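(* For $r\in\{0,1,2,\dots\}\cup\{\infty\}$, let $\mathcal{L}_r$ be the collection of all $H^2$-wavelets $\psi$ such that the associated space $V_0=V_0(\psi)$ is $\mathcal{G}_r$-invariant, and let $\mathcal{M}_r=\mathcal{L}_r\setminus\mathcal{L}_{r+1}$ for finite $r\ge 0$ and $\mathcal{M}_\infty=\mathcal{L}_\infty$. Then each of the classes $\mathcal{M}_r$, $r\in\{0,1,2,\dots\}\cup\{\infty\}$, is non-empty.
   Context: The Fourier transform is $\hat f(\xi)=\int_{\mathbb{R}} f(x)e^{-i\xi x}\,dx$ (extended to $L^2(\mathbb{R})$ as usual). The Hardy space is $H^2(\mathbb{R})=\{f\in L^2(\mathbb{R}):\hat f(\xi)=0\text{ for a.e. }\xi\le 0\}$. A function $\psi\in H^2(\mathbb{R})$ is an $H^2$-wavelet if $\{\psi_{j,k}=2^{j/2}\psi(2^j\cdot-k):j,k\in\mathbb{Z}\}$ is an orthonormal basis of $H^2(\mathbb{R})$. For an $H^2$-wavelet $\psi$, $V_0(\psi)$ is the closed linear span in $H^2(\mathbb{R})$ of $\{\psi_{l,k}:l<0,\ k\in\mathbb{Z}\}$. For $y\in\mathbb{R}$, $T_y$ is the translation operator $T_yf(x)=f(x-y)$. Set $\mathcal{G}_r=\{T_{m/2^r}:m\in\mathbb{Z}\}$ for integers $r\ge0$ and $\mathcal{G}_\infty=\{T_y:y\in\mathbb{R}\}$. If $\mathcal{G}$ is a set of bounded linear operators on $H^2(\mathbb{R})$ and $V$ is a closed subspace of $H^2(\mathbb{R})$, then $V$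 is called $\mathcal{G}$-invariant if $Tf\in V$ for every $f\in V$ and every $T\in\mathcal{G}$. *)

(* Defs.v *)
From HB Require Import structures.
From mathcomp Require Import all_boot all_order all_algebra.
From mathcomp Require Import complex.
From mathcomp Require Import all_classical all_reals all_analysis.
Set Implicit Arguments.
Unset Strict Implicit.
Unset Printing Implicit Defensive.
Import Order.TTheory GRing.Theory Num.Theory.
Import numFieldNormedType.Exports.
Import ComplexField.Normc.
Local Open Scope classical_set_scope.
Local Open Scope complex_scope.
Local Open Scope ring_scope.

(* Elements of L^1, L^2 and H^2 are represented by functions R -> R[i] rather
   than by a.e. classes; every set of functions below that consists of L^2
   functions is stable under a.e. equality (of measurable functions). *)
Section Defs.
Variable R : realType.
Local Notation C := R[i].
Local Notation mu := (@lebesgue_measure R).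
Implicit Types (f g psi : R -> C) (x y xi : R) (j k : int).

Definition Cmeasurable f : Prop :=
  measurable_fun setT (fun x => complex.Re (f x)) /\
  measurable_fun setT (fun x => complex.Im (f x)).

Definition Cnorm (p : R) f : \bar R := Lnorm mu p%:E (fun x => (normc (f x))%:E).

Definition CL (p : R) : set (R -> C) :=
  [set f | Cmeasurable f /\ (Cnorm p f < +oo)%E].

Definition Cintegral f : C :=
  (\int[mu]_x complex.Re (f x)) +i* (\int[mu]_x complex.Im (f x)).

Definition inner f g : C := Cintegral (fun x => f x * conjc (g x)).

Definition expi x : C := cos x +i* sin x.

Definition fourier f xi : C := Cintegral (fun x => f x * expi (- (xi * x))).

Definition L2_cvg (f_ : nat -> R -> C) f : Prop :=
  (fun n => Cnorm 2 (f_ n \- f)) @ \oo --> 0%E.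

(* The graph of the L^2 Fourier transform: the extension by continuity, from
   the dense subspace L^1 `&` L^2, of the integral transform. *)
Definition is_L2_fourier f g : Prop :=
  CL 2 g /\
  exists f_ : nat -> R -> C,
    [/\ forall n, (CL 1 `&` CL 2) (f_ n),
        L2_cvg f_ f
      & L2_cvg (fun n => fourier (f_ n)) g].

Definition hardy : set (R -> C) :=
  [set f | CL 2 f /\
     exists2 g, is_L2_fourier f g & {ae mu, forall xi, xi <= 0 -> g xi = 0}].

Definition closed_span (S : set (R -> C)) : set (R -> C) :=
  [set f | hardy f /\
     forall e : R, 0 < e ->
       exists (n : nat) (c : 'I_n -> C) (u : 'I_n -> R -> C),
         (forall i, S (u i)) /\
         (Cnorm 2 (fun x => f x - \sum_(i < n) c i * u i x)%R < e%:E)%E].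

Definition hardy_orthonormal_basis (I : eqType) (u : I -> R -> C) : Prop :=
  [/\ forall i, hardy (u i),
      forall i j : I, inner (u i) (u j) = (i == j)%:R
    & hardy `<=` closed_span (range u)].

Definition wavelet_system psi (jk : int * int) : R -> C :=
  fun x => (2 `^ (jk.1%:~R / 2))%:C * psi (2 ^ jk.1 * x - jk.2%:~R).

Definition H2_wavelet psi : Prop :=
  hardy psi /\ hardy_orthonormal_basis (wavelet_system psi).

Definition V0 psi : set (R -> C) :=
  closed_span [set wavelet_system psi lk | lk in [set lk : int * int | lk.1 < 0]].

Definition translation y f : R -> C := fun x => f (x - y).

(* [None] stands for r = oo. *)
Definition translations (r : option nat) : set ((R -> C) -> (R -> C)) :=
  if r is Some n
  then [set translation (m%:~R / 2 ^+ n) | m in [set: int]]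
  else [set translation y | y in [set: R]].

Definition op_invariant (G : set ((R -> C) -> (R -> C))) (V : set (R -> C)) :=
  forall T, G T -> forall f, V f -> V (T f).

Definition calL (r : option nat) : set (R -> C) :=
  [set psi | H2_wavelet psi /\ op_invariant (translations r) (V0 psi)].

Definition calM (r : option nat) : set (R -> C) :=
  if r is Some n then calL (Some n) `\` calL (Some n.+1) else calL None.

End Defs.

(* Main.v *)
Require Import Defs.
From mathcomp Require Import all_boot all_order all_algebra.
From mathcomp Require Import complex zify ring lra.
From mathcomp Require Import all_classical all_reals all_analysis.
From mathcomp Require Import measurable_realfun.

(** The wavelets are built on the frequency side: psi = phi G is the inverse
Fourier transform of a step function G that vanishes on the negative
half-line.  The transforms of the functions psi_jk are the functions
  2^(-j/2) G (2^-j xi) exp (- i k 2^-j xi)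
(called [Gd G (j, k)] below), and a change of variable shows that every inner
product of a translate by y of psi_lk with psi_jk', for l <= j, is a multiple of
  corr d th = int G (2^d eta) conj (G eta) exp (i th eta) d eta
at d = j - l and th = k' - 2^d k - 2^j y.  Hence everything can be read off
from these correlations:
- the psi_jk are orthonormal as soon as corr 0 q = 2 pi [q = 0] and
  corr d q = 0 for all integers q and d > 0;
- when they also span the Hardy space, V_0 is the orthogonal complement, in
  that space, of the psi_jk with j >= 0, so V_0 is invariant under the translation by y if
  corr d (q - 2^j y) = 0 for all integers q and 0 <= j < d
  ([translation_V0]), and only if corr 1 (- y) = 0 ([translation_V0_inv]).

For r = oo take G = 1 on ]2 pi, 4 pi].  The dyadic dilates of G have disjoint
supports, so corr d vanishes identically for d > 0, and all translations are
allowed.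

For finite r let n = 2^r, T = 2 pi n, A = ]a0, a1] and B = A + T.  The function
G is 1/sqrt 2 on A, B and 2A, it is - 1/sqrt 2 on 2B, and it is 1 on two further
intervals F1 and F2 ([stepG]).  The numbers a0 and a1 are chosen such that
- A, F1 - 2T, 2A = 2B - 2T and F2 - 2T tile a period ]a0, a0 + 2 pi], which
  gives corr 0 q = 2 pi [q = 0];
- F1, 2B and F2 tile 2^s ]a1, 2 a0] with s = r + 2, so that together with A
  they tile the octave ]a0, 2 a0] up to dyadic dilation, and the only overlaps
  of G with a dilate of G are that of A with 2A and that of B with 2B.
The two overlaps contribute with opposite signs.  As B is a translate of A,
  corr 1 th = (1 - exp (i th T)) / 2 * int_A exp (i th eta) d eta
([corr_near]) while corr d = 0 for d >= 2.  The first factor vanishes for th in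
(1/n) Z, in particular for integral th, and this is orthonormality together with
invariance under translations by m / 2^r.  At th = - 1 / (2 n) the first factor
is 2 and the second one is not zero because A is short, so V_0 is not invariant
under the translation by 1 / 2^(r+1).

It remains to see that the system spans.  Multiplying G (2^-j xi) by
trigonometric polynomials in 2^-j xi produces, in the limit, the restriction of
G (2^-j xi) to any arc of frequencies modulo 2 pi ([arc_span]).  An arc inside
F1 or F2 isolates the indicator function of an interval.  An arc inside A
produces at level j a multiple of the sum of the indicator functions of an
interval and of its translate by T; the doubled arc inside 2A produces at level
j - 1 their difference.  So the indicator functions of all subintervals of an
octave are in the closed span, and then those of all intervals of the positive
half-line, where they span L2 ([complete_of_good]).

The transfer between the two sides is Plancherel's theorem.  It is proved for
step functions from int (1 - cos (t x)) / x^2 dx = pi |t| ([int_1cos]) and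
extended by density ([plancherel]). *)

Set Implicit Arguments.
Unset Strict Implicit.
Unset Printing Implicit Defensive.
Import Order.TTheory GRing.Theory Num.Theory.
Import numFieldNormedType.Exports.
Import ComplexField.Normc.
Local Open Scope classical_set_scope.
Local Open Scope complex_scope.
Local Open Scope ring_scope.
Local Notation Re := complex.Re.
Local Notation Im := complex.Im.

(** * Complex numbers through real and imaginary parts *)
Section ComplexBasics.
Variable R : realType.
Implicit Types (z w : R[i]) (x y : R).

Lemma ReD z w : Re (z + w) = Re z + Re w. Proof. by case: z w => a b [c d]. Qed.
Lemma ImD z w : Im (z + w) = Im z + Im w. Proof. by case: z w => a b [c d]. Qed.
Lemma ReN z : Re (- z) = - Re z. Proof. by case: z. Qed.
Lemma ImN z : Im (- z) = - Im z. Proof. by case: z. Qed.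
Lemma ReM z w : Re (z * w) = Re z * Re w - Im z * Im w.
Proof. by case: z w => a b [c d]. Qed.
Lemma ImM z w : Im (z * w) = Re z * Im w + Im z * Re w.
Proof. by case: z w => a b [c d]. Qed.
Lemma ReJ z : Re (conjc z) = Re z. Proof. by case: z. Qed.
Lemma ImJ z : Im (conjc z) = - Im z. Proof. by case: z. Qed.
Lemma conjcD z w : conjc (z + w) = conjc z + conjc w.
Proof. exact: rmorphD. Qed.
Lemma conjcM z w : conjc (z * w) = conjc z * conjc w.
Proof. exact: rmorphM. Qed.
Lemma ReC x : Re x%:C = x. Proof. by []. Qed.
Definition ReImE := (ReD, ImD, ReN, ImN, ReM, ImM, ReJ, ImJ).

Lemma Ceq z w : Re z = Re w -> Im z = Im w -> z = w.
Proof. by case: z w => a b [c d] /= -> ->. Qed.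

Definition nsq z : R := Re z ^+ 2 + Im z ^+ 2.

Lemma nsq_ge0 z : 0 <= nsq z. Proof. by rewrite addr_ge0 ?sqr_ge0. Qed.
Lemma normcE z : normc z = Num.sqrt (nsq z). Proof. by case: z. Qed.
Lemma normc_sqr z : normc z ^+ 2 = nsq z.
Proof. by rewrite normcE sqr_sqrtr// nsq_ge0. Qed.
Lemma normc_ge0 z : 0 <= normc z. Proof. by rewrite normcE sqrtr_ge0. Qed.
Lemma nsqM z w : nsq (z * w) = nsq z * nsq w.
Proof. rewrite /nsq !ReImE; ring. Qed.
Lemma nsqJ z : nsq (conjc z) = nsq z.
Proof. by rewrite /nsq !ReImE sqrrN. Qed.
Lemma nsqN z : nsq (- z) = nsq z.
Proof. by rewrite /nsq !ReImE !sqrrN. Qed.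
Lemma nsq_real x : nsq x%:C = x ^+ 2.
Proof. by rewrite /nsq /= expr0n addr0. Qed.
Lemma nsq0 : nsq 0 = 0. Proof. by rewrite nsq_real expr0n. Qed.
Lemma nsqD_le z w : nsq (z + w) <= 2 * nsq z + 2 * nsq w.
Proof.
rewrite /nsq !ReImE.
have h (a b : R) : (a + b) ^+ 2 <= 2 * a ^+ 2 + 2 * b ^+ 2.
  by have := sqr_ge0 (a - b); lra.
by have := h (Re z) (Re w); have := h (Im z) (Im w); lra.
Qed.
Lemma Re_le_normc z : `|Re z| <= normc z.
Proof.
rewrite normcE -sqrtr_sqr ler_sqrt ?nsq_ge0//.
by rewrite /nsq lerDl sqr_ge0.
Qed.
Lemma Im_le_normc z : `|Im z| <= normc z.
Proof.
rewrite normcE -sqrtr_sqr ler_sqrt ?nsq_ge0//.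
by rewrite /nsq lerDr sqr_ge0.
Qed.
Lemma normc_le z : normc z <= `|Re z| + `|Im z|.
Proof.
rewrite normcE -[leRHS]ger0_norm ?addr_ge0// -sqrtr_sqr ler_sqrt ?sqr_ge0//.
rewrite /nsq -(real_normK (num_real (Re z))) -(real_normK (num_real (Im z))) sqrrD.
by have := mulr_ge0 (normr_ge0 (Re z)) (normr_ge0 (Im z)); lra.
Qed.
Lemma mulCJ z : z * conjc z = (nsq z)%:C.
Proof. apply: Ceq; rewrite !ReImE/= /nsq; ring. Qed.

Lemma expiD x y : expi (x + y) = expi x * expi y.
Proof. by apply: Ceq; rewrite /expi ?ReImE/= ?cosD ?sinD; ring. Qed.
Lemma expiN x : expi (- x) = conjc (expi x).
Proof. by apply: Ceq; rewrite /expi ?ReImE/= ?cosN ?sinN. Qed.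
Lemma expi0 : expi 0 = 1 :> R[i].
Proof. by apply: Ceq; rewrite /expi/= ?cos0 ?sin0. Qed.
Lemma nsq_expi x : nsq (expi x) = 1.
Proof. by rewrite /nsq /= cos2Dsin2. Qed.

End ComplexBasics.

(** * Square-integrable functions and their inner product *)
Section L2.
Variable R : realType.
Local Notation C := R[i].
Local Notation mu := (@lebesgue_measure R).
Implicit Types (f g h : R -> C) (c : C).

Lemma cmeas_add f g : Cmeasurable f -> Cmeasurable g -> Cmeasurable (f \+ g).
Proof.
move=> [f1 f2] [g1 g2]; split; under eq_fun do rewrite /= !ReImE;
 exact: measurable_funD.
Qed.
Lemma cmeas_mul f g : Cmeasurable f -> Cmeasurable g -> Cmeasurable (f \* g).
Proof.
move=> [f1 f2] [g1 g2]; split; under eq_fun do rewrite /= !ReImE.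
  by apply: measurable_funB; exact: measurable_funM.
by apply: measurable_funD; exact: measurable_funM.
Qed.
Lemma cmeas_cst c : Cmeasurable (fun _ : R => c).
Proof. by split; exact: measurable_cst. Qed.
Lemma cmeas_conj f : Cmeasurable f -> Cmeasurable (fun x => conjc (f x)).
Proof.
move=> [f1 f2]; split; [under eq_fun do rewrite ReJ|under eq_fun do rewrite ImJ] => //.
exact: measurable_funN.
Qed.
Lemma cmeas_scale c f : Cmeasurable f -> Cmeasurable (fun x => c * f x).
Proof. by move=> mf; apply: cmeas_mul => //; exact: cmeas_cst. Qed.
Lemma cmeas_opp f : Cmeasurable f -> Cmeasurable (fun x => - f x).
Proof.
move=> mf; under eq_fun do rewrite -mulN1r; exact: cmeas_scale.
Qed.
Lemma cmeas_sub f g : Cmeasurable f -> Cmeasurable g -> Cmeasurable (f \- g).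
Proof. by move=> mf mg; apply: cmeas_add => //; exact: cmeas_opp. Qed.
Lemma cmeas_real (f : R -> R) : measurable_fun setT f ->
  Cmeasurable (fun x => (f x)%:C).
Proof. by move=> mf; split => //=; exact: measurable_cst. Qed.
Lemma cmeas_comp f (u : R -> R) : measurable_fun setT u -> Cmeasurable f ->
  Cmeasurable (f \o u).
Proof.
move=> mu_ [f1 f2]; split.
  exact: (measurableT_comp f1 mu_).
exact: (measurableT_comp f2 mu_).
Qed.
Lemma cmeas_expi (u : R -> R) : measurable_fun setT u ->
  Cmeasurable (fun x => expi (u x)).
Proof.
move=> mu_; split => /=.
  apply: (measurableT_comp _ mu_); apply: continuous_measurable_fun.
  exact: continuous_cos.
apply: (measurableT_comp _ mu_); apply: continuous_measurable_fun.
exact: continuous_sin.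
Qed.

Lemma meas_nsq f : Cmeasurable f -> measurable_fun setT (fun x => nsq (f x)).
Proof.
by move=> [f1 f2]; apply: measurable_funD; exact: measurable_funX.
Qed.
Lemma meas_normc f : Cmeasurable f -> measurable_fun setT (fun x => normc (f x)).
Proof.
move=> mf; under eq_fun do rewrite normcE.
apply: (@measurableT_comp _ _ _ _ _ _ (@Num.sqrt R)); last exact: meas_nsq.
apply: continuous_measurable_fun; exact: sqrt_continuous.
Qed.

(** The squared norm, as an extended real: unlike the norm it needs no square
root, and its value is an integral to which convergence theorems apply. *)
Definition sqn f : \bar R := (\int[mu]_x (nsq (f x))%:E)%E.

Lemma sqn_ge0 f : (0 <= sqn f)%E.
Proof. by apply: integral_ge0 => x _; rewrite lee_fin nsq_ge0. Qed.

Lemma Cnorm2E f : Cnorm 2 f = (sqn f `^ 2^-1)%E.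
Proof.
rewrite /Cnorm unlock; congr (_ `^ _)%E; apply: eq_integral => x _.
rewrite abse_EFin ger0_norm ?normc_ge0// poweR_EFin powR_mulrn ?normc_ge0//.
by rewrite normc_sqr.
Qed.

Lemma Cnorm1E f : Cnorm 1 f = (\int[mu]_x (normc (f x))%:E)%E.
Proof.
rewrite /Cnorm Lnorm1; apply: eq_integral => x _.
by rewrite abse_EFin ger0_norm ?normc_ge0.
Qed.

Definition Cintegrable f :=
  mu.-integrable setT (EFin \o (fun x => Re (f x))) /\
  mu.-integrable setT (EFin \o (fun x => Im (f x))).

Lemma CL2P f : CL 2 f <-> Cmeasurable f /\ (sqn f < +oo)%E.
Proof.
rewrite /CL /= Cnorm2E; split=> -[mf h]; split=> //; last exact: poweR_lty.
have := sqn_ge0 f; move: h; case: (sqn f) => [s _ _|h _|//].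
  exact: ltry.
by move: h; rewrite /poweR invr_eq0 pnatr_eq0.
Qed.

Lemma CL1P f : CL 1 f <-> Cmeasurable f /\ (\int[mu]_x (normc (f x))%:E < +oo)%E.
Proof. by rewrite /CL /= Cnorm1E. Qed.

Lemma L2_meas f : CL 2 f -> Cmeasurable f. Proof. by case. Qed.
Lemma L2_fin f : CL 2 f -> (sqn f < +oo)%E. Proof. by move/CL2P => []. Qed.

Lemma le_sqn f g : Cmeasurable f -> Cmeasurable g ->
  (forall x, nsq (f x) <= nsq (g x)) -> (sqn f <= sqn g)%E.
Proof.
move=> mf mg fg; apply: ge0_le_integral => //.
- by move=> x _; rewrite lee_fin nsq_ge0.
- by apply/measurable_EFinP; exact: meas_nsq.
- by apply/measurable_EFinP; exact: meas_nsq.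
- by move=> x _; rewrite lee_fin.
Qed.

Lemma eq_sqn f g : (forall x, nsq (f x) = nsq (g x)) -> sqn f = sqn g.
Proof. by move=> fg; apply: eq_integral => x _; rewrite fg. Qed.

(** Integrates |z + w|^2 <= 2 |z|^2 + 2 |w|^2; with [sqn_tri] it serves as the
triangle inequality in approximation arguments. *)
Lemma sqnD_le f g : Cmeasurable f -> Cmeasurable g ->
  (sqn (f \+ g)%R <= 2%:E * sqn f + 2%:E * sqn g)%E.
Proof.
move=> mf mg; have mf2 := meas_nsq mf; have mg2 := meas_nsq mg.
rewrite /sqn -!ge0_integralZl_EFin//; try by [apply/measurable_EFinP|
  move=> x _; rewrite lee_fin nsq_ge0].
rewrite -ge0_integralD//; first last.
- by apply: measurable_funeM; apply/measurable_EFinP.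
- by move=> x _; rewrite mule_ge0// lee_fin nsq_ge0.
- by apply: measurable_funeM; apply/measurable_EFinP.
- by move=> x _; rewrite mule_ge0// lee_fin nsq_ge0.
apply: ge0_le_integral => //.
- by move=> x _; rewrite lee_fin nsq_ge0.
- by apply/measurable_EFinP; apply: meas_nsq; exact: cmeas_add.
- by apply: emeasurable_funD; apply: measurable_funeM; apply/measurable_EFinP.
- by move=> x _; rewrite -!EFinM -EFinD lee_fin nsqD_le.
Qed.

Lemma sqnZ c f : Cmeasurable f ->
  sqn (fun x => c * f x) = ((nsq c)%:E * sqn f)%E.
Proof.
move=> mf; rewrite /sqn -ge0_integralZl_EFin ?nsq_ge0//.
- by apply: eq_integral => x _; rewrite nsqM EFinM.
- by move=> x _; rewrite lee_fin nsq_ge0.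
- by apply/measurable_EFinP; exact: meas_nsq.
Qed.

Lemma sqnN f : sqn (fun x => - f x) = sqn f.
Proof. by apply: eq_sqn => x; rewrite nsqN. Qed.

Lemma sqnBC f g : sqn (f \- g) = sqn (g \- f).
Proof. by rewrite -sqnN; apply: eq_sqn => x /=; rewrite opprB. Qed.

Lemma sqn_tri f g h : Cmeasurable f -> Cmeasurable g -> Cmeasurable h ->
  (sqn (f \- h)%R <= 2%:E * sqn (f \- g)%R + 2%:E * sqn (g \- h)%R)%E.
Proof.
move=> mf mg mh; have := sqnD_le (cmeas_sub mf mg) (cmeas_sub mg mh).
by rewrite [X in (sqn X <= _)%E](_ : _ = (f \- h)%R)//; apply/funext => x /=; rewrite addrA subrK.
Qed.

Lemma L2D f g : CL 2 f -> CL 2 g -> CL 2 (f \+ g).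
Proof.
move=> /CL2P[mf hf] /CL2P[mg hg]; apply/CL2P; split; first exact: cmeas_add.
apply: le_lt_trans (sqnD_le mf mg) _.
by rewrite lte_add_pinfty// lte_mul_pinfty.
Qed.
Lemma L2Z c f : CL 2 f -> CL 2 (fun x => c * f x).
Proof.
move=> /CL2P[mf hf]; apply/CL2P; split; first exact: cmeas_scale.
by rewrite sqnZ// lte_mul_pinfty// lee_fin nsq_ge0.
Qed.
Lemma L2N f : CL 2 f -> CL 2 (fun x => - f x).
Proof. by move/(L2Z (-1)); under eq_fun do rewrite mulN1r. Qed.
Lemma L2B f g : CL 2 f -> CL 2 g -> CL 2 (f \- g).
Proof. by move=> Lf Lg; apply: L2D => //; exact: L2N. Qed.
Lemma L20 : CL 2 (fun _ : R => 0 : C).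
Proof.
apply/CL2P; split; first exact: cmeas_cst.
by rewrite /sqn; under eq_integral do rewrite nsq0; rewrite integral0.
Qed.
Lemma L2_sum n (F : 'I_n -> R -> C) :
  (forall i, CL 2 (F i)) -> CL 2 (fun x => \sum_(i < n) F i x).
Proof.
elim: n F => [|n IH] F LF.
  by under eq_fun do rewrite big_ord0; exact: L20.
under eq_fun do rewrite big_ord_recr/=.
by apply: L2D => //; apply: IH.
Qed.
Lemma L2_le f g : Cmeasurable f -> CL 2 g ->
  (forall x, nsq (f x) <= nsq (g x)) -> CL 2 f.
Proof.
move=> mf /CL2P[mg hg] fg; apply/CL2P; split => //.
exact: le_lt_trans (le_sqn mf mg fg) hg.
Qed.

Definition n2 f : R := fine (sqn f).
Lemma sqnE f : CL 2 f -> sqn f = (n2 f)%:E.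
Proof. by move=> /L2_fin Lf; rewrite /n2 fineK// ge0_fin_numE// sqn_ge0. Qed.
Lemma n2_ge0 f : 0 <= n2 f. Proof. exact/fine_ge0/sqn_ge0. Qed.

Arguments inner {R} : simpl never.
Arguments Cintegral {R} : simpl never.

Lemma ReCintegral f : Re (Cintegral f) = \int[mu]_x Re (f x). Proof. by []. Qed.
Lemma ImCintegral f : Im (Cintegral f) = \int[mu]_x Im (f x). Proof. by []. Qed.

Lemma integrable_le (u B : R -> R) : measurable_fun setT u ->
  (forall x, `|u x| <= B x) -> mu.-integrable setT (EFin \o B) ->
  mu.-integrable setT (EFin \o u).
Proof.
move=> mu_ uB iB; apply: (le_integrable _ _ _ iB) => //; first exact/measurable_EFinP.
by move=> x _ /=; rewrite lee_fin (le_trans (uB x))// ler_norm.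
Qed.

Lemma integrableD_R (u v : R -> R) : mu.-integrable setT (EFin \o u) ->
  mu.-integrable setT (EFin \o v) ->
  mu.-integrable setT (EFin \o (fun x => u x + v x)).
Proof. by move=> iu iv; exact: (@integrableD _ _ _ mu setT measurableT _ _ iu iv). Qed.
Lemma integrableB_R (u v : R -> R) : mu.-integrable setT (EFin \o u) ->
  mu.-integrable setT (EFin \o v) ->
  mu.-integrable setT (EFin \o (fun x => u x - v x)).
Proof. by move=> iu iv; exact: (@integrableB _ _ _ mu setT measurableT _ _ iu iv). Qed.

Lemma Cintegrable_le h (B : R -> R) : Cmeasurable h ->
  (forall x, normc (h x) <= B x) -> mu.-integrable setT (EFin \o B) ->
  Cintegrable h.
Proof.
move=> [h1 h2] hB iB; split; apply: (integrable_le _ _ iB) => // x.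
  exact: le_trans (Re_le_normc _) _.
exact: le_trans (Im_le_normc _) _.
Qed.

Lemma L1_norm_integrable f : CL 1 f ->
  mu.-integrable setT (EFin \o (fun x => normc (f x))).
Proof.
move=> /CL1P[mf hf]; apply/integrableP; split.
  by apply/measurable_EFinP; exact: meas_normc.
by under eq_integral do rewrite /= ger0_norm ?normc_ge0//.
Qed.

Lemma L1_Cintegrable f : CL 1 f -> Cintegrable f.
Proof.
move=> Lf; apply: (@Cintegrable_le _ (fun x => normc (f x))) => //.
  by case: Lf.
exact: L1_norm_integrable.
Qed.

Lemma Cintegrable_meas f : Cintegrable f -> Cmeasurable f.
Proof. 
move=> [f1 f2]; split; apply/measurable_EFinP.
  exact: (measurable_int _ f1).
exact: (measurable_int _ f2).
 Qed.

Lemma Cintegrable_L1 f : Cintegrable f -> CL 1 f.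
Proof.
move=> If; have mf := Cintegrable_meas If; case: If => f1 f2; apply/CL1P; split=> //.
have : mu.-integrable setT (EFin \o (fun x => normc (f x))).
  apply: (@integrable_le _ (fun x => `|Re (f x)| + `|Im (f x)|)).
  - exact: meas_normc.
  - by move=> x; rewrite ger0_norm ?normc_ge0// normc_le.
  - by apply: integrableD_R; exact: integrable_norm.
move=> /integrableP[_].
by under eq_integral do rewrite /= ger0_norm ?normc_ge0//.
Qed.

Lemma CintegrableD f g : Cintegrable f -> Cintegrable g -> Cintegrable (f \+ g).
Proof.
move=> [f1 f2] [g1 g2]; split.
  by under eq_fun do rewrite /= ReD; exact: integrableD_R.
by under eq_fun do rewrite /= ImD; exact: integrableD_R.
Qed.

Lemma CintegralD f g : Cintegrable f -> Cintegrable g ->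
  Cintegral (f \+ g) = Cintegral f + Cintegral g.
Proof.
move=> [f1 f2] [g1 g2]; apply: Ceq; rewrite ?ReD ?ImD ?ReCintegral ?ImCintegral /=.
  by rewrite -RintegralD//; apply: eq_Rintegral => x _; rewrite ReD.
by rewrite -RintegralD//; apply: eq_Rintegral => x _; rewrite ImD.
Qed.

Lemma integrableZ_R (k : R) (u : R -> R) : mu.-integrable setT (EFin \o u) ->
  mu.-integrable setT (EFin \o (fun x => k * u x)).
Proof. by move=> iu; exact: (@integrableZl _ _ _ mu setT measurableT k _ iu). Qed.

Lemma CintegrableZ c f : Cintegrable f -> Cintegrable (fun x => c * f x).
Proof.
move=> [f1 f2]; split.
  under eq_fun do rewrite /= ReM.
  by apply: integrableB_R; exact: integrableZ_R.
under eq_fun do rewrite /= ImM.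
by apply: integrableD_R; exact: integrableZ_R.
Qed.

Lemma CintegralZ c f : Cintegrable f ->
  Cintegral (fun x => c * f x) = c * Cintegral f.
Proof.
move=> [f1 f2]; apply: Ceq; rewrite ?ReM ?ImM ?ReCintegral ?ImCintegral /=.
  rewrite -!RintegralZl// -RintegralB//; try exact: integrableZ_R.
  by apply: eq_Rintegral => x _; rewrite ReM.
rewrite -!RintegralZl// -RintegralD//; try exact: integrableZ_R.
by apply: eq_Rintegral => x _; rewrite ImM.
Qed.

Lemma eq_Cintegral f g : f =1 g -> Cintegral f = Cintegral g.
Proof. by move=> /funext ->. Qed.

Lemma Cintegral_conj f : Cintegrable f ->
  Cintegral (fun x => conjc (f x)) = conjc (Cintegral f).
Proof.
move=> [f1 f2]; apply: Ceq; rewrite ?ReJ ?ImJ ?ReCintegral ?ImCintegral /=.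
  by apply: eq_Rintegral => x _; rewrite ReJ.
rewrite -mulN1r -RintegralZl//.
by apply: eq_Rintegral => x _; rewrite ImJ mulN1r.
Qed.

Lemma L2_nsq_integrable f : CL 2 f ->
  mu.-integrable setT (EFin \o (fun x => nsq (f x))).
Proof.
move=> /CL2P[mk hk]; apply/integrableP; split.
  by apply/measurable_EFinP; exact: meas_nsq.
by under eq_integral do rewrite /= ger0_norm ?nsq_ge0//.
Qed.

(** The modulus of the product is at most the sum of the squared moduli. *)
Lemma L2_mul_integrable f g : CL 2 f -> CL 2 g ->
  Cintegrable (fun x => f x * conjc (g x)).
Proof.
move=> Lf Lg; have mf := L2_meas Lf; have mg := L2_meas Lg.
apply: (@Cintegrable_le _ (fun x => nsq (f x) + nsq (g x))).
- by apply: cmeas_mul => //; exact: cmeas_conj.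
- move=> x; rewrite normcE nsqM nsqJ.
  have a := nsq_ge0 (f x); have b := nsq_ge0 (g x).
  rewrite -(ger0_norm (addr_ge0 a b)) -sqrtr_sqr ler_sqrt ?sqr_ge0//.
  by have := mulr_ge0 a b; rewrite sqrrD; have := sqr_ge0 (nsq (f x));
    have := sqr_ge0 (nsq (g x)); lra.
- by apply: integrableD_R; exact: L2_nsq_integrable.
Qed.

Lemma innerDl f g h : CL 2 f -> CL 2 g -> CL 2 h ->
  inner (f \+ g) h = inner f h + inner g h.
Proof.
move=> Lf Lg Lh; rewrite /inner -CintegralD; try exact: L2_mul_integrable.
by apply: eq_Cintegral => x /=; rewrite mulrDl.
Qed.
Lemma innerZl c f h : CL 2 f -> CL 2 h -> inner (fun x => c * f x) h = c * inner f h.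
Proof.
move=> Lf Lh; rewrite /inner -CintegralZ; last exact: L2_mul_integrable.
by apply: eq_Cintegral => x; rewrite mulrA.
Qed.
Lemma innerC f g : CL 2 f -> CL 2 g -> inner g f = conjc (inner f g).
Proof.
move=> Lf Lg; rewrite /inner -Cintegral_conj; last exact: L2_mul_integrable.
by apply: eq_Cintegral => x; rewrite rmorphM/= conjcK mulrC.
Qed.
Lemma innerDr f g h : CL 2 f -> CL 2 g -> CL 2 h ->
  inner h (f \+ g) = inner h f + inner h g.
Proof.
move=> Lf Lg Lh; rewrite innerC//; last exact: L2D.
by rewrite innerDl// conjcD -(innerC Lf Lh) -(innerC Lg Lh).
Qed.
Lemma innerZr c f h : CL 2 f -> CL 2 h ->
  inner h (fun x => c * f x) = conjc c * inner h f.
Proof.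
move=> Lf Lh; rewrite innerC//; last exact: L2Z.
by rewrite innerZl// conjcM -(innerC Lf Lh).
Qed.
Lemma inner0l h : inner (fun=> 0) h = 0.
Proof.
rewrite /inner; under eq_fun do rewrite mul0r.
by apply: Ceq; rewrite ?ReCintegral ?ImCintegral /= Rintegral_cst// mul0r.
Qed.
Lemma inner_suml n (F : 'I_n -> R -> C) h : (forall i, CL 2 (F i)) -> CL 2 h ->
  inner (fun x => \sum_(i < n) F i x) h = \sum_(i < n) inner (F i) h.
Proof.
elim: n F => [|n IH] F LF Lh.
  by under eq_fun do rewrite big_ord0; rewrite inner0l big_ord0.
under eq_fun do rewrite big_ord_recr/=.
rewrite big_ord_recr/= -IH// -innerDl//.
by apply: L2_sum.
Qed.
Lemma inner_sumr n (F : 'I_n -> R -> C) h : (forall i, CL 2 (F i)) -> CL 2 h ->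
  inner h (fun x => \sum_(i < n) F i x) = \sum_(i < n) inner h (F i).
Proof.
move=> LF Lh; rewrite innerC//; last exact: L2_sum.
rewrite inner_suml//.
elim: n F LF => [|n IH] F LF; first by rewrite !big_ord0 rmorph0.
by rewrite !big_ord_recr/= conjcD -innerC// IH.
Qed.

Lemma innerff f : CL 2 f -> inner f f = (n2 f)%:C.
Proof.
move=> Lf; rewrite /inner; under eq_fun do rewrite mulCJ.
by apply: Ceq; rewrite ?ReCintegral ?ImCintegral//= Rintegral_cst// mul0r.
Qed.

Lemma n2D f g : CL 2 f -> CL 2 g ->
  n2 (f \+ g) = n2 f + n2 g + 2 * Re (inner f g).
Proof.
move=> Lf Lg; have LD := L2D Lf Lg.
rewrite -[n2 (f \+ g)]ReC -innerff// innerDl// !innerDr// !innerff// (innerC Lf Lg).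
by rewrite !ReImE !ReC; ring.
Qed.
Lemma n2Z c f : CL 2 f -> n2 (fun x => c * f x) = nsq c * n2 f.
Proof. by move=> Lf; rewrite /n2 sqnZ ?sqnE ?fineM//; exact: L2_meas. Qed.
Lemma n2B f g : CL 2 f -> CL 2 g ->
  n2 (f \- g) = n2 f + n2 g - 2 * Re (inner f g).
Proof.
move=> Lf Lg; rewrite [f \- g](_ : _ = f \+ (fun x => -1 * g x)); last first.
  by apply/funext => x /=; rewrite mulN1r.
rewrite n2D//; last exact: L2Z.
rewrite n2Z// innerZr// nsqN nsq_real expr1n mul1r !ReImE/=; ring.
Qed.

(** The squared norm of f - t <f, g> g is nonnegative for all real t; the choice
t = 1 / |g|^2 gives the inequality, and large t gives <f, g> = 0 when g = 0. *)
Lemma inner_CS f g : CL 2 f -> CL 2 g -> nsq (inner f g) <= n2 f * n2 g.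
Proof.
move=> Lf Lg; set c := inner f g.
have key (t : R) : 0 <= n2 f + t ^+ 2 * nsq c * n2 g - 2 * (t * nsq c).
  have := n2_ge0 (f \- (fun x => (t%:C * c) * g x)).
  rewrite n2B//; last exact: L2Z.
  rewrite n2Z// nsqM nsq_real innerZr// -/c.
  by rewrite (_ : Re _ = t * nsq c)// /nsq !ReImE/=; ring.
have := n2_ge0 g; rewrite le_eqVlt => /predU1P[g0|g0].
  rewrite -g0 mulr0 leNgt; apply/negP => c0.
  have := key ((n2 f + 1) / nsq c); rewrite -g0 mulr0 divfK ?gt_eqF//.
  by have := n2_ge0 f; lra.
have := key (n2 g)^-1.
have -> : (n2 g)^-1 ^+ 2 * nsq c * n2 g = nsq c / n2 g.
  by field; rewrite gt_eqF.
rewrite -ler_pdivrMr// (mulrC _ (nsq c)); lra.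
Qed.

End L2.

(** * Closed linear spans in L2 *)
Section Approx.
Variable R : realType.
Local Notation C := R[i].
Local Notation mu := (@lebesgue_measure R).
Implicit Types (f g h : R -> C) (c : C) (U V : set (R -> C)).

Lemma near_lt_ereal (a_ : nat -> \bar R) (e : R) : 0 < e ->
  a_ n @[n --> \oo] --> 0%E -> \forall n \near \oo, (a_ n < e%:E)%E.
Proof.
move=> e0 /fine_cvgP[finn /cvgr0_norm_lt /(_ _ e0) near_lt].
near=> n; have fn : a_ n \is a fin_num by near: n.
rewrite -(fineK fn) lte_fin (le_lt_trans (ler_norm _))//.
by near: n.
Unshelve. all: by end_near. Qed.

(** Dominated convergence. *)
Lemma sqn_cvg0 (h_ : nat -> R -> C) (B : R -> R) :
  (forall n, Cmeasurable (h_ n)) -> (forall n x, nsq (h_ n x) <= B x) ->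
  mu.-integrable setT (EFin \o B) ->
  (forall x, nsq (h_ n x) @[n --> \oo] --> (0 : R)) ->
  sqn (h_ n) @[n --> \oo] --> 0%E.
Proof.
move=> mh hB iB h0.
have := @dominated_convergence _ _ _ mu setT measurableT
  (fun n x => (nsq (h_ n x))%:E) (cst 0%E) (EFin \o B).
move=> /(_ _ _ _ iB _)[].
- by move=> n; apply/measurable_EFinP; exact: meas_nsq.
- exact: measurable_cst.
- by apply: aeW => x _; apply: cvg_EFin; [exact: nearW|exact: h0].
- by apply: aeW => x n _; rewrite /= ger0_norm ?nsq_ge0// lee_fin.
- by move=> _ _; rewrite integral0.
Qed.

Definition lincomb U : set (R -> C) :=
  [set f | exists n (c : 'I_n -> C) (u : 'I_n -> R -> C),
     (forall i, U (u i)) /\ f = fun x => \sum_(i < n) c i * u i x].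

Lemma lincomb_in U f : U f -> lincomb U f.
Proof.
move=> Uf; exists 1%N, (fun=> 1), (fun=> f); split => //.
by apply/funext => x; rewrite big_ord1 mul1r.
Qed.
Lemma lincomb0 U : lincomb U (fun=> 0).
Proof.
exists 0%N, (fun=> 0), (fun _ _ => 0); split; first by case.
by apply/funext => x; rewrite big_ord0.
Qed.
Lemma lincombZ U c f : lincomb U f -> lincomb U (fun x => c * f x).
Proof.
move=> [n [d [u [Uu ->]]]]; exists n, (fun i => c * d i), u; split => //.
by apply/funext => x; rewrite mulr_sumr; apply: eq_bigr => i _; rewrite mulrA.
Qed.
Lemma lincombD U f g : lincomb U f -> lincomb U g -> lincomb U (f \+ g).
Proof.
move=> [n [c [u [Uu ->]]]] [m [d [v [Uv ->]]]].
exists (n + m)%N, (fun i => match fintype.split i with inl i => c i | inr j => d j end),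
  (fun i => match fintype.split i with inl i => u i | inr j => v j end); split.
  by move=> i; case: (fintype.split i).
apply/funext => x; rewrite big_split_ord/=; congr (_ + _); apply: eq_bigr => i _.
  by rewrite (unsplitK (inl i)).
by rewrite (unsplitK (inr i)).
Qed.
Lemma lincomb_L2 U : U `<=` CL 2 -> lincomb U `<=` CL 2.
Proof.
move=> UL f [n [c [u [Uu ->]]]]; apply: L2_sum => i; apply: L2Z; exact/UL.
Qed.
(** The closed span in L2.  The closed span of the wavelet theory also asks for
membership in the Hardy space; without that condition the notion can be used on
both sides of the Fourier transform. *)
Definition clspan U : set (R -> C) :=
  [set f | CL 2 f /\ forall e : R, 0 < e ->
     exists2 s, lincomb U s & (sqn (f \- s)%R < e%:E)%E].

Lemma sqnBB f : sqn (f \- f) = 0%E.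
Proof. by rewrite /sqn; under eq_integral do rewrite /= subrr nsq0; rewrite integral0. Qed.

Section fixU.
Variable U : set (R -> C).
Hypothesis UL : U `<=` CL 2.

Lemma clspan_L2 f : clspan U f -> CL 2 f. Proof. by case. Qed.

Lemma clspan_lincomb f : lincomb U f -> clspan U f.
Proof.
move=> Uf; split; first exact: (lincomb_L2 UL).
by move=> e e0; exists f => //; rewrite sqnBB lte_fin.
Qed.
Lemma clspan_in f : U f -> clspan U f.
Proof. by move=> Uf; apply: clspan_lincomb; exact: lincomb_in. Qed.

Lemma clspan0 : clspan U (fun=> 0).
Proof. by apply: clspan_lincomb; exact: lincomb0. Qed.

Lemma clspan_approx f : CL 2 f ->
  (forall e : R, 0 < e -> exists2 s, clspan U s & (sqn (f \- s)%R < e%:E)%E) ->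
  clspan U f.
Proof.
move=> Lf h; split => // e e0.
have e4 : 0 < e / 4 by rewrite divr_gt0.
have [s [Ls /(_ _ e4)[t Ut st]] fs] := h _ e4.
exists t => //.
have Lt := lincomb_L2 UL Ut.
apply: le_lt_trans (sqn_tri (L2_meas Lf) (L2_meas Ls) (L2_meas Lt)) _.
rewrite (sqnE (L2B Lf Ls)) (sqnE (L2B Ls Lt)) in fs st *.
rewrite -!EFinM -EFinD lte_fin; move: fs st; rewrite !lte_fin; lra.
Qed.

Lemma clspan_cvg f (f_ : nat -> R -> C) : CL 2 f -> (forall n, clspan U (f_ n)) ->
  sqn (f \- f_ n)%R @[n --> \oo] --> 0%E -> clspan U f.
Proof.
move=> Lf Uf_ cv; apply: clspan_approx => // e e0.
have [n _ fn] := near_lt_ereal e0 cv; exists (f_ n) => //.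
by apply: fn => /=.
Qed.

Lemma clspanZ c f : clspan U f -> clspan U (fun x => c * f x).
Proof.
move=> [Lf h]; split; first exact: L2Z.
move=> e e0.
have c0 : 0 < nsq c + 1 by rewrite ltr_wpDl ?nsq_ge0.
have [s Us fs] := h (e / (nsq c + 1)) (divr_gt0 e0 c0).
exists (fun x => c * s x); first exact: lincombZ.
have Ls := lincomb_L2 UL Us.
rewrite (_ : _ \- _ = (fun x => c * (f \- s) x)); last first.
  by apply/funext => x /=; rewrite mulrBr.
rewrite sqnZ; last by apply: L2_meas; exact: L2B.
rewrite (sqnE (L2B Lf Ls)) -EFinM lte_fin.
move: fs; rewrite (sqnE (L2B Lf Ls)) lte_fin ltr_pdivlMr// => fs.
apply: le_lt_trans fs; rewrite mulrC ler_wpM2l ?n2_ge0//.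
by rewrite lerDl.
Qed.

Lemma clspanD f g : clspan U f -> clspan U g -> clspan U (f \+ g).
Proof.
move=> [Lf hf] [Lg hg]; split; first exact: L2D.
move=> e e0; have e4 : 0 < e / 4 by rewrite divr_gt0.
have [s Us fs] := hf _ e4; have [t Ut gt] := hg _ e4.
have Ls := lincomb_L2 UL Us; have Lt := lincomb_L2 UL Ut.
exists (s \+ t); first exact: lincombD.
rewrite (_ : _ \- _ = (f \- s) \+ (g \- t)); last first.
  by apply/funext => x /=; rewrite opprD addrACA.
apply: le_lt_trans (sqnD_le _ _) _; try by apply: L2_meas; exact: L2B.
rewrite (sqnE (L2B Lf Ls)) (sqnE (L2B Lg Lt)) in fs gt *.
rewrite -!EFinM -EFinD lte_fin; move: fs gt; rewrite !lte_fin; lra.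
Qed.

Lemma clspanB f g : clspan U f -> clspan U g -> clspan U (f \- g).
Proof.
move=> Uf Ug; rewrite (_ : _ \- _ = f \+ (fun x => -1 * g x)).
  by apply: clspanD => //; exact: clspanZ.
by apply/funext => x /=; rewrite mulN1r.
Qed.

Lemma clspan_sum (I : Type) (r : seq I) (F : I -> R -> C) :
  (forall i, clspan U (F i)) -> clspan U (fun x => \sum_(i <- r) F i x).
Proof.
move=> UF; elim: r => [|i r IH].
  by under eq_fun do rewrite big_nil; exact: clspan0.
by under eq_fun do rewrite big_cons; exact: (clspanD (UF i) IH).
Qed.

End fixU.
End Approx.

(** * Density of step functions *)
Section Density.
Variable R : realType.
Local Notation C := R[i].
Local Notation mu := (@lebesgue_measure R).
Implicit Types (f g h : R -> C) (A E : set R).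

Definition cind A (x : R) : C := (\1_A x)%:C.

Lemma nsq_cind A x : nsq (cind A x) = \1_A x.
Proof. by rewrite /cind nsq_real indicE; case: (_ \in _); rewrite ?expr1n ?expr0n. Qed.

Lemma meas_cind A : measurable A -> Cmeasurable (cind A).
Proof. by move=> mA; apply: cmeas_real; exact: measurable_indic. Qed.

Lemma sqn_cind A : measurable A -> sqn (cind A) = mu A.
Proof.
move=> mA; rewrite /sqn; under eq_integral do rewrite nsq_cind.
by rewrite integral_indic// setIT.
Qed.

Lemma L2_cind A : measurable A -> (mu A < +oo)%E -> CL 2 (cind A).
Proof. by move=> mA fA; apply/CL2P; rewrite sqn_cind//; split => //; exact: meas_cind. Qed.

Lemma mu_oc (a b : R) : mu `]a, b]%classic = (Num.max (b - a) 0)%:E.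
Proof.
rewrite lebesgue_measure_itv/= lte_fin.
by case: ltP => ab; [rewrite -EFinB max_l// subr_ge0 ltW|rewrite max_r// subr_le0].
Qed.

Definition steps : set (R -> C) :=
  [set f | exists a b : R, f = cind `]a, b]].

Lemma L2_itv (a b : R) : CL 2 (cind `]a, b]).
Proof. by apply: L2_cind => //; rewrite mu_oc ltry. Qed.

Lemma steps_L2 : steps `<=` CL 2. Proof. by move=> _ [a [b ->]]; exact: L2_itv. Qed.

Lemma ocI (a b c d : R) :
  `]a, b]%classic `&` `]c, d]%classic = `]Num.max a c, Num.min b d]%classic.
Proof.
apply/seteqP; split => x /=; rewrite !in_itv/= gt_max le_min.
  by move=> [/andP[-> ->] /andP[-> ->]].
by move=> /andP[/andP[-> ->] /andP[-> ->]].
Qed.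

Lemma cindE_itv (a b x : R) : cind `]a, b] x = (if a < x <= b then 1 else 0).
Proof.
rewrite /cind indicE (_ : (x \in _) = (a < x <= b)); first by case: ifP.
by apply/idP/idP; rewrite inE/= in_itv.
Qed.

Lemma cindT A x : A x -> cind A x = 1.
Proof. by move=> Ax; rewrite /cind indicE mem_set. Qed.
Lemma cindF A x : ~ A x -> cind A x = 0.
Proof. by move=> Ax; rewrite /cind indicE memNset. Qed.
Lemma cindI A E x : cind (A `&` E) x = cind A x * cind E x.
Proof. by rewrite /cind indicI -rmorphM. Qed.

(** For fixed M the sets E with this property form a lambda-system, by dominated
convergence, and the half-open intervals have it. *)
Lemma density_set E (M : R) : measurable (E : set (measurableTypeR R)) ->
  clspan steps (cind (E `&` `]- M, M])).
Proof.
pose H := [set E | measurable (E : set (measurableTypeR R)) /\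
  clspan steps (cind (E `&` `]- M, M]))].
have LH A : measurable A -> CL 2 (cind (A `&` `]- M, M])).
  move=> mA; apply: L2_cind; first exact: measurableI.
  apply: (@le_lt_trans _ _ (mu `]- M, M]%classic)); last by rewrite mu_oc ltry.
  by apply: le_measure; rewrite ?inE//; exact: measurableI.
suff : (@measurable _ (measurableTypeR R)) `<=` H by move=> /(_ E) + mE => /(_ mE)[].
apply: (@lambda_system_subset _ (@ocitv R)) => //.
- exact: ocitvI.
- split.
  + by [].
  + split => //; rewrite setTI; apply: clspan_in; first exact: steps_L2.
    by exists (- M), M.
  + move=> A B BA [mA cA] [mB cB]; split; first exact: measurableD.
    rewrite (_ : cind _ = cind (A `&` `]- M, M]) \- cind (B `&` `]- M, M])).
      by apply: clspanB => //; exact: steps_L2.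
    apply/funext => x /=; rewrite !(cindI _ `]- M, M]).
    have [Bx|nBx] := pselect (B x).
      rewrite (@cindF (A `\` B)) ?(cindT Bx) ?(cindT (BA _ Bx)) ?subrr ?mul0r//.
      by case.
    rewrite (cindF nBx) mul0r subr0; congr (_ * _).
    have [Ax|nAx] := pselect (A x); first by rewrite !cindT.
    by rewrite !cindF// => -[].
  + move=> F ndF HF; have mF n : measurable (F n) by have [] := HF n.
    have mbF : measurable (\bigcup_n F n) by exact: bigcupT_measurable.
    split => //.
    apply: (@clspan_cvg _ _ (@steps_L2) _ (fun n => cind (F n `&` `]- M, M]))).
    * exact: LH.
    * by move=> n; have [] := HF n.
    * have LM := L2_itv (- M) M.
      apply: (@sqn_cvg0 _ _ (fun x => \1_(`]- M, M]%classic) x)).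
      - by move=> n; apply: cmeas_sub; apply: L2_meas; exact: LH.
      - move=> n x /=; rewrite !cindI -mulrBl nsqM nsq_cind ler_piMl//.
        have [Fx|nFx] := pselect (F n x).
          rewrite (cindT Fx) (@cindT (\bigcup_n F n)) ?subrr ?nsq0//.
          by exists n.
        by rewrite (cindF nFx) subr0 nsq_cind indicE; case: (_ \in _).
      - apply/integrableP; split.
          by apply/measurable_EFinP; exact: measurable_indic.
        have := L2_fin LM; rewrite /sqn; congr (_ < _)%E.
        by apply: eq_integral => x _; rewrite nsq_cind /= ger0_norm.
      - move=> x /=; under eq_fun do rewrite !cindI -mulrBl nsqM nsq_cind.
        have [[N _ FN]|nF] := pselect ((\bigcup_n F n) x).
          apply: cvg_near_cst; exists N => // n /= Nn.
          rewrite (@cindT (\bigcup_n F n)); last by exists N.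
          rewrite (@cindT (F n)) ?subrr ?nsq0 ?mul0r//.
          by have /subsetPset := ndF _ _ Nn; apply.
        rewrite (cindF nF); apply: cvg_near_cst; apply: nearW => n.
        rewrite cindF ?subrr ?nsq0 ?mul0r// => Fx; apply: nF; by exists n.
- move=> A [[a b] _ <-] /=; split.
    exact: measurable_itv.
  apply: clspan_in; first exact: steps_L2.
  by rewrite ocI; eexists; eexists.
Qed.

Import HBNNSimple.

Lemma cind_cut (x : R) : \forall n \near \oo, cind `]- (n%:R : R), n%:R] x = 1.
Proof.
near=> n; rewrite cindE_itv ifT//.
have xn : `|x| < n%:R by near: n; exact: nbhs_infty_gtr.
by move: xn; rewrite ltr_norml => /andP[-> /ltW].
Unshelve. all: by end_near. Qed.

(** A nonnegative function is the increasing limit of simple functions; cutting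
these to ]-n, n] makes them combinations of indicators of bounded sets. *)
Lemma density_ge0 (u : R -> R) : (forall x, 0 <= u x) ->
  CL 2 (fun x => (u x)%:C) -> clspan steps (fun x => (u x)%:C).
Proof.
move=> u0 Lu; have [mu_ _] := L2_meas Lu; rewrite /= in mu_.
have mue : measurable_fun setT (EFin \o u) by exact/measurable_EFinP.
pose g := nnsfun_approx measurableT mue.
pose I n : set R := `]- (n%:R : R), n%:R]%classic.
have g0 n x : 0 <= g n x by [].
have gu n x : g n x <= u x.
  by rewrite /g nnsfun_approxE -lee_fin; apply: le_approx => // y _; rewrite lee_fin.
have gcv x : g n x @[n --> \oo] --> u x.
  have : EFin \o g^~ x @ \oo --> (EFin \o u) x.
    by apply: cvg_nnsfun_approx => // y _; rewrite lee_fin.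
  by move/fine_cvgP => [].
have gspan n : clspan steps (fun x => (g n x)%:C * cind (I n) x).
  rewrite (_ : (fun x => _) = fun x => \sum_(y <- finmap.enum_fset (fset_set (range (g n))))
      y%:C * cind (g n @^-1` [set y] `&` I n) x).
    apply: (@clspan_sum _ _ (@steps_L2) _ _ (fun y x => y%:C * cind (g n @^-1` [set y] `&` I n) x)) => y.
    apply: clspanZ; first exact: steps_L2.
    apply: density_set; rewrite -[X in measurable X]setTI; exact: (measurable_funP (g n)).
  apply/funext => x; rewrite fimfunE fsbig_finite//= rmorph_sum/= mulr_suml.
  by apply: eq_bigr => y _; rewrite cindI /cind rmorphM mulrA.
apply: (@clspan_cvg _ _ (@steps_L2) _ _ Lu gspan).
apply: (@sqn_cvg0 _ _ (fun x => nsq (u x)%:C)).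
- by move=> n; apply: cmeas_sub; apply: L2_meas => //; exact: clspan_L2 (gspan n).
- move=> n x; rewrite /= cindE_itv; case: ifP => _; last by rewrite mulr0 subr0.
  rewrite mulr1 -rmorphB !nsq_real.
  have /= := g0 n x; have := gu n x; set a := g n x; set b := u x => ab a0.
  by rewrite ler_sqr ?nnegrE ?subr_ge0//; lra.
- exact: L2_nsq_integrable.
- move=> x /=.
  have h : (u x - g n x) ^+ 2 @[n --> \oo] --> (0 : R).
    rewrite [X in _ --> X](_ : _ = (u x - u x) * (u x - u x)); last by rewrite subrr mul0r.
    under eq_fun do rewrite expr2.
    by apply: cvgM; apply: cvgB => //; exact: cvg_cst.
  apply: cvg_trans h; apply: near_eq_cvg.
  near=> n; have -> : cind (I n) x = 1 by near: n; exact: cind_cut.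
  by rewrite mulr1 -rmorphB nsq_real.
Unshelve. all: by end_near. Qed.

Theorem density f : CL 2 f -> clspan steps f.
Proof.
have real (u : R -> R) : CL 2 (fun x => (u x)%:C) -> clspan steps (fun x => (u x)%:C).
  move=> Lu; have [mu_ _] := L2_meas Lu; rewrite /= in mu_.
  have nx y : nsq (Num.max y 0)%:C <= nsq (y%:C : C).
    by rewrite !nsq_real; case: (lerP 0 y) => // _; rewrite expr0n sqr_ge0.
  have mm (v : R -> R) : measurable_fun setT v ->
      Cmeasurable (fun x => (Num.max (v x) 0)%:C).
    move=> mv; apply: cmeas_real; apply: measurable_maxr => //.
  rewrite (_ : (fun x => _) = (fun x => (Num.max (u x) 0)%:C) \-
      (fun x => (Num.max (- u x) 0)%:C)).
    apply: clspanB; first exact: steps_L2.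
      apply: density_ge0 => [x|]; first by rewrite le_max lexx orbT.
      by apply: L2_le Lu _ => //; exact: mm.
    apply: density_ge0 => [x|]; first by rewrite le_max lexx orbT.
    apply: L2_le (L2N Lu) _.
      by apply: mm; exact: measurable_funN.
    by move=> x; rewrite -rmorphN; exact: nx.
  apply/funext => x /=; rewrite -rmorphB; congr (_%:C).
  by case: (lerP 0 (u x)) => h; case: (lerP 0 (- u x)) => h'; lra.
move=> Lf; have [m1 m2] := L2_meas Lf.
rewrite (_ : f = (fun x => (Re (f x))%:C) \+ (fun x => 'i%C * (Im (f x))%:C)); last first.
  by apply/funext => x /=; apply: Ceq; rewrite !ReImE /=; ring.
apply: clspanD; first exact: steps_L2.
  apply: real; apply: L2_le Lf _; first exact: cmeas_real.
  by move=> x; rewrite nsq_real /nsq lerDl sqr_ge0.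
apply: clspanZ; first exact: steps_L2.
apply: real; apply: L2_le Lf _; first exact: cmeas_real.
by move=> x; rewrite nsq_real /nsq lerDr sqr_ge0.
Qed.

Definition l1n f : \bar R := (\int[mu]_x (normc (f x))%:E)%E.

Lemma lincomb_steps_cut (a b : R) f : lincomb steps f ->
  lincomb steps (fun x => f x * cind `]a, b] x).
Proof.
move=> [n [c [u [Uu ->]]]].
exists n, c, (fun i x => u i x * cind `]a, b] x); split.
  move=> i; have [a' [b' ->]] := Uu i; exists (Num.max a' a), (Num.min b' b).
  by apply/funext => x; rewrite -ocI cindI.
apply/funext => x; rewrite mulr_suml; apply: eq_bigr => i _.
by rewrite mulrA.
Qed.

(** On a set of finite measure this bounds the L1 norm by the L2 norm. *)
Lemma normc_amgm (z : C) (t : R) : 0 < t -> normc z <= t * nsq z + t^-1.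
Proof.
move=> t0; rewrite -normc_sqr; set y := normc z.
have := sqr_ge0 (t * y - 2^-1); have ti : 0 < t^-1 by rewrite invr_gt0.
have tt : t * t^-1 = 1 by rewrite mulfV ?gt_eqF.
move=> h; rewrite -(ler_pM2l t0) mulrDr tt; nra.
Qed.

(** Truncate f to a large interval, then approximate the truncation in L2 by a
step function on that interval: there L2 closeness gives L1 closeness. *)
Theorem density12 f (e : R) : CL 1 f -> CL 2 f -> 0 < e ->
  exists2 s, lincomb steps s & (sqn (f \- s)%R < e%:E)%E /\ (l1n (f \- s)%R < e%:E)%E.
Proof.
move=> L1f L2f e0; have mf := L2_meas L2f.
pose I n : set R := `]- (n%:R : R), n%:R]%classic.
pose f_ n x := f x * cind (I n) x.
have mI n : measurable (I n) by exact: measurable_itv.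
have mf_ n : Cmeasurable (f_ n) by apply: cmeas_mul => //; exact: meas_cind.
have cut n x : f x - f_ n x = 0 \/ f x - f_ n x = f x.
  rewrite /f_ cindE_itv; case: ifP => _; [left|right].
    by rewrite mulr1 subrr.
  by rewrite mulr0 subr0.
have cut0 x : \forall n \near \oo, f x - f_ n x = 0.
  near=> n; rewrite /f_ (_ : cind _ _ = 1) ?mulr1 ?subrr//.
  by near: n; exact: cind_cut.
have c2 : sqn (f \- f_ n)%R @[n --> \oo] --> 0%E.
  apply: (@sqn_cvg0 _ _ (fun x => nsq (f x))).
  - by move=> n; exact: cmeas_sub.
  - by move=> n x /=; case: (cut n x) => ->//; rewrite nsq0 nsq_ge0.
  - exact: L2_nsq_integrable.
  - move=> x; apply: cvg_near_cst; apply: filterS (cut0 x) => n /= ->.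
    by rewrite nsq0.
have c1 : l1n (f \- f_ n)%R @[n --> \oo] --> 0%E.
  have := @dominated_convergence _ _ _ mu setT measurableT
    (fun n x => (normc (f x - f_ n x))%:E) (cst 0%E) (EFin \o (fun x => normc (f x))).
  move=> /(_ _ _ _ _ _)[].
  - by move=> n; apply/measurable_EFinP; apply: (@meas_normc _ (f \- f_ n)); exact: cmeas_sub.
  - exact: measurable_cst.
  - apply: aeW => x _; apply: cvg_near_cst; apply: filterS (cut0 x) => n /= ->.
    by rewrite normcE nsq0 sqrtr0.
  - exact: L1_norm_integrable.
  - apply: aeW => x n _; rewrite /= ger0_norm ?normc_ge0// lee_fin.
    by case: (cut n x) => ->//; rewrite {1}normcE nsq0 sqrtr0 normc_ge0.
  - by move=> _ _; rewrite integral0.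
have e4 : 0 < e / 4 by rewrite divr_gt0.
near \oo => N.
have h2 : (sqn (f \- f_ N)%R < (e / 4)%:E)%E by near: N; exact: near_lt_ereal.
have h1 : (l1n (f \- f_ N)%R < (e / 4)%:E)%E by near: N; exact: near_lt_ereal.
have L2N : CL 2 (f_ N).
  apply: L2_le L2f _ => // x; rewrite /f_ cindE_itv; case: ifP => _; rewrite ?mulr1//.
  by rewrite mulr0 nsq0 nsq_ge0.
(* on the interval I N, of length 2N, |y| <= t|y|^2 + 1/t *)
pose t := 8 * (N%:R + 1) / e.
have t0 : 0 < t by rewrite divr_gt0// mulr_gt0// ltr_wpDl.
have d0 : 0 < Num.min (e / 4) (e / (4 * t)) by rewrite lt_min e4 divr_gt0// mulr_gt0.
have [_ /(_ _ d0)[s0 Ss0 hs0]] := density L2N.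
have Ls0 := lincomb_L2 (@steps_L2) Ss0.
pose s x := s0 x * cind (I N) x.
have Ss : lincomb steps s by exact: lincomb_steps_cut.
have Ls := lincomb_L2 (@steps_L2) Ss.
have fs x : f_ N x - s x = (f_ N x - s0 x) * cind (I N) x.
  rewrite /s /f_ mulrBl; congr (_ - _).
  by rewrite cindE_itv; case: ifP => _; rewrite ?mulr1// !mulr0.
have fs2 x : nsq (f_ N x - s x) <= nsq (f_ N x - s0 x).
  by rewrite fs nsqM nsq_cind ler_piMr ?nsq_ge0// indicE; case: (_ \in _).
have sq1 : (sqn (f_ N \- s)%R < (Num.min (e / 4) (e / (4 * t)))%:E)%E.
  apply: le_lt_trans hs0; apply: le_sqn => //; apply: cmeas_sub => //; exact: L2_meas.
exists s => //; split.
  apply: le_lt_trans (sqn_tri mf (mf_ N) (L2_meas Ls)) _.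
  rewrite (sqnE (L2B L2f L2N)) in h2 *; rewrite (sqnE (L2B L2N Ls)) in sq1 *.
  rewrite -!EFinM -EFinD lte_fin; move: h2 sq1; rewrite !lte_fin lt_min => h2 /andP[]; lra.
have mN : Cmeasurable (f_ N \- s) by apply: cmeas_sub => //; exact: L2_meas.
have lN : (l1n (f_ N \- s)%R < (e / 2)%:E)%E.
  apply: (@le_lt_trans _ _ (t%:E * sqn (f_ N \- s)%R + t^-1%:E * sqn (cind (I N)))%E).
    have t0' := ltW t0; have ti0 : 0 <= t^-1 by rewrite invr_ge0.
    rewrite /l1n /sqn -!ge0_integralZl_EFin//; first last.
    - by apply/measurable_EFinP; exact: meas_nsq.
    - by move=> x _; rewrite lee_fin nsq_ge0.
    - by apply/measurable_EFinP; apply: meas_nsq; exact: meas_cind.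
    - by move=> x _; rewrite lee_fin nsq_ge0.
    rewrite -ge0_integralD//; first last.
    - by apply: measurable_funeM; apply/measurable_EFinP; apply: meas_nsq; exact: meas_cind.
    - by move=> x _; rewrite mule_ge0 ?lee_fin ?nsq_ge0.
    - by apply: measurable_funeM; apply/measurable_EFinP; exact: meas_nsq.
    - by move=> x _; rewrite mule_ge0 ?lee_fin ?nsq_ge0.
    apply: ge0_le_integral => //.
    - by move=> x _; rewrite lee_fin normc_ge0.
    - by apply/measurable_EFinP; exact: meas_normc.
    - by apply: emeasurable_funD; apply: measurable_funeM; apply/measurable_EFinP;
        apply: meas_nsq => //; exact: meas_cind.
    - move=> x _; rewrite -!EFinM -EFinD lee_fin /= fs nsqM nsq_cind.
      rewrite /cind indicE; case: (_ \in _); rewrite /= ?mulr1.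
        exact: normc_amgm.
      by rewrite !mulr0 normcE nsq0 sqrtr0 addr0.
  rewrite sqn_cind// mu_oc (sqnE (L2B L2N Ls)) in sq1 *.
  rewrite -!EFinM -EFinD lte_fin; move: sq1; rewrite lte_fin lt_min => /andP[_].
  rewrite opprK max_l ?addr_ge0// invfM mulrA -/t ltr_pdivlMr//.
  set q := n2 _ => qe.
  have -> : t^-1 * (N%:R + N%:R) = (e / 4) * (N%:R / (N%:R + 1)).
    rewrite /t; field; rewrite gt_eqF//= gt_eqF// ltr_wpDl//.
  have : N%:R / (N%:R + 1) <= 1 :> R.
    by rewrite ler_pdivrMr ?mul1r ?lerDl// ltr_wpDl.
  by move/(ler_wpM2l (ltW e4)); rewrite mulr1 mulrC; lra.
apply: (@le_lt_trans _ _ (l1n (f \- f_ N)%R + l1n (f_ N \- s)%R)%E).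
  have mfN : Cmeasurable (f \- f_ N) by exact: cmeas_sub.
  rewrite /l1n -ge0_integralD//; first last.
  - by apply/measurable_EFinP; exact: meas_normc.
  - by move=> x _; rewrite lee_fin normc_ge0.
  - by apply/measurable_EFinP; exact: meas_normc.
  - by move=> x _; rewrite lee_fin normc_ge0.
  apply: ge0_le_integral => //.
  - by move=> x _; rewrite lee_fin normc_ge0.
  - by apply/measurable_EFinP; apply: meas_normc; apply: cmeas_sub => //; exact: L2_meas.
  - by apply: emeasurable_funD; apply/measurable_EFinP; exact: meas_normc.
  - move=> x _; rewrite -EFinD lee_fin /=.
    have -> : f x - s x = (f x - f_ N x) + (f_ N x - s x) by rewrite addrA subrK.
    exact: le_normcD.
have -> : e%:E = ((e / 4)%:E + (e / 2)%:E + (e / 4)%:E)%E by rewrite -!EFinD; congr EFin; field.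
apply: (@lt_trans _ _ ((e / 4)%:E + (e / 2)%:E)%E); first exact: lteD.
by rewrite -!EFinD lte_fin; lra.
Unshelve. all: by end_near. Qed.

End Density.

(** * Affine substitutions *)
Section Affine.
Variable R : realType.
Local Notation C := R[i].
Local Notation mu := (@lebesgue_measure R).

Lemma meas_affine (a b : R) : measurable_fun setT (fun x : R => a * x + b).
Proof. by apply: measurable_funD => //; exact: measurable_funM. Qed.

(** Both sides are measures that agree on half-open intervals. *)
Lemma lebesgue_affine (a b : R) (A : set R) : 0 < a -> measurable A ->
  mu A = (a%:E * mu ((fun x => a * x + b)%R @^-1` A))%E.
Proof.
move=> a0 mA; have a0' := ltW a0.
pose phi := (fun x : measurableTypeR R => a * x + b : measurableTypeR R).
have mphi : measurable_fun setT phi by exact: meas_affine.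
apply: (@lebesgue_measure_unique R (mscale (NngNum a0') (pushforward mu phi))) => // _ [[c d] _ <-].
have preE : phi @^-1` `]c, d] = `](c - b) / a, (d - b) / a]%classic.
  apply/seteqP; split => x; rewrite /phi /= !in_itv/= ltr_pdivrMr// ler_pdivlMr//;
    by rewrite (mulrC x) ltrBlDr lerBrDr.
transitivity (a%:E * mu (phi @^-1` `]c, d]))%E; last by [].
rewrite preE.
rewrite !mu_oc -EFinM; congr EFin.
rewrite /= -mulrBl opprB addrA subrK maxr_pMr// mulr0.
by rewrite mulrC divfK// lt0r_neq0.
Qed.

Lemma ge0_integral_affine (a b : R) (f : R -> \bar R) : 0 < a ->
  measurable_fun setT f -> (forall x, 0 <= f x)%E ->
  (\int[mu]_x f (a * x + b)%R = a^-1%:E * \int[mu]_x f x)%E.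
Proof.
move=> a0 mf f0; have a0' := ltW a0.
have mphi : measurable_fun setT (fun x : measurableTypeR R => (a * x + b : measurableTypeR R)).
  exact: meas_affine.
have ai : 0 <= a^-1 by rewrite invr_ge0.
transitivity (\int[pushforward mu (fun x : measurableTypeR R => (a * x + b : measurableTypeR R)%R)]_x f x)%E.
  by rewrite ge0_integral_pushforward.
transitivity (\int[mscale (NngNum ai) mu]_x f x)%E; last by rewrite ge0_integral_mscale.
apply: eq_measure_integral => //= A mA _.
rewrite /mscale/= /pushforward (lebesgue_affine b a0 mA) muleA -EFinM.
by rewrite mulVf ?lt0r_neq0// mul1e.
Qed.

Lemma integrable_affine (a b : R) (f : R -> R) : 0 < a ->
  mu.-integrable setT (EFin \o f) ->
  mu.-integrable setT (EFin \o (fun x => f (a * x + b))).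
Proof.
move=> a0 /integrableP[mf hf]; apply/integrableP; split.
  apply/measurable_EFinP; apply: measurableT_comp; last exact: meas_affine.
  exact/measurable_EFinP.
rewrite (@ge0_integral_affine a b (fun x => `|(f x)%:E|%E))//.
  by rewrite lte_mul_pinfty// lee_fin invr_ge0 ltW.
exact: measurableT_comp.
Qed.

Lemma Rintegral_affine (a b : R) (f : R -> R) : 0 < a ->
  mu.-integrable setT (EFin \o f) ->
  \int[mu]_x f (a * x + b) = a^-1 * \int[mu]_x f x.
Proof.
move=> a0 intf; have mf := measurable_int _ intf.
have pE : (\int[mu]_x (EFin \o f)^\+ (a * x + b)%R =
    a^-1%:E * \int[mu]_x (EFin \o f)^\+ x)%E.
  by apply: ge0_integral_affine => //; exact: measurable_funepos.
have nE : (\int[mu]_x (EFin \o f)^\- (a * x + b)%R =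
    a^-1%:E * \int[mu]_x (EFin \o f)^\- x)%E.
  by apply: ge0_integral_affine => //; exact: measurable_funeneg.
pose phi (x : R) := a * x + b.
transitivity (fine (\int[mu]_x ((EFin \o f) \o phi) x)%E) => //.
rewrite /Rintegral [in LHS]integralE.
under [X in (X - _)%E]eq_integral do rewrite funepos_comp/=.
under [X in (_ - X)%E]eq_integral do rewrite funeneg_comp/=.
rewrite pE nE [in RHS]integralE.
have fp : (\int[mu]_x (EFin \o f)^\+ x)%E \is a fin_num.
  by apply: integrable_fin_num => //; exact: integrable_funepos.
have fn : (\int[mu]_x (EFin \o f)^\- x)%E \is a fin_num.
  by apply: integrable_fin_num => //; exact: integrable_funeneg.
by rewrite -(fineK fp) -(fineK fn) -!EFinM -!EFinB /= mulrBr.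
Qed.

Lemma Cintegrable_affine (a b : R) (f : R -> C) : 0 < a -> Cintegrable f ->
  Cintegrable (fun x => f (a * x + b)).
Proof.
move=> a0 [f1 f2]; split.
  exact: (integrable_affine _ a0 f1).
exact: (integrable_affine _ a0 f2).
Qed.

Lemma Cintegral_affine (a b : R) (f : R -> C) : 0 < a -> Cintegrable f ->
  Cintegral (fun x => f (a * x + b)) = a^-1%:C * Cintegral f.
Proof.
move=> a0 [f1 f2]; apply: Ceq; rewrite ?ReM ?ImM ?ReCintegral ?ImCintegral /= !mul0r.
  by rewrite subr0 -(Rintegral_affine b a0 f1).
by rewrite addr0 -(Rintegral_affine b a0 f2).
Qed.

Lemma sqn_affine (a b : R) (f : R -> C) : 0 < a -> Cmeasurable f ->
  sqn (fun x => f (a * x + b)) = (a^-1%:E * sqn f)%E.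
Proof.
move=> a0 mf; rewrite /sqn -(@ge0_integral_affine a b)//.
  by apply/measurable_EFinP; exact: meas_nsq.
by move=> x; rewrite lee_fin nsq_ge0.
Qed.

Lemma L2_affine (a b : R) (f : R -> C) : 0 < a -> CL 2 f ->
  CL 2 (fun x => f (a * x + b)).
Proof.
move=> a0 /CL2P[mf hf]; apply/CL2P; split.
  exact: (cmeas_comp (meas_affine a b) mf).
by rewrite sqn_affine// lte_mul_pinfty// lee_fin invr_ge0 ltW.
Qed.

Lemma L1_affine (a b : R) (f : R -> C) : 0 < a -> CL 1 f ->
  CL 1 (fun x => f (a * x + b)).
Proof.
by move=> a0 Lf; apply: Cintegrable_L1; apply: Cintegrable_affine => //; exact: L1_Cintegrable.
Qed.

End Affine.

(** * The integral of (1 - cos (t x)) / x^2 *)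
Section KeyIntegral.
Variable R : realType.
Local Notation mu := (@lebesgue_measure R).

Lemma FTC2y (f F : R -> R) (l : R) : (forall x, 0 <= x -> 0 <= f x) ->
  continuous f -> (forall x : R, is_derive x (1 : R) F (f x)) -> F x @[x --> +oo] --> l ->
  (\int[mu]_(x in `[0%R, +oo[) (f x)%:E = (l - F 0)%:E)%E.
Proof.
move=> f0 cf dF Fl; rewrite (@ge0_continuous_FTC2y R f F 0 l)//.
- exact: continuous_subspaceT.
- apply: cvg_at_right_filter; apply: differentiable_continuous.
  by apply/derivable1_diffP; exact: ex_derive.
- by move=> x _; rewrite derive1E; exact: derive_val.
Qed.

Lemma cvg_bound_inv (F : R -> R) (c : R) : (forall x, 0 < x -> `|F x| <= c / x) ->
  F x @[x --> +oo] --> (0 : R).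
Proof.
move=> h.
have ci : c / x @[x --> +oo] --> (0 : R).
  rewrite -[X in _ --> X](mulr0 c); apply: cvgMr.
  apply/gtr0_cvgV0; last exact: cvg_id.
  exact: nbhs_pinfty_gt.
apply/norm_cvg0P; apply: squeeze_cvgr; [|exact: cvg_cst|exact: ci].
near=> x; rewrite normr_ge0 h//; near: x; exact: nbhs_pinfty_gt.
Unshelve. all: by end_near. Qed.

Lemma expRN_le1 (y : R) : 0 < y -> expR (- y) <= y^-1.
Proof.
move=> y0; rewrite expRN lef_pV2 ?posrE ?expR_gt0//.
by apply: le_trans (expR_ge1Dx y); rewrite lerDr.
Qed.

Lemma expRN_le2 (y : R) : 0 < y -> expR (- y) <= 4 / y ^+ 2.
Proof.
move=> y0; have -> : - y = (- (y / 2)) *+ 2 by rewrite mulr2n; field.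
rewrite mulr2n expRD -expr2.
have h : expR (- (y / 2)) <= (y / 2)^-1 by apply: expRN_le1; rewrite divr_gt0.
rewrite (_ : 4 / y ^+ 2 = ((y / 2)^-1) ^+ 2); last by field; rewrite gt_eqF.
by rewrite ler_sqr ?nnegrE ?expR_ge0// invr_ge0 ltW// divr_gt0.
Qed.

Lemma is_derive_expRl (k u : R) : is_derive u 1 (fun u => expR (- (k * u))) (- k * expR (- (k * u))).
Proof.
rewrite (_ : (fun u => _) = expR \o ((- k) \*: id)); last first.
  by apply/funext => v; rewrite /= /GRing.scale/= mulNr.
apply: is_derive_eq; rewrite /= /GRing.scale/= mulr1 mulNr; ring.
Qed.

Lemma int_u_expR (x : R) : 0 < x ->
  (\int[mu]_(u in `[0%R, +oo[) (u * expR (- (x * u)))%:E = (x ^- 2)%:E)%E.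
Proof.
move=> x0; have xn0 := lt0r_neq0 x0.
pose F (u : R) := - (u / x + x ^- 2) * expR (- (x * u)).
have dF (u : R) : is_derive u (1 : R) F (u * expR (- (x * u))).
  rewrite /F (_ : (fun u => _) = (- (x^-1 \*: id + cst (x ^- 2))) *
     (fun u => expR (- (x * u)))); last first.
    by apply/funext => v; rewrite /GRing.mul/= /GRing.opp/= /GRing.add/= /GRing.scale/= (mulrC x^-1).
  have ? := is_derive_expRl x u.
  apply: is_derive_eq; rewrite !fctE /GRing.scale/= -?[_ *: _]/(_ * _); field.
  exact: xn0.
rewrite (@FTC2y _ F 0).
- by congr EFin; rewrite /F mul0r add0r mulr0 oppr0 expR0 mulr1 opprK add0r.
- by move=> u u0; rewrite mulr_ge0// expR_ge0.
- move=> u; apply: cvgM; first exact: cvg_id.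
  apply: continuous_comp; last exact: continuous_expR.
  by apply: cvgN; apply: cvgM; [exact: cvg_cst|exact: cvg_id].
- apply: (@cvg_bound_inv _ (4 / x ^+ 3 + x ^- 3)) => u u0.
  have xu0 : 0 < x * u by rewrite mulr_gt0.
  rewrite /F mulNr normrN ger0_norm; last first.
    by rewrite mulr_ge0 ?expR_ge0// addr_ge0// ?invr_ge0 ?exprn_ge0 ?mulr_ge0 ?invr_ge0// ltW.
  rewrite mulrDl mulrDl lerD//.
    have -> : 4 / x ^+ 3 / u = (u / x) * (4 / (x * u) ^+ 2).
      by field; rewrite xn0 gt_eqF.
    by rewrite ler_wpM2l ?expRN_le2// divr_ge0// ltW.
  have -> : x ^- 3 / u = x ^- 2 * (x * u)^-1 by field; rewrite xn0 gt_eqF.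
  by rewrite ler_wpM2l ?expRN_le1// invr_ge0 exprn_ge0// ltW.
Qed.

Lemma int_1cos_expR (u : R) : 0 < u ->
  (\int[mu]_(x in `[0%R, +oo[) ((1 - cos x) * expR (- (u * x)))%:E =
   (u * (1 + u ^+ 2))^-1%:E)%E.
Proof.
move=> u0; have un0 := lt0r_neq0 u0.
have u2 : 1 + u ^+ 2 != 0 by rewrite lt0r_neq0// ltr_wpDr ?sqr_ge0.
pose F (x : R) := (- u^-1 - (sin x - u * cos x) / (1 + u ^+ 2)) * expR (- (u * x)).
have dF (x : R) : is_derive x (1 : R) F ((1 - cos x) * expR (- (u * x))).
  rewrite /F (_ : (fun x => _) = (cst (- u^-1) - ((1 + u ^+ 2)^-1 \*: (@sin R - u \*: @cos R))) *
     (fun x => expR (- (u * x)))); last first.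
    by apply/funext => v; rewrite /GRing.mul/= /GRing.opp/= /GRing.add/= /GRing.scale/= (mulrC (1 + _)^-1).
  have ? := is_derive_expRl u x.
  apply: is_derive_eq; rewrite !fctE /GRing.scale/= -?[_ *: _]/(_ * _); field.
  by rewrite u2.
rewrite (@FTC2y _ F 0).
- by congr EFin; rewrite /F sin0 cos0 mulr0 oppr0 expR0; field; rewrite u2.
- by move=> x _; rewrite mulr_ge0 ?expR_ge0// subr_ge0 cos_le1.
- move=> x; apply: cvgM.
    by apply: cvgB; [exact: cvg_cst|exact: continuous_cos].
  apply: continuous_comp; last exact: continuous_expR.
  by apply: cvgN; apply: cvgM; [exact: cvg_cst|exact: cvg_id].
- apply: (@cvg_bound_inv _ ((u^-1 + (1 + u)) / u)) => x x0.
  have ux0 : 0 < u * x by rewrite mulr_gt0.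
  rewrite /F normrM (ger0_norm (expR_ge0 _)).
  rewrite (_ : _ / u / x = (u^-1 + (1 + u)) * (u * x)^-1); last by field; rewrite un0 gt_eqF.
  apply: ler_pM (expR_ge0 _) _ (expRN_le1 ux0) => //.
  have iu0 : 0 <= u^-1 by rewrite invr_ge0 ltW.
  apply: le_trans (ler_normB _ _) _; rewrite normrN (ger0_norm iu0) lerD2l.
  rewrite normrM [X in _ * X]ger0_norm; last by rewrite invr_ge0 addr_ge0 ?sqr_ge0.
  rewrite -[leRHS]mulr1; apply: ler_pM => //; first by rewrite invr_ge0 addr_ge0 ?sqr_ge0.
    apply: le_trans (ler_normB _ _) _; apply: lerD; first by rewrite ler_norml sin_geN1 sin_le1.
    rewrite normrM (ger0_norm (ltW u0)) ler_piMr ?(ltW u0)//.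
    by rewrite ler_norml cos_geN1 cos_le1.
  by rewrite invf_le1 ?lerDl ?sqr_ge0// ltr_wpDr ?sqr_ge0.
Qed.

Lemma int_atan : (\int[mu]_(u in `[0%R, +oo[) ((1 + u ^+ 2)^-1)%:E = (pi / 2)%:E)%E.
Proof.
rewrite (@FTC2y _ (@atan R) (pi / 2)).
- by rewrite atan0 subr0.
- by move=> u _; rewrite invr_ge0 addr_ge0 ?sqr_ge0.
- move=> u; apply: cvgV; first by rewrite lt0r_neq0// ltr_wpDr ?sqr_ge0.
  apply: cvgD; first exact: cvg_cst.
  exact: exprn_continuous.
- exact: cvgy_atan.
Qed.

Lemma meas_expR_lin (c : R) : measurable_fun setT (fun y : R => expR (- (c * y))).
Proof.
apply: measurableT_comp => //; apply: measurable_funN.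
exact: measurable_funM.
Qed.

Lemma integral_itv0y (f : R -> R) : measurable_fun setT f ->
  (\int[mu]_(x in `]0%R, +oo[) (f x)%:E = \int[mu]_(x in `[0%R, +oo[) (f x)%:E)%E.
Proof.
move=> mf; rewrite integral_itv_obnd_cbnd//; apply/measurable_EFinP.
exact: measurable_funTS.
Qed.

Let D : set R := `]0%R, +oo[%classic.
Let mD : measurable D. Proof. exact: measurable_itv. Qed.
Let DE x : (x \in D) = (0 < x). Proof. by rewrite mem_setE in_itv/= andbT. Qed.

Let restr (f : R -> \bar R) : (\int[mu]_x (f x * (\1_D x)%:E) = \int[mu]_(x in D) f x)%E.
Proof.
rewrite [RHS]integral_mkcond; apply: eq_integral => x _.
by rewrite patchE indicE; case: (x \in D); rewrite ?mule1 ?mule0.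
Qed.

Let int1 (x : R) : (\int[mu]_y (((1 - cos x) * \1_D x * (y * expR (- (x * y))))%:E * (\1_D y)%:E)
  = ((1 - cos x) / x ^+ 2)%:E * (\1_D x)%:E)%E.
Proof.
rewrite restr indicE DE; case: ltrP => x0 /=; last first.
  by rewrite mule0; apply: integral0_eq => y _; rewrite mulr0 mul0r.
rewrite mulr1 mule1.
under eq_integral do rewrite EFinM.
rewrite ge0_integralZl_EFin.
- rewrite integral_itv0y; first by rewrite int_u_expR// EFinM.
  by apply: measurable_funM => //; exact: meas_expR_lin.
- exact: mD.
- by move=> y; rewrite /D/= in_itv/= andbT => /ltW y0; rewrite lee_fin mulr_ge0 ?expR_ge0.
- by apply/measurable_EFinP; apply: measurable_funTS; apply: measurable_funM => //; exact: meas_expR_lin.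
- by rewrite subr_ge0 cos_le1.
Qed.

Let int2 (u : R) : (\int[mu]_x ((u * \1_D u * ((1 - cos x) * expR (- (u * x))))%:E * (\1_D x)%:E)
  = ((1 + u ^+ 2)^-1)%:E * (\1_D u)%:E)%E.
Proof.
rewrite restr indicE DE; case: ltrP => u0 /=; last first.
  by rewrite mule0; apply: integral0_eq => y _; rewrite mulr0 mul0r.
rewrite mulr1 mule1.
have mc : measurable_fun setT (fun x : R => (1 - cos x) * expR (- (u * x))).
  apply: measurable_funM; last exact: meas_expR_lin.
  apply: measurable_funB => //.
  apply: continuous_measurable_fun; exact: continuous_cos.
under eq_integral do rewrite EFinM.
rewrite ge0_integralZl_EFin.
- rewrite integral_itv0y// int_1cos_expR// -EFinM; congr EFin; field.
  by rewrite (lt0r_neq0 u0) andbT lt0r_neq0// ltr_wpDr ?sqr_ge0.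
- exact: mD.
- by move=> x _; rewrite lee_fin mulr_ge0 ?expR_ge0// subr_ge0 cos_le1.
- by apply/measurable_EFinP; apply: measurable_funTS.
- exact: ltW.
Qed.

(** Tonelli for u (1 - cos x) exp (- u x) on the positive quadrant: integrating
first in u gives (1 - cos x) / x^2, integrating first in x gives
1 / (1 + u^2), whose integral is pi / 2. *)
Lemma int_1cos_half :
  (\int[mu]_(x in `]0%R, +oo[) ((1 - cos x) / x ^+ 2)%:E = (pi / 2)%:E)%E.
Proof.
pose h (z : R * R) : R := (1 - cos z.1) * (z.2 * expR (- (z.1 * z.2))) * (\1_D z.1 * \1_D z.2).
have h0 z : 0 <= h z.
  rewrite /h !indicE !DE; case: (ltrP 0 z.1) => a; case: (ltrP 0 z.2) => b /=;
    rewrite ?mulr0 ?mul0r ?mulr0 ?mulr1//.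
  by rewrite !mulr_ge0 ?expR_ge0 ?(ltW b)// subr_ge0 cos_le1.
have mh : measurable_fun setT h.
  apply: measurable_funM.
    apply: measurable_funM.
      apply: measurable_funB => //; apply: (measurableT_comp _ measurable_fst).
      apply: continuous_measurable_fun; exact: continuous_cos.
    apply: measurable_funM; first exact: measurable_snd.
    apply: measurableT_comp => //; apply: measurable_funN.
    apply: measurable_funM; [exact: measurable_fst|exact: measurable_snd].
  apply: measurable_funM; (apply: measurableT_comp; first exact: measurable_indic).
    exact: measurable_fst.
  exact: measurable_snd.
have mhE : measurable_fun setT (EFin \o h) by exact/measurable_EFinP.
have e := @fubini_tonelli _ _ _ _ _ mu mu (EFin \o h) mhE (fun z => h0 z).
rewrite -int_atan -integral_itv0y; last first.
  apply: continuous_measurable_fun => u.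
  apply: cvgV; first by rewrite lt0r_neq0// ltr_wpDr ?sqr_ge0.
  apply: cvgD; first exact: cvg_cst.
  exact: exprn_continuous.
rewrite -(restr (fun u => ((1 + u ^+ 2)^-1)%:E)) -(restr (fun x => ((1 - cos x) / x ^+ 2)%:E)).
transitivity (\int[mu]_x \int[mu]_y (EFin \o h) (x, y))%E.
  apply: eq_integral => x _; rewrite -int1; apply: eq_integral => y _.
  by rewrite -EFinM /h/=; congr EFin; ring.
rewrite e; apply: eq_integral => u _; rewrite -int2; apply: eq_integral => x _.
by rewrite -EFinM /h/= (mulrC u x); congr EFin; ring.
Qed.

Lemma measurable_inv : measurable_fun setT (fun x : R => x^-1).
Proof.
rewrite (_ : (fun x => _) = fun x : R => x * (x ^+ 2) `^ (-1)).
  apply: measurable_funM => //; apply: (measurableT_comp (measurable_powR _)).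
  exact: measurable_funX.
apply/funext => x; rewrite powR_inv1 ?sqr_ge0//.
have [->|x0] := eqVneq x 0; first by rewrite invr0 mul0r.
by field.
Qed.

Lemma meas_1cos (t : R) : measurable_fun setT (fun x : R => (1 - cos (t * x)) / x ^+ 2).
Proof.
apply: measurable_funM.
  apply: measurable_funB => //; apply: measurableT_comp; last exact: measurable_funM.
  apply: continuous_measurable_fun; exact: continuous_cos.
apply: (measurableT_comp measurable_inv).
exact: measurable_funX.
Qed.

Lemma int_1cos (t : R) :
  (\int[mu]_x ((1 - cos (t * x)) / x ^+ 2)%:E = (pi * `|t|)%:E)%E.
Proof.
have pos x : (0 <= ((1 - cos (t * x)) / x ^+ 2)%:E)%E.
  by rewrite lee_fin divr_ge0 ?sqr_ge0// subr_ge0 cos_le1.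
wlog t0 : t pos / 0 <= t.
  move=> H; case: (lerP 0 t) => t0; first exact: H.
  have := H (- t); rewrite normrN => <-; last by rewrite oppr_ge0 ltW.
    by apply: eq_integral => x _; rewrite mulNr cosN.
  by move=> x; rewrite mulNr cosN.
move: t0; rewrite le_eqVlt => /predU1P[<-|t0].
  by rewrite normr0 mulr0; apply: integral0_eq => x _; rewrite mul0r cos0 subrr mul0r.
pose g (x : R) : \bar R := ((1 - cos x) / x ^+ 2)%:E.
have mg : measurable_fun setT g.
  apply/measurable_EFinP; have := meas_1cos 1.
  by under eq_fun do rewrite mul1r.
have g0 x : (0 <= g x)%E.
  by rewrite lee_fin divr_ge0 ?sqr_ge0// subr_ge0 cos_le1.
have gT : (\int[mu]_x g x = pi%:E)%E.
  have e2 : (\int[mu]_(x in `[0%R, +oo[) g x = (pi / 2)%:E)%E.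
    by rewrite -int_1cos_half integral_itv_obnd_cbnd//; exact: measurable_funTS.
  have e1 : (\int[mu]_(x in `]-oo, 0%R[) g x = (pi / 2)%:E)%E.
    rewrite integral_itv_bndo_bndc; last exact: measurable_funTS.
    rewrite -e2 (ge0_integration_by_substitution0 mg g0).
    by apply: eq_integral => x _; rewrite /g cosN sqrrN.
  have TE : [set: R] = `]-oo, (0:R)[%classic `|` `[(0:R), +oo[%classic.
    by rewrite -setCitvl setUv.
  rewrite TE ge0_integral_setU//.
  - by rewrite e1 e2 -EFinD; congr EFin; field.
  - by rewrite -TE.
  - by rewrite -setCitvl; apply/disj_setPCl.
transitivity (\int[mu]_x ((t ^+ 2)%:E * g (t * x + 0)%R))%E.
  apply: eq_integral => x _; rewrite /g addr0 -EFinM; congr EFin.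
  have [->|x0] := eqVneq x 0; first by rewrite mulr0 expr0n/= invr0 !mulr0.
  by field; rewrite x0 lt0r_neq0.
rewrite ge0_integralZl_EFin ?sqr_ge0//; last first.
  by apply: (measurableT_comp mg); exact: meas_affine.
rewrite ge0_integral_affine// gT gtr0_norm// -!EFinM; congr EFin; field.
exact: lt0r_neq0.
Qed.

End KeyIntegral.

(** * Plancherel's theorem for step functions *)
Section FourierStep.
Variable R : realType.
Local Notation C := R[i].
Local Notation mu := (@lebesgue_measure R).
Implicit Types (f g h : R -> C) (c : C) (a b x xi : R).

Lemma normc_expi x : normc (expi x) = 1.
Proof. by rewrite normcE nsq_expi sqrtr1. Qed.

Lemma meas_expiM (k : R) : Cmeasurable (fun x : R => expi (k * x)).
Proof. by apply: cmeas_expi; exact: measurable_funM. Qed.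

Lemma meas_expiNM (k : R) : Cmeasurable (fun x : R => expi (- (k * x))).
Proof. by apply: cmeas_expi; apply: measurable_funN; exact: measurable_funM. Qed.

Lemma L1_mul_bounded f g : CL 1 f -> Cmeasurable g -> (forall x, normc (g x) <= 1) ->
  CL 1 (f \* g).
Proof.
move=> Lf mg g1; have mf : Cmeasurable f by case: Lf.
apply: Cintegrable_L1; apply: (@Cintegrable_le _ _ (fun x => normc (f x))).
- exact: cmeas_mul.
- by move=> x /=; rewrite normcM ler_piMr// normc_ge0.
- exact: L1_norm_integrable.
Qed.

Lemma fourier_integrable f xi : CL 1 f -> Cintegrable (fun x => f x * expi (- (xi * x))).
Proof.
move=> Lf; apply: L1_Cintegrable.
apply: (@L1_mul_bounded f (fun x => expi (- (xi * x)))) => //.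
  exact: meas_expiNM.
by move=> x; rewrite normc_expi.
Qed.

Lemma fourierD f g xi : CL 1 f -> CL 1 g ->
  fourier (f \+ g) xi = fourier f xi + fourier g xi.
Proof.
move=> Lf Lg; rewrite /fourier -CintegralD; try exact: fourier_integrable.
by apply: eq_Cintegral => x /=; rewrite mulrDl.
Qed.

Lemma fourierZ c f xi : CL 1 f -> fourier (fun x => c * f x) xi = c * fourier f xi.
Proof.
move=> Lf; rewrite /fourier -CintegralZ; last exact: fourier_integrable.
by apply: eq_Cintegral => x /=; rewrite mulrA.
Qed.

Lemma L1D f g : CL 1 f -> CL 1 g -> CL 1 (f \+ g).
Proof. by move=> Lf Lg; apply: Cintegrable_L1; apply: CintegrableD; exact: L1_Cintegrable. Qed.
Lemma L1Z c f : CL 1 f -> CL 1 (fun x => c * f x).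
Proof. by move=> Lf; apply: Cintegrable_L1; apply: CintegrableZ; exact: L1_Cintegrable. Qed.
Lemma L1N f : CL 1 f -> CL 1 (fun x => - f x).
Proof. by move/(L1Z (-1)); under eq_fun do rewrite mulN1r. Qed.
Lemma L1B f g : CL 1 f -> CL 1 g -> CL 1 (f \- g).
Proof. by move=> Lf Lg; apply: L1D => //; exact: L1N. Qed.
Lemma L10 : CL 1 (fun _ : R => 0 : C).
Proof.
have -> : (fun _ : R => 0 : C) = fun x => 0 * (cind `]0, 1] x : C).
  by apply/funext => x; rewrite mul0r.
apply: L1Z; apply/CL1P; split; first by apply: meas_cind; exact: measurable_itv.
have := L2_fin (@L2_itv R 0 1); congr (_ < _)%E; apply: eq_integral => x _.
by rewrite nsq_cind /cind normcE nsq_real sqrtr_sqr ger0_norm ?indicE.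
Qed.

Lemma fourierB f g xi : CL 1 f -> CL 1 g ->
  fourier (f \- g) xi = fourier f xi - fourier g xi.
Proof.
move=> Lf Lg; have -> : f \- g = f \+ (fun x => -1 * g x).
  by apply/funext => x /=; rewrite mulN1r.
by rewrite fourierD ?fourierZ ?mulN1r//; exact: L1Z.
Qed.

Lemma L1_cind (A : set R) : measurable A -> (mu A < +oo)%E -> CL 1 (@cind R A).
Proof.
move=> mA fA; apply/CL1P; split; first exact: meas_cind.
move: fA; rewrite -(sqn_cind mA); congr (_ < _)%E; apply: eq_integral => x _.
by rewrite nsq_cind /cind normcE nsq_real sqrtr_sqr ger0_norm ?indicE.
Qed.

Lemma L1_itv a b : CL 1 (@cind R `]a, b]).
Proof. by apply: L1_cind; [exact: measurable_itv|rewrite mu_oc ltry]. Qed.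

Lemma L1_sum n (F : 'I_n -> R -> C) :
  (forall i, CL 1 (F i)) -> CL 1 (fun x => \sum_(i < n) F i x).
Proof.
elim: n F => [|n IH] F LF.
  by under eq_fun do rewrite big_ord0; exact: L10.
under eq_fun do rewrite big_ord_recr/=.
by apply: L1D => //; apply: IH.
Qed.

Lemma fourier0 xi : fourier (fun=> 0 : C) xi = 0.
Proof.
rewrite /fourier; under eq_fun do rewrite mul0r.
by apply: Ceq; rewrite ?ReCintegral ?ImCintegral /= Rintegral_cst// mul0r.
Qed.

Lemma fourier_sum n (F : 'I_n -> R -> C) xi : (forall i, CL 1 (F i)) ->
  fourier (fun x => \sum_(i < n) F i x) xi = \sum_(i < n) fourier (F i) xi.
Proof.
elim: n F => [|n IH] F LF.
  by under eq_fun do rewrite big_ord0; rewrite big_ord0; exact: fourier0.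
under eq_fun do rewrite big_ord_recr/=.
by rewrite fourierD ?big_ord_recr/= ?IH//; exact: L1_sum.
Qed.

Lemma FTC_cc (f F : R -> R) a b : a <= b -> continuous f ->
  (forall x : R, is_derive x (1 : R) F (f x)) ->
  \int[mu]_(x in `]a, b]) f x = F b - F a.
Proof.
rewrite le_eqVlt => /predU1P[<- _ _|ab cf dF].
  by rewrite subrr set_itvoc0 Rintegral_set0.
have dd x : derivable F x 1 by exact: ex_derive.
have cF : continuous F.
  by move=> x; apply: differentiable_continuous; apply/derivable1_diffP.
rewrite /Rintegral integral_itv_obnd_cbnd; last first.
  by apply/measurable_EFinP; apply: measurable_funTS; exact: continuous_measurable_fun.
rewrite (@continuous_FTC2 _ f F a b)//.
- exact: continuous_subspaceT.
- split.
  + by move=> x _.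
  + by apply: cvg_at_right_filter; exact: cF.
  + by apply: cvg_at_left_filter; exact: cF.
- by move=> x _; rewrite derive1E; exact: derive_val.
Qed.

Lemma is_derive_sinl (k x : R) : is_derive x (1 : R) (fun u => sin (k * u)) (k * cos (k * x)).
Proof.
rewrite (_ : (fun u => _) = (@sin R) \o (k \*: id)); last by [].
by apply: is_derive_eq; rewrite /= /GRing.scale/= mulr1 mulrC.
Qed.
Lemma is_derive_cosl (k x : R) : is_derive x (1 : R) (fun u => cos (k * u)) (- k * sin (k * x)).
Proof.
rewrite (_ : (fun u => _) = (@cos R) \o (k \*: id)); last by [].
by apply: is_derive_eq; rewrite /= /GRing.scale/= mulr1 !mulNr mulrC.
Qed.

Lemma continuous_lin (k : R) : continuous (fun x : R => k * x).
Proof. by move=> x; apply: cvgM; [exact: cvg_cst|exact: cvg_id]. Qed.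

Lemma int_cosl (k a b : R) : a <= b -> k != 0 ->
  \int[mu]_(x in `]a, b]) cos (k * x) = (sin (k * b) - sin (k * a)) / k.
Proof.
move=> ab k0; pose F := k^-1 \*: (fun u => sin (k * u)).
have dF (x : R) : is_derive x (1 : R) F (cos (k * x)).
  have ? := is_derive_sinl k x; apply: is_derive_eq.
  by rewrite -?[_ *: _]/(_ * _) mulrA mulVf// mul1r.
rewrite (@FTC_cc _ F)//.
- by rewrite -[F b]/(k^-1 * sin (k * b)) -[F a]/(k^-1 * sin (k * a)) -mulrBr mulrC.
- move=> x; apply: continuous_comp; [exact: continuous_lin|exact: continuous_cos].
Qed.
Lemma int_sinl (k a b : R) : a <= b -> k != 0 ->
  \int[mu]_(x in `]a, b]) sin (k * x) = (cos (k * a) - cos (k * b)) / k.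
Proof.
move=> ab k0; pose F := (- k^-1) \*: (fun u => cos (k * u)).
have dF (x : R) : is_derive x (1 : R) F (sin (k * x)).
  have ? := is_derive_cosl k x; apply: is_derive_eq.
  by rewrite -?[_ *: _]/(_ * _) mulrA mulrNN mulVf// mul1r.
rewrite (@FTC_cc _ F)//.
- by rewrite -[F b]/(- k^-1 * cos (k * b)) -[F a]/(- k^-1 * cos (k * a)); field.
- move=> x; apply: continuous_comp; [exact: continuous_lin|exact: continuous_sin].
Qed.

(** The Fourier integral of the indicator function of ]a, b] away from the
frequency 0, where this formula gives 0 instead of b - a. *)
Definition sfun a b xi : C :=
  ((sin (xi * b) - sin (xi * a)) / xi) +i* ((cos (xi * b) - cos (xi * a)) / xi).

Lemma Rint_cind (u : R -> R) (A : set R) : measurable A ->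
  \int[mu]_x (u x * \1_A x) = \int[mu]_(x in A) u x.
Proof.
move=> mA; rewrite [RHS]Rintegral_mkcond; apply: eq_Rintegral => x _.
by rewrite patchE indicE; case: (x \in A); rewrite ?mulr1 ?mulr0.
Qed.

Lemma Cint_cind_expi (a b k : R) : a <= b ->
  Cintegral (fun x => cind `]a, b] x * expi (k * x)) =
  (\int[mu]_(x in `]a, b]) cos (k * x)) +i* (\int[mu]_(x in `]a, b]) sin (k * x)).
Proof.
move=> ab; apply: Ceq; rewrite ?ReCintegral ?ImCintegral/=.
  by rewrite -[RHS]Rint_cind//; apply: eq_Rintegral => x _; rewrite mul0r subr0 mulrC.
by rewrite -[RHS]Rint_cind//; apply: eq_Rintegral => x _; rewrite mul0r addr0 mulrC.
Qed.

Lemma fourier_cind a b xi : a <= b ->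
  fourier (cind `]a, b]) xi = sfun a b xi + (b - a)%:C * cind [set 0] xi.
Proof.
move=> ab; rewrite /fourier; under eq_fun do rewrite -mulNr.
rewrite Cint_cind_expi//.
have [->|x0] := eqVneq xi 0.
  rewrite oppr0; under [X in X +i* _]eq_Rintegral do rewrite mul0r cos0.
  under [X in _ +i* X]eq_Rintegral do rewrite mul0r sin0.
  have -> : \int[mu]_(x in `]a, b]) (1 : R) = b - a.
    rewrite Rintegral_cst// mul1r [X in fine X](_ : _ = (b - a)%:E)//.
    by rewrite -[X in X%:E](@max_l _ _ (b - a) 0) ?subr_ge0// -mu_oc.
  rewrite Rintegral_cst// mul0r cindT// /sfun !mul0r !subrr !mul0r.
  by apply: Ceq; rewrite !ReImE/=; ring.
rewrite int_cosl ?oppr_eq0// int_sinl ?oppr_eq0// cindF; last by move=> /= /eqP; rewrite (negbTE x0).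
rewrite mulr0 addr0 /sfun !mulNr !sinN !cosN; apply: Ceq => /=; field.
  exact: x0.
exact: x0.
Qed.

Lemma meas_sfun a b : Cmeasurable (sfun a b).
Proof.
have ms (k : R) : measurable_fun setT (fun x => sin (x * k)).
  apply: measurableT_comp; last exact: measurable_funM.
  apply: continuous_measurable_fun; exact: continuous_sin.
have mc (k : R) : measurable_fun setT (fun x => cos (x * k)).
  apply: measurableT_comp; last exact: measurable_funM.
  apply: continuous_measurable_fun; exact: continuous_cos.
split => /=; apply: measurable_funM; try exact: measurable_inv; exact: measurable_funB.
Qed.

Lemma meas_fourier_cind a b : a <= b -> Cmeasurable (fourier (cind `]a, b])).
Proof.
move=> ab; rewrite (_ : fourier _ = fun xi => sfun a b xi + (b - a)%:C * cind [set 0] xi).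
  apply: cmeas_add; first exact: meas_sfun.
  by apply: cmeas_scale; apply: meas_cind; exact: measurable_set1.
by apply/funext => xi; exact: fourier_cind.
Qed.

(** The value at 0 is invisible to integrals; this reduces the Fourier transforms
of intervals to [sfun]. *)
Lemma integral_off0 (u v : R -> R) : measurable_fun setT u -> measurable_fun setT v ->
  (forall x, x != 0 -> u x = v x) ->
  (\int[mu]_x (u x)%:E = \int[mu]_x (v x)%:E)%E.
Proof.
move=> mu_ mv uv; apply: ae_eq_integral => //; try exact/measurable_EFinP.
exists [set 0]; split.
- exact: measurable_set1.
- exact: lebesgue_measure_set1.
- move=> x /= h; apply: contrapT => /eqP x0; apply: h => _.
  by rewrite uv.
Qed.

(** The products of sines and cosines combine into four terms whose integrals are
known from [int_1cos]. *)
Lemma sfun_Re a b a' b' xi :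
  Re (sfun a b xi * conjc (sfun a' b' xi)) =
  (1 - cos ((b - a') * xi)) / xi ^+ 2 + (1 - cos ((a - b') * xi)) / xi ^+ 2
  - ((1 - cos ((b - b') * xi)) / xi ^+ 2 + (1 - cos ((a - a') * xi)) / xi ^+ 2).
Proof.
rewrite !ReImE/= !(mulrC _ xi) !mulrBr !cosB.
have -> : xi ^- 2 = xi^-1 * xi^-1 by rewrite -exprVn expr2.
by ring.
Qed.

Lemma sfun_Im a b a' b' xi :
  Im (sfun a b (- xi) * conjc (sfun a' b' (- xi))) =
  - Im (sfun a b xi * conjc (sfun a' b' xi)).
Proof. by rewrite !ReImE/= !mulNr !sinN !cosN !invrN; ring. Qed.

(** This combination of absolute values, produced by [sfun_Re] and [int_1cos], is
twice the length of the intersection of ]a, b] and ]a', b']. *)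
Lemma overlapE a b a' b' : a <= b -> a' <= b' ->
  `|b - a'| + `|a - b'| - (`|b - b'| + `|a - a'|) =
  2 * Num.max (Num.min b b' - Num.max a a') 0.
Proof.
have nE (x : R) : (0 <= x /\ `|x| = x) \/ (x <= 0 /\ `|x| = - x).
  have [h|h] := leP 0 x; [left|right]; split => //.
  - by rewrite ger0_norm.
  - exact: ltW.
  - by rewrite ltr0_norm.
have mE (x y : R) : (x <= y /\ Num.max x y = y) \/ (y <= x /\ Num.max x y = x).
  by case: (lerP x y) => h; [left|right; split => //; exact: ltW].
have iE (x y : R) : (x <= y /\ Num.min x y = x) \/ (y <= x /\ Num.min x y = y).
  by case: (lerP x y) => h; [left|right; split => //; exact: ltW].
move=> ab ab'.
case: (mE (Num.min b b' - Num.max a a') 0) => [] [h0 ->]; move: h0;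
case: (iE b b') => [] [h1 ->]; case: (mE a a') => [] [h2 ->]; move=> h0;
case: (nE (b - a')) => [] [h3 ->]; case: (nE (a - b')) => [] [h4 ->];
case: (nE (b - b')) => [] [h5 ->]; case: (nE (a - a')) => [] [h6 ->]; lra.
Qed.

Let kap (t x : R) := (1 - cos (t * x)) / x ^+ 2.

Let ik t : mu.-integrable setT (EFin \o kap t).
Proof.
apply/integrableP; split; first by apply/measurable_EFinP; exact: meas_1cos.
under eq_integral => x _.
  rewrite /= ger0_norm; last by rewrite divr_ge0 ?sqr_ge0// subr_ge0 cos_le1.
  over.
by rewrite int_1cos ltry.
Qed.

Let Ik t : \int[mu]_x kap t x = pi * `|t|.
Proof. by rewrite /Rintegral int_1cos. Qed.

Lemma Re_sfun_int a b a' b' : a <= b -> a' <= b' ->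
  \int[mu]_xi Re (sfun a b xi * conjc (sfun a' b' xi)) =
  2 * pi * Num.max (Num.min b b' - Num.max a a') 0.
Proof.
move=> ab ab'.
rewrite (_ : \int[mu]_xi _ = \int[mu]_xi ((kap (b - a') xi + kap (a - b') xi) - (kap (b - b') xi + kap (a - a') xi))); last first.
  by apply: eq_Rintegral => xi _; rewrite sfun_Re.
rewrite RintegralB//; try exact: integrableD_R.
rewrite !RintegralD// !Ik -!mulrDr -mulrBr overlapE//; ring.
Qed.

Lemma L2_sfun a b : a <= b -> CL 2 (sfun a b).
Proof.
move=> ab; apply/CL2P; split; first exact: meas_sfun.
rewrite /sqn.
under eq_integral => xi _ do rewrite -[nsq _]ReC -mulCJ sfun_Re.
have : mu.-integrable setT (EFin \o (fun xi => ((kap (b - a) xi + kap (a - b) xi) - (kap (b - b) xi + kap (a - a) xi)))).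
  by apply: integrableB_R; exact: integrableD_R.
by move/(integrable_lty measurableT).
Qed.

Lemma integral_opp (f : R -> \bar R) : measurable_fun setT f -> (forall x, 0 <= f x)%E ->
  (\int[mu]_x f (- x)%R = \int[mu]_x f x)%E.
Proof.
move=> mf f0.
transitivity (\int[pushforward mu (-%R : measurableTypeR R -> measurableTypeR R)]_x f x)%E.
  by rewrite ge0_integral_pushforward.
apply: eq_measure_integral => //= A mA _; exact: lebesgue_measureN.
Qed.

Lemma Rintegral_odd (u : R -> R) : mu.-integrable setT (EFin \o u) ->
  (forall x, u (- x) = - u x) -> \int[mu]_x u x = 0.
Proof.
move=> iu odd; have mf := measurable_int _ iu.
have pn x : ((EFin \o u)^\- x = (EFin \o u)^\+ (- x)%R)%E.
  by rewrite funenegE funeposE /= odd.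
rewrite /Rintegral integralE.
have -> : (\int[mu]_x (EFin \o u)^\- x = \int[mu]_x (EFin \o u)^\+ x)%E.
  rewrite -integral_opp//; last exact: measurable_funeneg.
  by apply: eq_integral => x _; rewrite pn opprK.
rewrite subee//; apply: integrable_fin_num => //; exact: integrable_funepos.
Qed.

Lemma sqn_opp f : Cmeasurable f -> sqn (fun x => f (- x)) = sqn f.
Proof.
move=> mf; rewrite /sqn (@integral_opp (fun x => (nsq (f x))%:E))//.
  by apply/measurable_EFinP; exact: meas_nsq.
by move=> x; rewrite lee_fin nsq_ge0.
Qed.

(** The real part is the sum of four integrals of [int_1cos]; the imaginary part
is the integral of an odd function. *)
Lemma inner_sfun a b a' b' : a <= b -> a' <= b' ->
  inner (sfun a b) (sfun a' b') =
  (2 * pi * Num.max (Num.min b b' - Num.max a a') 0)%:C.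
Proof.
move=> ab ab'; have [i1 i2] := L2_mul_integrable (L2_sfun ab) (L2_sfun ab').
apply: Ceq; rewrite /inner ?ReCintegral ?ImCintegral.
  exact: Re_sfun_int.
by apply: Rintegral_odd => // xi; exact: sfun_Im.
Qed.

Lemma Cintegral_off0 f g : Cmeasurable f -> Cmeasurable g ->
  (forall x, x != 0 -> f x = g x) -> Cintegral f = Cintegral g.
Proof.
move=> [f1 f2] [g1 g2] fg; apply: Ceq; rewrite ?ReCintegral ?ImCintegral;
  by congr fine; apply: integral_off0 => // x x0; rewrite fg.
Qed.

Lemma sqn_off0 f g : Cmeasurable f -> Cmeasurable g ->
  (forall x, x != 0 -> f x = g x) -> sqn f = sqn g.
Proof.
move=> mf mg fg; apply: integral_off0; [exact: meas_nsq|exact: meas_nsq|].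
by move=> x x0; rewrite fg.
Qed.

Lemma cind_max a b : @cind R `]a, b] = cind `]a, Num.max a b].
Proof.
apply/funext => x; rewrite !cindE_itv; congr (if _ then _ else _).
by rewrite le_max; case: ltP => //= ax; rewrite orbC; case: (x <= b) => //=; rewrite leNgt ax.
Qed.

Lemma fourier_cind_off0 a b xi : xi != 0 ->
  fourier (cind `]a, b]) xi = sfun a (Num.max a b) xi.
Proof.
move=> x0; rewrite cind_max fourier_cind ?le_max ?lexx// cindF ?mulr0 ?addr0//.
by move=> /= /eqP; rewrite (negbTE x0).
Qed.

Lemma meas_fcind a b : Cmeasurable (fourier (@cind R `]a, b])).
Proof. by rewrite cind_max; apply: meas_fourier_cind; rewrite le_max lexx. Qed.

Lemma L2_fcind a b : CL 2 (fourier (@cind R `]a, b])).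
Proof.
have h : a <= Num.max a b by rewrite le_max lexx.
apply/CL2P; split; first exact: meas_fcind.
rewrite (@sqn_off0 _ (sfun a (Num.max a b))); first exact: L2_fin (L2_sfun h).
- exact: meas_fcind.
- exact: meas_sfun.
- by move=> x x0; rewrite fourier_cind_off0.
Qed.

(** Polarized Plancherel for intervals: both sides are multiples of the length of
the intersection. *)
Lemma inner_fcind a b a' b' :
  inner (fourier (@cind R `]a, b])) (fourier (cind `]a', b'])) =
  (2 * pi)%:C * inner (cind `]a, b]) (cind `]a', b']).
Proof.
have h : a <= Num.max a b by rewrite le_max lexx.
have h' : a' <= Num.max a' b' by rewrite le_max lexx.
rewrite {1}/inner (@Cintegral_off0 _ (fun x => sfun a (Num.max a b) x * conjc (sfun a' (Num.max a' b') x))).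
- rewrite -/(inner (sfun a (Num.max a b)) (sfun a' (Num.max a' b'))) inner_sfun// [RHS](_ : _ = (2 * pi)%:C * (Num.max (Num.min (Num.max a b) (Num.max a' b') - Num.max a a') 0)%:C).
    by rewrite -rmorphM.
  congr (_ * _); rewrite [cind `]a, b]]cind_max [cind `]a', b']]cind_max.
  rewrite /inner; under eq_fun do rewrite {2}/cind conjc_real -/(cind _ _) -cindI ocI.
  apply: Ceq; rewrite ?ReCintegral ?ImCintegral /=; last by rewrite Rintegral_cst// mul0r.
  by rewrite /Rintegral integral_indic// setIT; exact: (congr1 fine (mu_oc _ _)).
- by apply: cmeas_mul; [|apply: cmeas_conj]; exact: meas_fcind.
- by apply: cmeas_mul; [|apply: cmeas_conj]; exact: meas_sfun.
- by move=> x x0; rewrite !fourier_cind_off0.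
Qed.

Lemma inner_lincomb n (c : 'I_n -> C) (u v : 'I_n -> R -> C) (k : C) :
  (forall i, CL 2 (u i)) -> (forall i, CL 2 (v i)) ->
  (forall i j, inner (u i) (u j) = k * inner (v i) (v j)) ->
  inner (fun x => \sum_(i < n) c i * u i x) (fun x => \sum_(i < n) c i * u i x) =
  k * inner (fun x => \sum_(i < n) c i * v i x) (fun x => \sum_(i < n) c i * v i x).
Proof.
move=> Lu Lv uv.
have Lcu i : CL 2 (fun x => c i * u i x) by exact: L2Z.
have Lcv i : CL 2 (fun x => c i * v i x) by exact: L2Z.
rewrite (@inner_suml _ _ (fun i x => c i * u i x))//; last exact: L2_sum.
rewrite (@inner_suml _ _ (fun i x => c i * v i x))//; last exact: L2_sum.
rewrite mulr_sumr; apply: eq_bigr => i _.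
rewrite (@inner_sumr _ _ (fun i x => c i * u i x))//.
rewrite (@inner_sumr _ _ (fun i x => c i * v i x))//.
rewrite mulr_sumr; apply: eq_bigr => j _.
by rewrite !innerZl// !innerZr// uv; ring.
Qed.

Lemma plancherel_steps f : lincomb (@steps R) f ->
  CL 2 (fourier f) /\ n2 (fourier f) = 2 * pi * n2 f.
Proof.
move=> Sf; have Lf := lincomb_L2 (@steps_L2 R) Sf.
move: Sf Lf => [n [c [u [Uu fE]]]] Lf.
have L1u i : CL 1 (u i) by have [a [b ->]] := Uu i; exact: L1_itv.
have L2u i : CL 2 (u i) by have [a [b ->]] := Uu i; exact: L2_itv.
have L2fu i : CL 2 (fourier (u i)) by have [a [b ->]] := Uu i; exact: L2_fcind.
have ffE : fourier f = fun xi => \sum_(i < n) c i * fourier (u i) xi.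
  apply/funext => xi; rewrite fE (@fourier_sum n (fun i x => c i * u i x)).
    by apply: eq_bigr => i _; rewrite fourierZ.
  by move=> i; exact: L1Z.
have Lff : CL 2 (fourier f) by rewrite ffE; apply: L2_sum => i; exact: L2Z.
split => //.
rewrite -[LHS]ReC -innerff// -[n2 f]ReC -innerff//.
rewrite ffE fE (@inner_lincomb _ _ _ u (2 * pi)%:C)//.
  by rewrite !ReImE/= mul0r subr0.
by move=> i j; have [a [b ->]] := Uu i; have [a' [b' ->]] := Uu j; exact: inner_fcind.
Qed.

End FourierStep.

(** * Plancherel's theorem, the L2 transform and the Hardy space *)
Section Plancherel.
Variable R : realType.
Local Notation C := R[i].
Local Notation mu := (@lebesgue_measure R).
Implicit Types (f g h : R -> C) (c : C) (a b x xi : R).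

Arguments fourier {R} : simpl never.

Lemma cvg_sqn_n2 f (f_ : nat -> R -> C) : CL 2 f -> (forall n, CL 2 (f_ n)) ->
  sqn (f_ n \- f) @[n --> \oo] --> 0%E -> n2 (f_ n \- f) @[n --> \oo] --> (0 : R).
Proof. by move=> Lf Lf_ /fine_cvgP[]. Qed.

Lemma cvg_inner f g (f_ : nat -> R -> C) : CL 2 f -> CL 2 g -> (forall n, CL 2 (f_ n)) ->
  sqn (f_ n \- f) @[n --> \oo] --> 0%E ->
  Re (inner (f_ n) g) @[n --> \oo] --> Re (inner f g).
Proof.
move=> Lf Lg Lf_ /(cvg_sqn_n2 Lf Lf_) cv.
apply/subr_cvg0; rewrite /=.
have cv2 : Num.sqrt (n2 (f_ n \- f) * n2 g) @[n --> \oo] --> (0 : R).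
  rewrite -[X in _ --> X](@sqrtr0 R) -[X in _ --> Num.sqrt X](mul0r (n2 g)).
  apply: continuous_cvg; first exact: sqrt_continuous.
  by apply: cvgM => //; exact: cvg_cst.
apply/norm_cvg0P; apply: squeeze_cvgr; [|exact: cvg_cst|exact: cv2].
near=> n; rewrite normr_ge0 /=.
have -> : Re (inner (f_ n) g) - Re (inner f g) = Re (inner (f_ n \- f) g).
  have -> : f_ n \- f = f_ n \+ (fun x => -1 * f x).
    by apply/funext => x /=; rewrite mulN1r.
  rewrite innerDl//; last exact: L2Z.
  by rewrite innerZl// !ReImE/=; ring.
rewrite -sqrtr_sqr ler_sqrt ?mulr_ge0 ?n2_ge0//.
apply: le_trans (inner_CS (L2B (Lf_ n) Lf) Lg).
by rewrite /nsq lerDl sqr_ge0.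
Unshelve. all: by end_near. Qed.

Lemma cvg_n2 f (f_ : nat -> R -> C) : CL 2 f -> (forall n, CL 2 (f_ n)) ->
  sqn (f_ n \- f) @[n --> \oo] --> 0%E -> n2 (f_ n) @[n --> \oo] --> n2 f.
Proof.
move=> Lf Lf_ cv; have cv1 := cvg_sqn_n2 Lf Lf_ cv; have cv2 := cvg_inner Lf Lf Lf_ cv.
have fE n : n2 (f_ n) = n2 (f_ n \- f) - n2 f + 2 * Re (inner (f_ n) f).
  by rewrite n2B//; ring.
rewrite (_ : (fun n => n2 (f_ n)) = fun n => n2 (f_ n \- f) - n2 f + 2 * Re (inner (f_ n) f)); last exact/funext.
rewrite [X in _ --> X](_ : n2 f = 0 - n2 f + 2 * Re (inner f f)); last first.
  by rewrite innerff// ReC; ring.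
apply: cvgD; first by apply: cvgB => //; exact: cvg_cst.
by apply: cvgM => //; exact: cvg_cst.
Qed.

(** L1 convergence of functions gives pointwise convergence of their transforms,
which identifies the L2 limit in [plancherel]. *)
Lemma fourier_diff_le f g xi : CL 1 f -> CL 1 g ->
  (`|Re (fourier f xi - fourier g xi)|%:E <= l1n (f \- g)%R)%E /\
  (`|Im (fourier f xi - fourier g xi)|%:E <= l1n (f \- g)%R)%E.
Proof.
move=> Lf Lg; rewrite -fourierB//.
have LB := L1B Lf Lg; have [i1 i2] := fourier_integrable xi LB.
have key (u : R -> R) : mu.-integrable setT (EFin \o u) ->
   (forall x, `|u x| <= normc ((f \- g) x)) ->
   (`|\int[mu]_x u x|%:E <= l1n (f \- g)%R)%E.
  move=> iu ule; rewrite EFin_normr_Rintegral//.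
  apply: le_trans (le_abse_integral _ _ _) _ => //; first exact: measurable_int iu.
  apply: ge0_le_integral => //.
  - by apply: measurableT_comp => //; exact: measurable_int iu.
  - by apply/measurable_EFinP; apply: meas_normc; case: LB.
  - by move=> x _; rewrite /= lee_fin.
split; rewrite /fourier ?ReCintegral ?ImCintegral; apply: key => // x.
  by apply: le_trans (Re_le_normc _) _; rewrite normcM normc_expi mulr1.
by apply: le_trans (Im_le_normc _) _; rewrite normcM normc_expi mulr1.
Qed.

(** Step functions s_n that converge to f in L1 and in L2 have transforms that
converge pointwise to that of f and form a Cauchy sequence in L2. *)
Theorem plancherel f : CL 1 f -> CL 2 f ->
  CL 2 (fourier f) /\ n2 (fourier f) = 2 * pi * n2 f.
Proof.
move=> L1f L2f.
have inv0 (n : nat) : 0 < n.+1%:R^-1 :> R by rewrite invr_gt0.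
have /choice[s Hs] : forall n : nat, exists s, lincomb (@steps R) s /\
    ((sqn (f \- s)%R < (n.+1%:R^-1)%:E)%E /\ (l1n (f \- s)%R < (n.+1%:R^-1)%:E)%E).
  by move=> n; have [s ss hs] := density12 L1f L2f (inv0 n); exists s.
have Ls n : lincomb (@steps R) (s n) by case: (Hs n).
have L2s n : CL 2 (s n) by apply: lincomb_L2 (Ls n); exact: steps_L2.
have L1s n : CL 1 (s n).
  have [m [c [u [Uu ->]]]] := Ls n; apply: L1_sum => i; apply: L1Z.
  by have [a [b ->]] := Uu i; exact: L1_itv.
have d2 n : n2 (f \- s n) < n.+1%:R^-1.
  by have [_ [+ _]] := Hs n; rewrite (sqnE (L2B L2f (L2s n))) lte_fin.
have Lfs n : CL 2 (fourier (s n)) by have [] := plancherel_steps (Ls n).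
have cvinv : (n.+1%:R^-1 : R) @[n --> \oo] --> (0 : R) by exact: cvg_harmonic.
have cvp xi : Re (fourier (s n) xi) @[n --> \oo] --> Re (fourier f xi) /\
              Im (fourier (s n) xi) @[n --> \oo] --> Im (fourier f xi).
  have h n := fourier_diff_le xi L1f (L1s n).
  have l1 n : (l1n (f \- s n)%R <= (n.+1%:R^-1)%:E)%E.
    by have [_ [_ /ltW]] := Hs n.
  split; apply/subr_cvg0; apply/norm_cvg0P;
    (apply: squeeze_cvgr; [|exact: cvg_cst|exact: cvinv]); near=> n;
    apply/andP; split; rewrite ?normr_ge0// distrC -lee_fin; have [h1 h2] := h n.
    by apply: le_trans (l1 n); rewrite -ReN -ReD.
  by apply: le_trans (l1 n); rewrite -ImN -ImD.
have mff : Cmeasurable (fourier f).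
  split.
    apply: (@measurable_fun_cvg _ _ _ setT (fun n xi => Re (fourier (s n) xi))).
      by move=> n; have [] := L2_meas (Lfs n).
    by move=> xi _; have [] := cvp xi.
  apply: (@measurable_fun_cvg _ _ _ setT (fun n xi => Im (fourier (s n) xi))).
    by move=> n; have [] := L2_meas (Lfs n).
  by move=> xi _; have [] := cvp xi.
have nss m k : n2 (fourier (s m) \- fourier (s k)) = 2 * pi * n2 (s m \- s k).
  have -> : fourier (s m) \- fourier (s k) = fourier (s m \- s k).
    by apply/funext => xi /=; rewrite fourierB.
  apply: (plancherel_steps _).2.
  have -> : s m \- s k = s m \+ (fun x => -1 * s k x).
    by apply/funext => x /=; rewrite mulN1r.
  by apply: lincombD => //; exact: lincombZ.
have dss m k : n2 (s m \- s k) <= 2 * m.+1%:R^-1 + 2 * k.+1%:R^-1.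
  have := sqn_tri (L2_meas (L2s m)) (L2_meas L2f) (L2_meas (L2s k)).
  rewrite (sqnBC (s m) f) (sqnE (L2B L2f (L2s m))) (sqnE (L2B L2f (L2s k))).
  rewrite (sqnE (L2B (L2s m) (L2s k))) -!EFinM -EFinD lee_fin.
  by have := d2 m; have := d2 k; move: (m.+1%:R^-1) (k.+1%:R^-1) => x y; lra.
(* Fatou's lemma along m, for fixed k *)
have fat k : (sqn (fourier f \- fourier (s k))%R <= (8 * pi * k.+1%:R^-1)%:E)%E.
  have -> : sqn (fourier f \- fourier (s k))%R =
    (\int[mu]_xi limn_einf (fun m => (nsq (fourier (s m) xi - fourier (s k) xi))%:E))%E.
    apply: eq_integral => xi _; apply/esym.
    have : (nsq (fourier (s m) xi - fourier (s k) xi))%:E @[m --> \oo] -->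
           (nsq (fourier f xi - fourier (s k) xi))%:E.
      apply: cvg_EFin; first exact: nearW.
      have [c1 c2] := cvp xi.
      rewrite (_ : fine \o _ = fun m => (Re (fourier (s m) xi) - Re (fourier (s k) xi)) ^+ 2 +
          (Im (fourier (s m) xi) - Im (fourier (s k) xi)) ^+ 2); last first.
        by apply/funext => m /=; rewrite /nsq !ReImE.
      rewrite /nsq !ReImE.
      apply: cvgD; rewrite expr2; under eq_fun do rewrite expr2;
        by apply: cvgM; apply: cvgB => //; exact: cvg_cst.
    move=> cv; rewrite is_cvg_limn_einfE; last exact: cvgP cv.
    exact: cvg_lim cv.
  apply: le_trans (fatou _ _ _ _) _ => //.
  - by move=> m; apply/measurable_EFinP; apply: (@meas_nsq _ (fourier (s m) \- fourier (s k)));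
      apply: cmeas_sub; exact: L2_meas.
  - by move=> m xi _; rewrite lee_fin nsq_ge0.
  rewrite limn_einf_lim; apply: lime_le; first exact: is_cvg_einfs.
  near=> m; apply: (@le_trans _ _ (sqn (fourier (s m) \- fourier (s k))%R)).
    by apply: ereal_inf_lbound; exists m => /=.
  rewrite sqnE ?nss; last exact: L2B.
  have km : (k <= m)%N by near: m; exact: nbhs_infty_ge.
  have mk : m.+1%:R^-1 <= k.+1%:R^-1 :> R by rewrite lef_pV2 ?posrE// ler_nat.
  rewrite lee_fin; have := dss m k; have := pi_gt0 R => p0 d.
  rewrite (_ : 8 * pi * k.+1%:R^-1 = 2 * pi * (4 * k.+1%:R^-1)); last by ring.
  rewrite ler_wpM2l ?mulr_ge0 ?(ltW p0)//.
  by move: d mk; move: (m.+1%:R^-1) (k.+1%:R^-1) => x y; lra.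
have Lff : CL 2 (fourier f).
  have -> : fourier f = (fourier f \- fourier (s 0)) \+ fourier (s 0).
    by apply/funext => xi /=; rewrite subrK.
  apply: L2D => //; apply/CL2P; split; first by apply: cmeas_sub => //; exact: L2_meas.
  exact: le_lt_trans (fat 0%N) (ltry _).
split => //.
have c1 : n2 (fourier (s n)) @[n --> \oo] --> n2 (fourier f).
  apply: cvg_n2 => //.
  apply: (@squeeze_cvge _ _ _ _ (cst 0%E) _ (fun k => (8 * pi * k.+1%:R^-1)%:E)).
  - by near=> k; rewrite sqn_ge0 sqnBC fat.
  - exact: cvg_cst.
  - apply: cvg_EFin; first exact: nearW.
    rewrite /= -[X in _ --> X](mulr0 (8 * pi)).
    by apply: cvgM => //; exact: cvg_cst.
have c2 : n2 (s n) @[n --> \oo] --> n2 f.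
  apply: cvg_n2 => //.
  apply: (@squeeze_cvge _ _ _ _ (cst 0%E) _ (fun k => (k.+1%:R^-1)%:E)).
  - by near=> k; rewrite sqn_ge0 sqnBC; have [_ [/ltW]] := Hs k.
  - exact: cvg_cst.
  - by apply: cvg_EFin => //; exact: nearW.
have c3 : n2 (fourier (s n)) @[n --> \oo] --> 2 * pi * n2 f.
  under eq_fun do rewrite (plancherel_steps (Ls _)).2.
  by apply: cvgM => //; exact: cvg_cst.
exact: cvg_unique c1 c3.
Unshelve. all: by end_near. Qed.

(** Domination by a product of integrable functions of one variable makes the
kernel integrable on the plane. *)
Lemma Fubini_R (k : R * R -> R) (p q : R -> R) : measurable_fun setT k ->
  mu.-integrable setT (EFin \o p) -> mu.-integrable setT (EFin \o q) ->
  (forall x, 0 <= p x) -> (forall x, 0 <= q x) ->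
  (forall x y, `|k (x, y)| <= p x * q y) ->
  \int[mu]_x (\int[mu]_y k (x, y)) = \int[mu]_y (\int[mu]_x k (x, y)).
Proof.
move=> mk ip iq p0 q0 kpq.
have mp : measurable_fun setT p by apply/measurable_EFinP; exact: measurable_int ip.
have mq : measurable_fun setT q by apply/measurable_EFinP; exact: measurable_int iq.
have mkE : measurable_fun setT (EFin \o k) by exact/measurable_EFinP.
have mkA : measurable_fun setT (abse \o (EFin \o k)) by exact: measurableT_comp.
have i1 x : mu.-integrable setT (EFin \o (fun y => k (x, y))).
  apply: (@integrable_le _ _ (fun y => p x * q y)) => //.
    exact: (measurableT_comp mk (measurable_pair1 x)).
  exact: integrableZ_R.
have i2 y : mu.-integrable setT (EFin \o (fun x => k (x, y))).
  apply: (@integrable_le _ _ (fun x => q y * p x)) => //.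
    exact: (measurableT_comp mk (measurable_pair2 y)).
  by move=> x; rewrite mulrC.
  exact: integrableZ_R.
have f1 (u : R -> R) : mu.-integrable setT (EFin \o u) -> (\int[mu]_y (u y)%:E = (\int[mu]_y u y)%:E)%E.
  by move=> iu; rewrite /Rintegral fineK//; exact: integrable_fin_num.
have intk : (mu \x mu)%E.-integrable setT (EFin \o k).
  apply/integrable12ltyP => //.
  apply: (@le_lt_trans _ _ (\int[mu]_x \int[mu]_y ((p x)%:E * (q y)%:E))%E).
    apply: ge0_le_integral => //.
    - by move=> x _; apply: integral_ge0.
    - exact: (@measurable_fun_fubini_tonelli_F _ _ _ _ _ mu _ mkA (fun z => abse_ge0 _)).
    - under eq_fun => x do (rewrite ge0_integralZl_EFin//; [|by move=> y _; rewrite lee_fin|exact/measurable_EFinP]).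
      apply: emeasurable_funM; first exact/measurable_EFinP.
      exact: measurable_cst.
    - move=> x _; apply: ge0_le_integral => //.
      + apply: measurableT_comp => //; apply/measurable_EFinP.
        exact: (measurableT_comp mk (measurable_pair1 x)).
      + apply/measurable_EFinP; exact: measurable_funM.
      + by move=> y _; rewrite /= lee_fin kpq.
  under eq_integral => x _ do (rewrite ge0_integralZl_EFin//; [|by move=> y _; rewrite lee_fin|exact/measurable_EFinP]).
  rewrite f1// ge0_integralZr//.
  - by rewrite f1// -EFinM ltry.
  - exact/measurable_EFinP.
  - by move=> x _; rewrite lee_fin.
  - by rewrite lee_fin; apply: Rintegral_ge0.
have := Fubini intk.
rewrite /Rintegral => e; congr fine.
transitivity (\int[mu]_x \int[mu]_y (EFin \o k) (x, y))%E.
  by apply: eq_integral => x _; rewrite -f1.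
by rewrite e; apply: eq_integral => y _; rewrite -f1.
Qed.

Lemma fourier_swap f g : CL 1 f -> CL 1 g ->
  Cintegral (fun xi => fourier f xi * g xi) =
  Cintegral (fun x => f x * fourier g x).
Proof.
move=> Lf Lg; have mf : Cmeasurable f by case: Lf.
have mg : Cmeasurable g by case: Lg.
pose H (z : R * R) : C := f z.1 * (g z.2 * expi (- (z.2 * z.1))).
have Hle x y : normc (H (x, y)) <= normc (f x) * normc (g y).
  by rewrite /H/= !normcM normc_expi mulr1.
have ip := L1_norm_integrable Lf; have iq := L1_norm_integrable Lg.
have mH : measurable_fun setT (fun z => Re (H z)) /\ measurable_fun setT (fun z => Im (H z)).
  have m1 : measurable_fun setT (fun z : R * R => Re (f z.1)).
    exact: (measurableT_comp mf.1 measurable_fst).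
  have m2 : measurable_fun setT (fun z : R * R => Im (f z.1)).
    exact: (measurableT_comp mf.2 measurable_fst).
  have m3 : measurable_fun setT (fun z : R * R => Re (g z.2)).
    exact: (measurableT_comp mg.1 measurable_snd).
  have m4 : measurable_fun setT (fun z : R * R => Im (g z.2)).
    exact: (measurableT_comp mg.2 measurable_snd).
  have me : measurable_fun setT (fun z : R * R => - (z.2 * z.1)).
    by apply: measurable_funN; apply: measurable_funM;
      [exact: measurable_snd|exact: measurable_fst].
  have m5 : measurable_fun setT (fun z : R * R => cos (- (z.2 * z.1))).
    apply: measurableT_comp me; apply: continuous_measurable_fun.
    exact: continuous_cos.
  have m6 : measurable_fun setT (fun z : R * R => sin (- (z.2 * z.1))).
    apply: measurableT_comp me; apply: continuous_measurable_fun.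
    exact: continuous_sin.
  have HR : (fun z => Re (H z)) = fun z => Re (f z.1) * (Re (g z.2) * cos (- (z.2 * z.1)) - Im (g z.2) * sin (- (z.2 * z.1)))
      - Im (f z.1) * (Re (g z.2) * sin (- (z.2 * z.1)) + Im (g z.2) * cos (- (z.2 * z.1))).
    by apply/funext => z; rewrite /H !(ReM, ImM).
  have HI : (fun z => Im (H z)) = fun z => Re (f z.1) * (Re (g z.2) * sin (- (z.2 * z.1)) + Im (g z.2) * cos (- (z.2 * z.1)))
      + Im (f z.1) * (Re (g z.2) * cos (- (z.2 * z.1)) - Im (g z.2) * sin (- (z.2 * z.1))).
    by apply/funext => z; rewrite /H !(ReM, ImM).
  split; [rewrite HR|rewrite HI].
    apply: measurable_funB; apply: measurable_funM => //.
      by apply: measurable_funB; apply: measurable_funM.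
    by apply: measurable_funD; apply: measurable_funM.
  apply: measurable_funD; apply: measurable_funM => //.
    by apply: measurable_funD; apply: measurable_funM.
  by apply: measurable_funB; apply: measurable_funM.
have eR : \int[mu]_x (\int[mu]_y Re (H (x, y))) = \int[mu]_y (\int[mu]_x Re (H (x, y))).
  apply: (@Fubini_R (fun z => Re (H z)) _ _ mH.1 ip iq) => [x|x|x y]; try exact: normc_ge0.
  exact: le_trans (Re_le_normc _) _.
have eI : \int[mu]_x (\int[mu]_y Im (H (x, y))) = \int[mu]_y (\int[mu]_x Im (H (x, y))).
  apply: (@Fubini_R (fun z => Im (H z)) _ _ mH.2 ip iq) => [x|x|x y]; try exact: normc_ge0.
  exact: le_trans (Im_le_normc _) _.
have H1 x : Cintegral (fun y => H (x, y)) = f x * fourier g x.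
  rewrite /fourier -CintegralZ; last exact: fourier_integrable.
  by apply: eq_Cintegral => y; rewrite /H/= (mulrC x y).
have H2 y : Cintegral (fun x => H (x, y)) = fourier f y * g y.
  rewrite /fourier mulrC -CintegralZ; last exact: fourier_integrable.
  by apply: eq_Cintegral => x; rewrite /H/=; ring.
apply: Ceq; rewrite ?ReCintegral ?ImCintegral.
  under eq_Rintegral do rewrite -H2 ReCintegral.
  by rewrite -eR; apply: eq_Rintegral => x _; rewrite -H1 ReCintegral.
under eq_Rintegral do rewrite -H2 ImCintegral.
by rewrite -eI; apply: eq_Rintegral => x _; rewrite -H1 ImCintegral.
Qed.

(** The inverse transform of an integrable function. *)
Definition phi g x : C := ((2 * pi)^-1)%:C * fourier g (- x).

Lemma L2_opp f : CL 2 f -> CL 2 (fun x => f (- x)).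
Proof.
move=> /CL2P[mf hf]; apply/CL2P; split; last by rewrite sqn_opp.
apply: (cmeas_comp _ mf); exact: measurable_funN.
Qed.
Lemma n2_opp f : CL 2 f -> n2 (fun x => f (- x)) = n2 f.
Proof. by move=> Lf; rewrite /n2 sqn_opp//; exact: L2_meas. Qed.

Lemma L2_phi g : CL 1 g -> CL 2 g -> CL 2 (phi g).
Proof. by move=> L1 L2; apply: L2Z; apply: (L2_opp (plancherel L1 L2).1). Qed.

Lemma twopi_gt0 : 0 < 2 * pi :> R. Proof. by rewrite mulr_gt0// pi_gt0. Qed.

Lemma n2_phi g : CL 1 g -> CL 2 g -> n2 (phi g) = (2 * pi)^-1 * n2 g.
Proof.
move=> L1 L2; have [Lg ng] := plancherel L1 L2; have p0 := lt0r_neq0 twopi_gt0.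
rewrite /phi n2Z; last exact: L2_opp.
rewrite (@n2_opp (fourier g))// ng nsq_real.
by move: (2 * pi) p0 => P p0; field.
Qed.

Lemma fourier_conj g xi : CL 1 g -> fourier (fun x => conjc (g x)) xi = conjc (fourier g (- xi)).
Proof.
move=> Lg; rewrite /fourier -Cintegral_conj; last exact: fourier_integrable.
by apply: eq_Cintegral => x; rewrite conjcM -expiN mulNr opprK.
Qed.

Lemma L1_conj g : CL 1 g -> CL 1 (fun x => conjc (g x)).
Proof.
move=> /CL1P[mg hg]; apply/CL1P; split; first exact: cmeas_conj.
by under eq_integral do rewrite normcE nsqJ -normcE.
Qed.

(** Fubini moves the transform from f to conj g, and conjugation turns it into
the inverse transform. *)
Lemma parseval_phi f g : CL 1 f -> CL 2 f -> CL 1 g -> CL 2 g ->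
  inner (fourier f) g = (2 * pi)%:C * inner f (phi g).
Proof.
move=> Lf L2f Lg L2g; rewrite /inner (fourier_swap Lf (L1_conj Lg)) -CintegralZ; last first.
  by apply: L2_mul_integrable => //; exact: L2_phi.
apply: eq_Cintegral => x; rewrite /phi conjcM conjc_real fourier_conj//.
rewrite mulrCA; congr (_ * _); rewrite mulrA -rmorphM.
by rewrite mulfV ?rmorph1 ?mul1r// lt0r_neq0// twopi_gt0.
Qed.

Lemma Cnorm2_lt f (e : R) : 0 < e -> (Cnorm 2 f < e%:E)%E = (sqn f < (e ^+ 2)%:E)%E.
Proof.
move=> e0; rewrite Cnorm2E; have := sqn_ge0 f; case: (sqn f) => [s||//]; last first.
  by move=> _; rewrite /poweR invr_eq0 pnatr_eq0.
rewrite lee_fin => s0; rewrite poweR_EFin !lte_fin powR12_sqrt//.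
rewrite -[e in LHS](ger0_norm (ltW e0)) -sqrtr_sqr ltr_sqrt// exprn_gt0//.
Qed.

Lemma ereal_cvg0 (a_ : nat -> \bar R) : (forall n, (0 <= a_ n)%E) ->
  (forall e : R, 0 < e -> \forall n \near \oo, (a_ n < e%:E)%E) ->
  a_ n @[n --> \oo] --> 0%E.
Proof.
move=> a0 h; apply/fine_cvgP; split.
  apply: filterS (h 1 ltr01) => n a1; rewrite ge0_fin_numE//.
  exact: lt_trans a1 (ltry _).
apply/cvgr0Pnorm_lt => e e0; apply: filterS (h e e0) => n ae /=.
rewrite ger0_norm ?fine_ge0//.
have fn : a_ n \is a fin_num by rewrite ge0_fin_numE//; exact: lt_trans ae (ltry _).
by move: ae; rewrite -{1}(fineK fn) lte_fin.
Qed.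

Lemma L2_cvgP (f_ : nat -> R -> C) f :
  L2_cvg f_ f <-> sqn (f_ n \- f) @[n --> \oo] --> 0%E.
Proof.
split=> [h|h].
  apply: ereal_cvg0 => [n|e e0]; first exact: sqn_ge0.
  have se : 0 < Num.sqrt e by rewrite sqrtr_gt0.
  apply: filterS (near_lt_ereal se h) => n; rewrite Cnorm2_lt// sqr_sqrtr//.
  exact: ltW.
apply: ereal_cvg0 => [n|e e0]; first exact: Lnorm_ge0.
have e2 : 0 < e ^+ 2 by rewrite exprn_gt0.
by apply: filterS (near_lt_ereal e2 h) => n; rewrite Cnorm2_lt.
Qed.

Lemma graph_L2 f g : is_L2_fourier f g -> CL 2 g. Proof. by case. Qed.

Lemma graph_sub f g f' g' : CL 2 f -> CL 2 f' -> is_L2_fourier f g ->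
  is_L2_fourier f' g' -> is_L2_fourier (f \- f') (g \- g').
Proof.
move=> Lf Lf' [Lg [s [s1 /L2_cvgP s2 /L2_cvgP s3]]] [Lg' [s' [s1' /L2_cvgP s2' /L2_cvgP s3']]].
split; first exact: L2B.
have cvB (u u' : R -> C) (u_ u_' : nat -> R -> C) : CL 2 u -> CL 2 u' ->
  (forall n, CL 2 (u_ n)) -> (forall n, CL 2 (u_' n)) ->
  sqn (u_ n \- u) @[n --> \oo] --> 0%E -> sqn (u_' n \- u') @[n --> \oo] --> 0%E ->
  sqn ((u_ n \- u_' n) \- (u \- u')) @[n --> \oo] --> 0%E.
  move=> Lu Lu' Lu_ Lu_' c1 c2; apply: ereal_cvg0 => [n|e e0]; first exact: sqn_ge0.
  have e4 : 0 < e / 4 by rewrite divr_gt0.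
  near=> n.
  have h1 : (sqn (u_ n \- u)%R < (e / 4)%:E)%E by near: n; exact: near_lt_ereal.
  have h2 : (sqn (u_' n \- u')%R < (e / 4)%:E)%E by near: n; exact: near_lt_ereal.
  rewrite [X in (sqn X < _)%E](_ : _ = (u_ n \- u) \+ (fun x => - (u_' n \- u') x))%R; last first.
    by apply/funext => x /=; ring.
  apply: le_lt_trans (sqnD_le _ _) _.
  - by apply: L2_meas; exact: L2B.
  - by apply: L2_meas; apply: L2N; exact: L2B.
  rewrite sqnN; move: h1 h2; rewrite (sqnE (L2B (Lu_ n) Lu)) (sqnE (L2B (Lu_' n) Lu')).
  by rewrite -!EFinM -EFinD !lte_fin; lra.
exists (fun n => s n \- s' n); split.
- move=> n; have [a1 a2] := s1 n; have [b1 b2] := s1' n.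
  by split; [exact: L1B|exact: L2B].
- apply/L2_cvgP; apply: cvB => // n; [by have [] := s1 n|by have [] := s1' n].
- have eF : (fun n => fourier (s n \- s' n)) = (fun n => fourier (s n) \- fourier (s' n)).
    apply/funext => n; apply/funext => xi /=.
    have [a1 a2] := s1 n; have [b1 b2] := s1' n.
    by rewrite fourierB.
  rewrite eF; apply/L2_cvgP; apply: cvB => //.
  + by move=> n; have [a1 a2] := s1 n; have [] := plancherel a1 a2.
  + by move=> n; have [a1 a2] := s1' n; have [] := plancherel a1 a2.
Unshelve. all: by end_near. Qed.

(** The isometry passes to the closure of the graph; in particular a function has
at most one transform, up to null sets. *)
Lemma graph_isometry f g : CL 2 f -> is_L2_fourier f g -> n2 g = 2 * pi * n2 f.
Proof.
move=> Lf [Lg [s [s1 /L2_cvgP s2 /L2_cvgP s3]]].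
have L1s n : CL 1 (s n) by have [] := s1 n.
have L2s n : CL 2 (s n) by have [] := s1 n.
have c1 := cvg_n2 Lf L2s s2.
have c2 : n2 (fourier (s n)) @[n --> \oo] --> n2 g.
  by apply: cvg_n2 => // n; have [] := plancherel (L1s n) (L2s n).
have c3 : n2 (fourier (s n)) @[n --> \oo] --> 2 * pi * n2 f.
  rewrite (_ : (fun n => _) = fun n => 2 * pi * n2 (s n)).
    by apply: cvgM => //; exact: cvg_cst.
  by apply/funext => n; have [] := plancherel (L1s n) (L2s n).
exact: cvg_unique c2 c3.
Qed.

(** Fourier inversion in L2.  The truncations s_n of phi g are in L1 and L2.
Expanding the square and using [plancherel] and [parseval_phi], the squared
distance of the transform of s_n to g is 2 pi times that of s_n to phi g. *)
Lemma graph_phi g : CL 1 g -> CL 2 g -> is_L2_fourier (phi g) g.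
Proof.
move=> L1g L2g; split => //; have Lp := L2_phi L1g L2g.
pose I n : set R := `]- (n%:R : R), n%:R]%classic.
have mI n : measurable (I n) by exact: measurable_itv.
pose s n x := phi g x * cind (I n) x.
have ms n : Cmeasurable (s n).
  by apply: cmeas_mul; [exact: L2_meas|exact: meas_cind].
have L2s n : CL 2 (s n).
  apply: L2_le Lp _ => // x; rewrite /s nsqM nsq_cind ler_piMr ?nsq_ge0// indicE.
have L1s n : CL 1 (s n).
  apply: Cintegrable_L1.
  have -> : s n = fun x => s n x * conjc (cind (I n) x).
    apply/funext => x; rewrite /s {2}/cind conjc_real -/(cind _ _) -mulrA -cindI.
    by rewrite setIid.
  by apply: L2_mul_integrable => //; exact: L2_itv.
have sc : sqn (s n \- phi g) @[n --> \oo] --> 0%E.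
  apply: (@sqn_cvg0 _ _ (fun x => nsq (phi g x))).
  - by move=> n; apply: cmeas_sub => //; exact: L2_meas.
  - move=> n x; rewrite /s /= cindE_itv; case: ifP => _; rewrite ?mulr1 ?mulr0.
      by rewrite subrr nsq0 nsq_ge0.
    by rewrite sub0r nsqN.
  - exact: L2_nsq_integrable.
  - move=> x; apply: cvg_near_cst; apply: filterS (cind_cut x) => n e.
    by rewrite /s /= e mulr1 subrr nsq0.
exists s; split.
- by move=> n; split.
- exact/L2_cvgP.
apply/L2_cvgP.
have e n : sqn (fourier (s n) \- g) = ((2 * pi)%:E * sqn (s n \- phi g)%R)%E.
  have [Lf nf] := plancherel (L1s n) (L2s n).
  rewrite (sqnE (L2B Lf L2g)) (sqnE (L2B (L2s n) Lp)) -EFinM; congr EFin.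
  rewrite !n2B// nf parseval_phi// n2_phi// !ReImE /= mul0r subr0.
  have := lt0r_neq0 twopi_gt0; move: (2 * pi) => P p0; field; exact: p0.
have -> : (fun n => sqn (fourier (s n) \- g)) = (fun n => (2 * pi)%:E * sqn (s n \- phi g)%R)%E.
  exact/funext.
rewrite -[X in _ --> X](mule0 (2 * pi)%:E).
by apply: cvgeM => //; exact: cvg_cst.
Qed.

Lemma n2_phiB f g h : CL 2 f -> is_L2_fourier f g -> CL 1 h -> CL 2 h ->
  n2 (g \- h) = 2 * pi * n2 (f \- phi h).
Proof.
move=> Lf Fg L1h L2h; apply: graph_isometry; first by apply: L2B => //; exact: L2_phi.
by apply: graph_sub => //; [exact: L2_phi|exact: graph_phi].
Qed.

Lemma hardy_phi g : CL 1 g -> CL 2 g -> (forall xi, xi <= 0 -> g xi = 0) -> hardy (phi g).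
Proof.
move=> L1g L2g g0; split; first exact: L2_phi.
by exists g; [exact: graph_phi|exact: aeW].
Qed.

Lemma hardy_L2 f : hardy f -> CL 2 f. Proof. by case. Qed.

Lemma phiD f g : CL 1 f -> CL 1 g -> phi (f \+ g) = phi f \+ phi g.
Proof. by move=> Lf Lg; apply/funext => x; rewrite /phi /= fourierD// mulrDr. Qed.
Lemma phiZ c f : CL 1 f -> phi (fun x => c * f x) = fun x => c * phi f x.
Proof. by move=> Lf; apply/funext => x; rewrite /phi fourierZ// mulrCA. Qed.

Lemma Re_inner_phi f g : CL 1 f -> CL 2 f -> CL 1 g -> CL 2 g ->
  Re (inner (phi f) (phi g)) = (2 * pi)^-1 * Re (inner f g).
Proof.
move=> L1f L2f L1g L2g.
have := n2_phi (L1D L1f L1g) (L2D L2f L2g).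
rewrite phiD// !n2D//; try exact: L2_phi.
rewrite !n2_phi//; move: (2 * pi)^-1 => P; lra.
Qed.

(** Polarization: the real parts agree by [Re_inner_phi], and the imaginary part
is the real part for i g in place of g. *)
Lemma inner_phi f g : CL 1 f -> CL 2 f -> CL 1 g -> CL 2 g ->
  inner (phi f) (phi g) = ((2 * pi)^-1)%:C * inner f g.
Proof.
move=> L1f L2f L1g L2g; have Lp := L2_phi L1f L2f; have Lq := L2_phi L1g L2g.
apply: Ceq; first by rewrite Re_inner_phi// !ReImE/= mul0r subr0.
have := @Re_inner_phi f (fun x => 'i%C * g x) L1f L2f (L1Z _ L1g) (L2Z _ L2g).
have iE z : Re (conjc 'i%C * z) = Im z by case: z => u v; rewrite /=; ring.
rewrite phiZ// innerZr// innerZr// iE iE ImM => ->.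
by rewrite /= mul0r addr0.
Qed.

Lemma translationE y f : translation y f = fun x => f (1 * x + - y).
Proof. by apply/funext => x; rewrite /translation mul1r. Qed.

Lemma L2_translation y f : CL 2 f -> CL 2 (translation y f).
Proof. by move=> Lf; rewrite translationE; exact: L2_affine. Qed.
Lemma L1_translation y f : CL 1 f -> CL 1 (translation y f).
Proof. by move=> Lf; rewrite translationE; exact: L1_affine. Qed.

Lemma sqn_translation y f : Cmeasurable f -> sqn (translation y f) = sqn f.
Proof. by move=> mf; rewrite translationE sqn_affine// invr1 mul1e. Qed.

Lemma fourier_translation y f xi : CL 1 f ->
  fourier (translation y f) xi = expi (- (xi * y)) * fourier f xi.
Proof.
move=> Lf; rewrite /fourier -CintegralZ; last exact: fourier_integrable.
rewrite translationE.
have := @Cintegral_affine _ 1 (- y) (fun x => expi (- (xi * y)) * (f x * expi (- (xi * x)))).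
rewrite invr1 mul1r => <-//; last by apply: CintegrableZ; exact: fourier_integrable.
apply: eq_Cintegral => x; rewrite mulrCA -expiD; congr (_ * expi _); ring.
Qed.

(** A translation multiplies the transform by a unimodular function. *)
Lemma hardy_translation y f : hardy f -> hardy (translation y f).
Proof.
move=> [Lf [g [Lg [s [s1 /L2_cvgP s2 /L2_cvgP s3]]] g0]].
split; first exact: L2_translation.
pose e xi : C := expi (- (xi * y)).
have me : Cmeasurable e by apply: cmeas_expi; apply: measurable_funN; exact: measurable_funM.
exists (fun xi => e xi * g xi); last first.
  case: g0 => N [mN N0 sub]; exists N; split => // xi /= h; apply: sub => /= k.
  by apply: h => /k ->; rewrite mulr0.
have ne xi z : nsq (e xi * z) = nsq z by rewrite nsqM nsq_expi mul1r.
split.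
  by apply: (L2_le _ Lg) => [|x]; [exact: cmeas_mul me (L2_meas Lg)|rewrite ne].
exists (fun n => translation y (s n)); split.
- by move=> n; have [a b] := s1 n; split; [exact: L1_translation|exact: L2_translation].
- apply/L2_cvgP; rewrite (_ : (fun n => _) = fun n => sqn (s n \- f))//.
  apply/funext => n; rewrite -(@sqn_translation y (s n \- f))//.
  by apply: cmeas_sub; apply: L2_meas => //; have [] := s1 n.
- apply/L2_cvgP; rewrite (_ : (fun n => _) = fun n => sqn (fourier (s n) \- g))//.
  apply/funext => n; apply: eq_sqn => xi /=; have [a b] := s1 n.
  by rewrite fourier_translation// -/(e xi) -mulrBr ne.
Qed.

End Plancherel.

(** * Wavelets defined on the frequency side *)
Section Framework.
Variable R : realType.
Local Notation C := R[i].
Local Notation mu := (@lebesgue_measure R).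
Implicit Types (f g h : R -> C) (c : C) (a b x y xi : R).

Lemma closed_spanP (S : set (R -> C)) f : S `<=` CL 2 ->
  closed_span S f <-> hardy f /\ clspan S f.
Proof.
move=> SL; split.
  move=> [hf h]; split => //; split; first exact: hardy_L2.
  move=> e e0; have se : 0 < Num.sqrt e by rewrite sqrtr_gt0.
  have [n [c [u [Su hu]]]] := h _ se.
  exists (fun x => \sum_(i < n) c i * u i x); first by exists n, c, u.
  by move: hu; rewrite Cnorm2_lt// sqr_sqrtr// ltW.
move=> [hf [_ h]]; split => // e e0.
have e2 : 0 < e ^+ 2 by rewrite exprn_gt0.
have [s [n [c [u [Su ->]]]] fs] := h _ e2.
by exists n, c, u; split => //; rewrite Cnorm2_lt.
Qed.

(** Translation is an isometry, so f |-> <T_y f, w> is continuous; it vanishes on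
U, hence on the closed span of U. *)
Lemma clspan_inner0 (U : set (R -> C)) f w y : U `<=` CL 2 -> CL 2 w ->
  (forall u, U u -> inner (translation y u) w = 0) -> clspan U f ->
  inner (translation y f) w = 0.
Proof.
move=> UL Lw U0 [Lf h].
have key (e : R) : 0 < e -> nsq (inner (translation y f) w) <= e * n2 w.
  move=> e0; have [s Ss fs] := h _ e0.
  have Ls := lincomb_L2 UL Ss.
  have s0 : inner (translation y s) w = 0.
    have [n [c [u [Uu sE]]]] := Ss.
    have Lu i : CL 2 (translation y (u i)) by apply: L2_translation; exact: UL.
    have -> : translation y s = fun x => \sum_(i < n) c i * translation y (u i) x.
      by rewrite sE.
    rewrite (@inner_suml _ _ (fun i x => c i * translation y (u i) x))//.
      by rewrite big1// => i _; rewrite innerZl// U0// mulr0.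
    by move=> i; exact: L2Z.
  have -> : inner (translation y f) w = inner (translation y (f \- s)) w.
    have -> : translation y (f \- s) = translation y f \+ (fun x => -1 * translation y s x).
      by apply/funext => x; rewrite /translation /= mulN1r.
    rewrite innerDl//; [|exact: L2_translation|by apply: L2Z; exact: L2_translation].
    by rewrite innerZl ?s0 ?mulr0 ?addr0//; exact: L2_translation.
  apply: le_trans (inner_CS (L2_translation y (L2B Lf Ls)) Lw) _.
  rewrite ler_wpM2r ?n2_ge0// /n2 sqn_translation; last exact: L2_meas (L2B Lf Ls).
  by move: fs; rewrite (sqnE (L2B Lf Ls)) lte_fin => /ltW.
have : nsq (inner (translation y f) w) <= 0.
  rewrite leNgt; apply/negP => I0.
  have w0 : 0 < n2 w + 1 by rewrite ltr_wpDl ?n2_ge0.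
  have := key (nsq (inner (translation y f) w) / (2 * (n2 w + 1))).
  rewrite divr_gt0 ?mulr_gt0// => /(_ isT).
  set I := nsq _ in I0 *.
  have -> : I / (2 * (n2 w + 1)) * n2 w = (I / 2) * (n2 w / (n2 w + 1)) by field; rewrite gt_eqF.
  have : n2 w / (n2 w + 1) <= 1 by rewrite ler_pdivrMr// mul1r lerDl.
  move=> h1; have := ler_wpM2l (ltW (divr_gt0 I0 (ltr0Sn _ 1))) h1; lra.
rewrite le_eqVlt ltNge nsq_ge0 orbF /nsq paddr_eq0 ?sqr_ge0// !sqrf_eq0 => /andP[/eqP r0 /eqP i0].
exact: Ceq.
Qed.

Lemma translation0 f : translation 0 f = f.
Proof. by apply/funext => x; rewrite /translation subr0. Qed.

Section Wavelet.
Variable G : R -> C.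
Hypothesis L1G : CL 1 G.
Hypothesis L2G : CL 2 G.
Hypothesis G0 : forall xi, xi <= 0 -> G xi = 0.

Definition pw (j : int) : R := 2 ^ j.
Lemma pw_gt0 j : 0 < pw j. Proof. exact: exprz_gt0. Qed.
Lemma pw_neq0 j : pw j != 0. Proof. by rewrite lt0r_neq0// pw_gt0. Qed.
Lemma pwD i j : pw (i + j) = pw i * pw j.
Proof. by rewrite /pw expfzDr// pnatr_eq0. Qed.
Lemma pwN j : pw (- j) = (pw j)^-1. Proof. by rewrite /pw invr_expz. Qed.

Definition hpw (j : int) : R := 2 `^ (j%:~R / 2).
Lemma hpw_gt0 j : 0 < hpw j. Proof. exact: powR_gt0. Qed.
Lemma hpw_sq j : hpw j * hpw j = pw j.
Proof.
rewrite /hpw -powRD; last by rewrite pnatr_eq0 implybT.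
by rewrite -splitr powR_intmul.
Qed.

(** The transforms of the wavelets psi_jk for psi = phi G. *)
Definition Gd (jk : int * int) xi : C :=
  ((hpw jk.1)^-1)%:C * (G ((pw jk.1)^-1 * xi) * expi (- (jk.2%:~R * ((pw jk.1)^-1 * xi)))).

Lemma L2_mul_bounded f g : CL 2 f -> Cmeasurable g -> (forall x, nsq (g x) <= 1) ->
  CL 2 (f \* g).
Proof.
move=> Lf mg g1; apply: (L2_le _ Lf); first exact: (cmeas_mul (L2_meas Lf) mg).
by move=> x /=; rewrite nsqM ler_piMr ?nsq_ge0.
Qed.

Lemma L1_Gscale j : CL 1 (fun xi => G ((pw j)^-1 * xi)).
Proof.
have ai : 0 < (pw j)^-1 by rewrite invr_gt0 pw_gt0.
by have := L1_affine 0 ai L1G; under eq_fun do rewrite addr0.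
Qed.
Lemma L2_Gscale j : CL 2 (fun xi => G ((pw j)^-1 * xi)).
Proof.
have ai : 0 < (pw j)^-1 by rewrite invr_gt0 pw_gt0.
by have := L2_affine 0 ai L2G; under eq_fun do rewrite addr0.
Qed.

Let me (k : R) j : Cmeasurable (fun xi : R => expi (- (k * ((pw j)^-1 * xi)))).
Proof. by apply: cmeas_expi; apply: measurable_funN; apply: measurable_funM => //; exact: measurable_funM. Qed.

Lemma L1_Gd jk : CL 1 (Gd jk).
Proof.
apply: L1Z; apply: (@L1_mul_bounded _ (fun xi => G ((pw jk.1)^-1 * xi))) => //.
  exact: L1_Gscale.
by move=> x; rewrite normc_expi.
Qed.
Lemma L2_Gd jk : CL 2 (Gd jk).
Proof.
apply: L2Z; apply: (@L2_mul_bounded (fun xi => G ((pw jk.1)^-1 * xi))) => //.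
  exact: L2_Gscale.
by move=> x; rewrite nsq_expi.
Qed.
Lemma Gd0 jk xi : xi <= 0 -> Gd jk xi = 0.
Proof.
by move=> x0; rewrite /Gd G0 ?mul0r ?mulr0// pmulr_rle0 ?invr_gt0 ?pw_gt0.
Qed.

Lemma Cintegral_scale (a : R) (F : R -> C) : 0 < a -> Cintegrable F ->
  Cintegral (fun x => F (a^-1 * x)) = a%:C * Cintegral F.
Proof.
move=> a0 iF; have ai : 0 < a^-1 by rewrite invr_gt0.
have := Cintegral_affine 0 ai iF; rewrite invrK => <-.
by apply: eq_Cintegral => x; rewrite addr0.
Qed.

Lemma wavelet_systemE jk : wavelet_system (phi G) jk = phi (Gd jk).
Proof.
case: jk => j k; apply/funext => x; rewrite /wavelet_system /phi /=.
rewrite mulrCA; congr (_ * _); rewrite /fourier.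
pose F eta : C := ((hpw j)^-1)%:C * (G eta * expi (- (- (pw j * x - k%:~R) * eta))).
have iF : Cintegrable F by apply: CintegrableZ; exact: (fourier_integrable _ L1G).
rewrite [RHS](_ : _ = Cintegral (fun xi => F ((pw j)^-1 * xi))); last first.
  apply: eq_Cintegral => xi; rewrite /Gd /F/= -!mulrA; congr (_ * (_ * _)).
  rewrite -expiD; congr expi; field; exact: pw_neq0.
rewrite (Cintegral_scale (pw_gt0 j) iF) /F CintegralZ; last exact: (fourier_integrable _ L1G).
rewrite mulrA -rmorphM (_ : pw j * (hpw j)^-1 = hpw j)//.
by rewrite -hpw_sq mulfK// lt0r_neq0// hpw_gt0.
Qed.

Let u jk := wavelet_system (phi G) jk.

Lemma hardy_u jk : hardy (u jk).
Proof. by rewrite /u wavelet_systemE; apply: hardy_phi; [exact: L1_Gd|exact: L2_Gd|exact: Gd0]. Qed.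

Lemma L2_u jk : CL 2 (u jk). Proof. exact: hardy_L2 (hardy_u jk). Qed.

Lemma hardy_phiG : hardy (phi G). Proof. exact: hardy_phi. Qed.

(** The correlations of G with its dyadic dilates carry all inner products of
the wavelet system, see [inner_mod_Gd]. *)
Definition corr (d : int) (th : R) : C :=
  Cintegral (fun eta => G (pw d * eta) * conjc (G eta) * expi (th * eta)).

Lemma corr_integrable (d : int) (th : R) :
  Cintegrable (fun eta => G (pw d * eta) * conjc (G eta) * expi (th * eta)).
Proof.
have L : CL 2 ((fun xi => G ((pw (- d))^-1 * xi)) \* (fun x => expi (th * x))).
  apply: L2_mul_bounded; [exact: L2_Gscale|exact: meas_expiM|].
  by move=> x; rewrite nsq_expi.
rewrite (_ : (fun eta => _) = fun x => ((fun xi => G ((pw (- d))^-1 * xi)) \* (fun x => expi (th * x))) x * conjc (G x)).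
  exact: L2_mul_integrable.
by apply/funext => x; rewrite /= pwN invrK; ring.
Qed.

(** Translation by y on the frequency side. *)
Definition mod_ (y : R) g xi : C := expi (- (xi * y)) * g xi.

Let meas_e y : Cmeasurable (fun xi : R => expi (- (xi * y))).
Proof. by apply: cmeas_expi; apply: measurable_funN; exact: measurable_funM. Qed.

Lemma L2_mod y g : CL 2 g -> CL 2 (mod_ y g).
Proof.
move=> Lg; rewrite /mod_; have := @L2_mul_bounded g _ Lg (meas_e y).
rewrite (_ : g \* _ = fun xi => expi (- (xi * y)) * g xi).
  by apply => x; rewrite nsq_expi.
by apply/funext => xi; rewrite /= mulrC.
Qed.
Lemma L1_mod y g : CL 1 g -> CL 1 (mod_ y g).
Proof.
move=> Lg; rewrite /mod_; have := @L1_mul_bounded _ g _ Lg (meas_e y).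
rewrite (_ : g \* _ = fun xi => expi (- (xi * y)) * g xi).
  by apply => x; rewrite normc_expi.
by apply/funext => xi; rewrite /= mulrC.
Qed.

Lemma translation_phi y g : translation y (phi g) = phi (mod_ y g).
Proof.
apply/funext => x; rewrite /translation /phi /fourier; congr (_ * _).
apply: eq_Cintegral => xi; rewrite /mod_ [expi (- (xi * y)) * _]mulrC -mulrA -expiD; congr (_ * expi _); ring.
Qed.

Lemma inner_mod_Gd y l k j k' :
  inner (mod_ y (Gd (l, k))) (Gd (j, k')) =
  (pw j / (hpw l * hpw j))%:C * corr (j - l) (k'%:~R - k%:~R * pw (j - l) - y * pw j).
Proof.
set th := _ - y * pw j.
pose F eta : C := ((hpw l * hpw j)^-1)%:C * (G (pw (j - l) * eta) * conjc (G eta) * expi (th * eta)).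
have iF : Cintegrable F by apply: CintegrableZ; exact: corr_integrable.
rewrite /inner (_ : Cintegral _ = Cintegral (fun xi => F ((pw j)^-1 * xi))).
  rewrite (Cintegral_scale (pw_gt0 j) iF) /F CintegralZ; last exact: corr_integrable.
  by rewrite mulrA -rmorphM.
apply: eq_Cintegral => xi; rewrite /mod_ /Gd /F /= !conjcM !conjc_real.
have -> : pw (j - l) * ((pw j)^-1 * xi) = (pw l)^-1 * xi.
  by rewrite pwD pwN; field; rewrite !pw_neq0.
rewrite -expiN invfM rmorphM opprK.
have -> : expi (th * ((pw j)^-1 * xi)) = expi (- (xi * y)) * expi (- (k%:~R * ((pw l)^-1 * xi))) *
    expi (k'%:~R * ((pw j)^-1 * xi)).
  rewrite -!expiD; congr expi; rewrite /th pwD pwN; field; rewrite !pw_neq0//.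
ring.
Qed.

Hypothesis corr0 : forall q : int, corr 0 q%:~R = (2 * pi)%:C * (q == 0)%:R.
Hypothesis corr1 : forall d q : int, 0 < d -> corr d q%:~R = 0.
Hypothesis complete : forall h, CL 2 h -> (forall xi, xi <= 0 -> h xi = 0) ->
  clspan (range Gd) h.

Lemma pw_int d : 0 <= d -> exists m : int, pw d = m%:~R.
Proof.
case: d => // n _; exists (2 ^+ n); rewrite /pw -exprnP.
by rewrite rmorphXn.
Qed.

Lemma mod_0 g : mod_ 0 g = g.
Proof. by apply/funext => xi; rewrite /mod_ mulr0 oppr0 expi0 mul1r. Qed.

Lemma inner_u_le l k j k' : l <= j -> inner (u (l, k)) (u (j, k')) = ((l, k) == (j, k'))%:R.
Proof.
move=> lj; rewrite /u !wavelet_systemE inner_phi; try solve [exact: L1_Gd|exact: L2_Gd].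
rewrite -[Gd (l, k)]mod_0 inner_mod_Gd mul0r subr0.
move: lj; rewrite le_eqVlt => /predU1P[<-|lj].
  rewrite subrr hpw_sq mulfV ?pw_neq0// rmorph1 mul1r [pw 0]expr0z mulr1 -intrB corr0.
  rewrite mulrA -rmorphM mulVf ?lt0r_neq0 ?twopi_gt0// rmorph1 mul1r.
  by rewrite subr_eq0 xpair_eqE eqxx eq_sym.
have [m ->] : exists m : int, pw (j - l) = m%:~R by apply: pw_int; rewrite subr_ge0 ltW.
rewrite -intrM -intrB corr1 ?subr_gt0// !mulr0.
by rewrite xpair_eqE (lt_eqF lj).
Qed.

Lemma inner_u p q : inner (u p) (u q) = (p == q)%:R.
Proof.
case: p q => [l k] [j k']; case: (leP l j) => lj; first exact: inner_u_le.
rewrite (innerC (L2_u (j, k')) (L2_u (l, k))) inner_u_le; last exact: ltW.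
by rewrite eq_sym; case: (_ == _); rewrite ?conjc1 ?conjc0.
Qed.

Lemma phi_lincomb f : lincomb (range Gd) f -> lincomb (range u) (phi f).
Proof.
move=> [n [c [g [Ug ->]]]].
have L1 i : CL 1 (g i) by have [p _ <-] := Ug i; exact: L1_Gd.
exists n, c, (fun i => phi (g i)); split.
  move=> i; have [p _ <-] := Ug i; exists p => //.
  by rewrite /u wavelet_systemE.
apply/funext => x; rewrite {1}/phi (@fourier_sum _ n (fun i x => c i * g i x)).
  rewrite mulr_sumr; apply: eq_bigr => i _.
  by rewrite fourierZ// mulrCA.
by move=> i; exact: L1Z.
Qed.

Lemma sub_u : range u `<=` CL 2. Proof. by move=> _ [p _ <-]; exact: L2_u. Qed.
Lemma sub_Gd : range Gd `<=` CL 2. Proof. by move=> _ [p _ <-]; exact: L2_Gd. Qed.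

(** The transform g of f agrees almost everywhere with a function h on the positive
half-line; a combination close to h on the frequency side is mapped by phi to a
combination of wavelets close to f. *)
Lemma hardy_clspan f : hardy f -> clspan (range u) f.
Proof.
move=> [Lf [g Fg g0]]; split => // e e0.
pose h xi : C := g xi * cind `]0, +oo[ xi.
have Lg := graph_L2 Fg.
have mI : measurable (`]0, +oo[%classic : set R) by exact: measurable_itv.
have hg xi : 0 < xi -> h xi = g xi.
  by move=> x0; rewrite /h cindT ?mulr1//= in_itv/= x0.
have h0 xi : xi <= 0 -> h xi = 0.
  move=> x0; rewrite /h cindF ?mulr0// => /=.
  by rewrite in_itv/= andbT ltNge x0.
have Lh : CL 2 h.
  apply: (@L2_mul_bounded g (cind `]0, +oo[)) => //; first exact: meas_cind.
  by move=> x; rewrite nsq_cind indicE; case: (x \in _).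
have gh : sqn (g \- h) = 0%E.
  rewrite -(@integral0 _ _ _ mu setT); apply: ae_eq_integral => //.
  - by apply/measurable_EFinP; apply: (@meas_nsq _ (g \- h)); apply: cmeas_sub; exact: L2_meas.
  - case: g0 => N [mN N0 sub]; exists N; split => // xi /= k; apply: sub => /= k'.
    apply: k => _; case: (ltP 0 xi) => x0; first by rewrite hg// subrr nsq0.
    by rewrite h0// k'// subrr nsq0.
have pe : 0 < pi * e by rewrite mulr_gt0// pi_gt0.
have [_ /(_ _ pe)[s Ss hs]] := complete Lh h0.
exists (phi s); first exact: phi_lincomb.
have Ls := lincomb_L2 sub_Gd Ss.
have L1s : CL 1 s.
  have [n [c [v [Uv ->]]]] := Ss; apply: L1_sum => i; apply: L1Z.
  by have [p _ <-] := Uv i; exact: L1_Gd.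
rewrite (sqnE (L2B Lf (L2_phi L1s Ls))) lte_fin.
have := sqn_tri (L2_meas Lg) (L2_meas Lh) (L2_meas Ls).
rewrite gh mule0 add0e; move: hs; rewrite (sqnE (L2B Lh Ls)) (sqnE (L2B Lg Ls)).
rewrite (n2_phiB Lf Fg L1s Ls) -EFinM lee_fin lte_fin => hs.
rewrite -mulrA ler_pM2l// => gs.
by rewrite -(ltr_pM2l (pi_gt0 R)); exact: le_lt_trans gs hs.
Qed.

Lemma phiG_wavelet : H2_wavelet (phi G).
Proof.
split; first exact: hardy_phiG.
split; [exact: hardy_u|exact: inner_u|].
by move=> f hf; apply/closed_spanP; [exact: sub_u|split => //; exact: hardy_clspan].
Qed.

Let V0set : set (R -> C) := [set u lk | lk in [set lk : int * int | lk.1 < 0]].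

Lemma sub_V0set : V0set `<=` CL 2. Proof. by move=> _ [p _ <-]; exact: L2_u. Qed.

(** Approximate f by s1 + s2, where s1 collects the terms of negative scale.
As f - s1 is orthogonal to s2, dropping s2 brings the approximation closer. *)
Lemma V0P f : V0 (phi G) f <-> hardy f /\ forall j k, 0 <= j -> inner f (u (j, k)) = 0.
Proof.
rewrite /V0 closed_spanP; last exact: sub_V0set.
split=> [[hf cf]|[hf f0]]; split => //.
  move=> j k j0; rewrite -[f]translation0.
  apply: (clspan_inner0 sub_V0set) cf; first exact: L2_u.
  move=> _ [[l k'] /= l0 <-]; rewrite translation0 inner_u xpair_eqE.
  by rewrite (lt_eqF (lt_le_trans l0 j0)).
have [Lf h] := hardy_clspan hf; split => // e e0.
have [_ [n [c [v [Uv ->]]]] fs] := h _ e0.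
have /choice[p Hp] : forall i, exists p, u p = v i by move=> i; have [p _ <-] := Uv i; exists p.
pose s1 x := \sum_(i < n) (if (p i).1 < 0 then c i else 0) * u (if (p i).1 < 0 then p i else (-1, 0)) x.
pose s2 x := \sum_(i < n) (if (p i).1 < 0 then 0 else c i) * u (p i) x.
have Ls1 : CL 2 s1 by apply: L2_sum => i; apply: L2Z; exact: L2_u.
have Ls2 : CL 2 s2 by apply: L2_sum => i; apply: L2Z; exact: L2_u.
have s12 : (fun x => \sum_(i < n) c i * v i x) = s1 \+ s2.
  apply/funext => x; rewrite /s1 /s2 /= -big_split/=; apply: eq_bigr => i _.
  by rewrite -Hp; case: ifP => _; rewrite mul0r ?addr0 ?add0r.
exists s1.
  exists n, (fun i => if (p i).1 < 0 then c i else 0), (fun i => u (if (p i).1 < 0 then p i else (-1, 0))).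
  split => // i; case: ifP => pi0; first by exists (p i).
  by exists (-1, 0).
apply: le_lt_trans fs; rewrite s12 (sqnE (L2B Lf Ls1)) (sqnE (L2B Lf (L2D Ls1 Ls2))) lee_fin.
have -> : f \- (s1 \+ s2) = (f \- s1) \- s2.
  by apply/funext => x /=; rewrite opprD addrA.
rewrite (n2B (L2B Lf Ls1) Ls2).
have -> : inner (f \- s1) s2 = 0.
  rewrite /s2 (@inner_sumr _ _ (fun i x => (if (p i).1 < 0 then 0 else c i) * u (p i) x)); last 2 first.
  - by move=> i; apply: L2Z; exact: L2_u.
  - exact: L2B.
  apply: big1 => i _; rewrite innerZr; [|exact: L2_u|exact: L2B].
  case: ltP => pi0; first by rewrite conjc0 mul0r.
  have -> : f \- s1 = f \+ (fun x => -1 * s1 x) by apply/funext => x /=; rewrite mulN1r.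
  rewrite innerDl; [|by []|by apply: L2Z|exact: L2_u].
  rewrite innerZl; [|by []|exact: L2_u].
  rewrite {1}[p i]surjective_pairing f0// add0r.
  rewrite (@inner_suml _ _ (fun j x => (if (p j).1 < 0 then c j else 0) * u (if (p j).1 < 0 then p j else (-1, 0)) x)); last 2 first.
  - by move=> j; apply: L2Z; exact: L2_u.
  - exact: L2_u.
  rewrite big1 ?mulr0// => j _; rewrite innerZl; [|exact: L2_u|exact: L2_u].
  case: ifP => pj0; last by rewrite mul0r.
  rewrite inner_u; case: eqP => [e1|]; last by rewrite mulr0.
  by move: pj0; rewrite e1 ltNge pi0.
by rewrite /= mulr0 subr0 lerDl n2_ge0.
Qed.

(** For l < 0 <= j the inner product of T_y psi_lk with psi_jk' is a multiple of
corr d (q - 2^j y) with d = j - l > j and q an integer. *)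
Lemma translation_V0 y :
  (forall d j q : int, 0 <= j -> j < d -> corr d (q%:~R - y * pw j) = 0) ->
  forall f, V0 (phi G) f -> V0 (phi G) (translation y f).
Proof.
move=> cy f Vf; have hf : hardy f by have /V0P[] := Vf.
apply/V0P; split; first exact: hardy_translation.
move=> j k' j0; move: Vf; rewrite /V0 closed_spanP; last exact: sub_V0set.
move=> [_]; apply: (clspan_inner0 sub_V0set); first exact: L2_u.
move=> _ [[l k] /= l0 <-]; rewrite /u !wavelet_systemE translation_phi.
rewrite inner_phi; [|by apply: L1_mod; exact: L1_Gd|by apply: L2_mod; exact: L2_Gd|exact: L1_Gd|exact: L2_Gd].
have lj : 0 <= j - l by rewrite subr_ge0 (le_trans (ltW l0)).
have [m mE] := pw_int lj.
rewrite inner_mod_Gd mE -intrM -intrB cy ?mulr0//.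
by rewrite ltrBrDl gtrDr.
Qed.

(** The translate of psi_(-1,0) has to be orthogonal to psi_(0,0). *)
Lemma translation_V0_inv y : (forall f, V0 (phi G) f -> V0 (phi G) (translation y f)) ->
  corr 1 (- y) = 0.
Proof.
move=> h.
have V1 : V0 (phi G) (u (-1, 0)).
  apply/V0P; split; first exact: hardy_u.
  by move=> j k j0; rewrite inner_u xpair_eqE (@lt_eqF _ _ (-1 : int))// (lt_le_trans _ j0).
have /V0P[_ /(_ 0 0 (lexx _))] := h _ V1.
rewrite /u !wavelet_systemE translation_phi.
rewrite inner_phi; [|by apply: L1_mod; exact: L1_Gd|by apply: L2_mod; exact: L2_Gd|exact: L1_Gd|exact: L2_Gd].
rewrite inner_mod_Gd mul0r subrr sub0r [pw 0]expr0z mulr1 sub0r opprK.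
rewrite mulrA -rmorphM => /eqP; rewrite mulf_eq0 => /orP[|/eqP//].
rewrite (_ : 0 = 0%:C)// (inj_eq (@complexI _)) gt_eqF//.
by rewrite mulr_gt0 ?divr_gt0 ?mulr_gt0 ?hpw_gt0// invr_gt0 twopi_gt0.
Qed.

End Wavelet.
End Framework.

(** * Powers approximating a threshold *)
Section Threshold.
Variable R : realType.
Implicit Types (x t u : R).

Lemma bernoulli_add x n : 0 <= x -> 1 + n%:R * x <= (1 + x) ^+ n.
Proof.
move=> x0; elim: n => [|n IH]; first by rewrite mul0r addr0 expr0.
rewrite exprS -natr1; apply: (@le_trans _ _ ((1 + x) * (1 + n%:R * x))).
  by have := mulr_ge0 (mulr_ge0 (ler0n R n) x0) x0; nra.
by rewrite ler_wpM2l// addr_ge0.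
Qed.

Lemma bernoulli_sub x n : 0 <= x <= 1 -> 1 - n%:R * x <= (1 - x) ^+ n.
Proof.
move=> /andP[x0 x1]; elim: n => [|n IH]; first by rewrite mul0r subr0 expr0.
rewrite exprS -natr1; apply: (@le_trans _ _ ((1 - x) * (1 - n%:R * x))).
  by have := mulr_ge0 (mulr_ge0 (ler0n R n) x0) x0; nra.
by rewrite ler_wpM2l// subr_ge0.
Qed.

Lemma cvg_nexpr t : 0 <= t < 1 -> n%:R * t ^+ n @[n --> \oo] --> (0 : R).
Proof.
move=> /andP[t0 t1]; pose q := Num.sqrt t.
have q0 : 0 <= q by exact: sqrtr_ge0.
have q1 : q < 1 by rewrite -(@sqrtr1 R) ltr_sqrt.
have tq : t = q * q by rewrite -expr2 sqr_sqrtr.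
have qn n : n%:R * q ^+ n <= (1 - q)^-1.
  have h1 : 0 <= 1 - q by rewrite subr_ge0 ltW.
  have := bernoulli_add n h1; have : (1 + (1 - q)) * q <= 1 by nra.
  move=> h2 h3; rewrite -[X in _ <= X]mul1r ler_pdivlMr ?subr_gt0//.
  have qn0 : 0 <= q ^+ n by rewrite exprn_ge0.
  have h4 : ((1 + (1 - q)) * q) ^+ n <= 1.
    by rewrite exprn_ile1// mulr_ge0// addr_ge0.
  rewrite exprMn in h4; nra.
have cq : (1 - q)^-1 * q ^+ n @[n --> \oo] --> (0 : R).
  rewrite -[X in _ --> X](mulr0 (1 - q)^-1); apply: cvgM; first exact: cvg_cst.
  by apply: cvg_expr; rewrite ger0_norm.
apply: squeeze_cvgr; [|exact: cvg_cst|exact: cq].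
near=> n; rewrite mulr_ge0 ?exprn_ge0//= tq exprMn mulrA ler_wpM2r ?exprn_ge0//.
Unshelve. all: by end_near. Qed.

(** With K close to n / t^n, the quantity K u^n tends to 0 for u < t and to
infinity for u >= t.  So (1 - u^n)^K, a polynomial in u with values in [0, 1],
tends to the indicator function of u < t. *)
Definition Kpow t n : nat := (Num.truncn (n%:R * t ^- n)).+1.
Definition thr t n u : R := (1 - u ^+ n) ^+ Kpow t n.

Lemma thr_itv t n u : 0 <= u <= 1 -> 0 <= thr t n u <= 1.
Proof.
move=> /andP[u0 u1]; rewrite /thr.
have h : 0 <= 1 - u ^+ n <= 1.
  by rewrite subr_ge0 exprn_ile1//= lerBlDr lerDl exprn_ge0.
by move: h => /andP[h1 h2]; rewrite exprn_ge0//= exprn_ile1.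
Qed.

Lemma thr_lt t u : 0 < t -> 0 <= u < t -> t <= 1 -> thr t n u @[n --> \oo] --> (1 : R).
Proof.
move=> t0 /andP[u0 ut] t1; have ut1 : 0 <= u / t < 1.
  by rewrite divr_ge0 ?(ltW t0)//= ltr_pdivrMr// mul1r.
have u1 : u < 1 by exact: lt_le_trans ut t1.
have c1 := cvg_nexpr ut1.
have c2 : u ^+ n @[n --> \oo] --> (0 : R) by apply: cvg_expr; rewrite ger0_norm.
have c3 : 1 - (n%:R * (u / t) ^+ n + u ^+ n) @[n --> \oo] --> (1 : R).
  rewrite -[X in _ --> X](subr0 1) -[X in _ --> _ - X](addr0 0).
  by apply: cvgB; [exact: cvg_cst|exact: cvgD].
apply: squeeze_cvgr; [|exact: c3|exact: cvg_cst].
near=> n; have un0 : 0 <= u ^+ n by rewrite exprn_ge0.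
have un1 : u ^+ n <= 1 by rewrite exprn_ile1// ltW.
have u01 : 0 <= u <= 1 by rewrite u0 ltW.
have /andP[_ ->] := thr_itv t n u01; rewrite andbT.
apply: le_trans (bernoulli_sub _ _); last by rewrite un0.
rewrite lerD2l lerN2.
have N0 : 0 <= n%:R * t ^- n by rewrite mulr_ge0// invr_ge0 exprn_ge0// ltW.
have /andP[k1 _] := truncn_itv N0.
have -> : n%:R * (u / t) ^+ n + u ^+ n = (n%:R * t ^- n + 1) * u ^+ n.
  by rewrite exprMn exprVn; ring.
by rewrite ler_wpM2r// /Kpow -natr1 lerD2r.
Unshelve. all: by end_near. Qed.

Lemma thr_ge t u : 0 < t -> t <= u <= 1 -> thr t n u @[n --> \oo] --> (0 : R).
Proof.
move=> t0 /andP[tu u1].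
have u0 : 0 <= u by exact: le_trans (ltW t0) tu.
have c : (n.+1%:R^-1 : R) @[n --> \oo] --> (0 : R) by exact: cvg_harmonic.
apply: squeeze_cvgr; [|exact: cvg_cst|exact: c].
near=> n; have u01 : 0 <= u <= 1 by rewrite u0.
have /andP[-> _] := thr_itv t n u01; rewrite /=.
have un0 : 0 <= u ^+ n by rewrite exprn_ge0.
have un1 : u ^+ n <= 1 by rewrite exprn_ile1.
have N0 : 0 <= n%:R * t ^- n by rewrite mulr_ge0// invr_ge0 exprn_ge0// ltW.
have /andP[_ /ltW k2] := truncn_itv N0.
set K := Kpow t n; rewrite -/K in k2.
have tn0 : 0 < t ^+ n by rewrite exprn_gt0.
have nK : n.+1%:R <= 1 + K%:R * u ^+ n.
  rewrite -natr1 addrC lerD2l.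
  have : n%:R * t ^- n * t ^+ n <= K%:R * u ^+ n.
    by apply: ler_pM => //; [exact: ltW|rewrite lerXn2r ?nnegrE ?(ltW t0)].
  by rewrite divfK ?gt_eqF.
have b := bernoulli_add K un0.
have : thr t n u * (1 + u ^+ n) ^+ K <= 1.
  rewrite /thr -/K -exprMn exprn_ile1//.
    by rewrite mulr_ge0 ?subr_ge0// addr_ge0.
  nra.
have /andP[th0 _] := thr_itv t n u01.
move=> h; rewrite -[X in _ <= X]mul1r ler_pdivlMr//.
apply: le_trans h; rewrite ler_wpM2l//; exact: le_trans nK b.
Unshelve. all: by end_near. Qed.

End Threshold.

(** * Trigonometric polynomials and arcs *)
Section Trig.
Variable R : realType.
Local Notation C := R[i].
Implicit Types (p q : R -> C) (x eta m : R).

Lemma lincomb_sum (U : set (R -> C)) n (F : 'I_n -> R -> C) :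
  (forall i, lincomb U (F i)) -> lincomb U (fun x => \sum_(i < n) F i x).
Proof.
elim: n F => [|n IH] F UF.
  by under eq_fun do rewrite big_ord0; exact: lincomb0.
under eq_fun do rewrite big_ord_recr/=.
by apply: lincombD => //; apply: IH.
Qed.

Definition chars : set (R -> C) :=
  [set f | exists k : int, f = fun eta => expi (- (k%:~R * eta))].
Definition trigp := lincomb chars.

Lemma trigp_char (k : int) : trigp (fun eta => expi (- (k%:~R * eta))).
Proof. by apply: lincomb_in; exists k. Qed.
Lemma trigp_cst (c : C) : trigp (fun=> c).
Proof.
have := lincombZ c (trigp_char 0); congr lincomb; apply/funext => x.
by rewrite mul0r oppr0 expi0 mulr1.
Qed.
Lemma trigpM p q : trigp p -> trigp q -> trigp (p \* q).
Proof.
move=> [n [c [e [Ee ->]]]] [k [d [f [Ff ->]]]].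
rewrite (_ : _ \* _ = fun x => \sum_(i < n) \sum_(j < k) (c i * d j) * (e i x * f j x)).
  apply: (@lincomb_sum _ _ (fun i x => \sum_(j < k) (c i * d j) * (e i x * f j x))) => i.
  apply: (@lincomb_sum _ _ (fun j x => (c i * d j) * (e i x * f j x))) => j.
  apply: lincombZ; apply: lincomb_in.
  have [a ->] := Ee i; have [b ->] := Ff j; exists (a + b).
  by apply/funext => x; rewrite -expiD intrD; congr expi; ring.
apply/funext => x /=; rewrite mulr_suml; apply: eq_bigr => i _.
by rewrite mulr_sumr; apply: eq_bigr => j _; ring.
Qed.
Lemma trigpX p n : trigp p -> trigp (fun x => p x ^+ n).
Proof.
move=> tp; elim: n => [|n IH]; first exact: trigp_cst.
by under eq_fun do rewrite exprS; exact: trigpM.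
Qed.
Lemma trigp_cos m : trigp (fun eta => (cos (eta - m))%:C).
Proof.
rewrite (_ : (fun eta => _) = (fun eta => (expi m / 2) * expi (- (1%:~R * eta))) \+
   (fun eta => (expi (- m) / 2) * expi (- ((-1)%:~R * eta)))).
  by apply: lincombD; apply: lincombZ; exact: trigp_char.
apply/funext => eta /=.
have e1 : expi m / 2 * expi (- (1%:~R * eta)) = expi (- (eta - m)) / 2.
  by rewrite mulrAC -expiD; congr (expi _ / 2); ring.
have e2 : expi (- m) / 2 * expi (- ((-1)%:~R * eta)) = expi (eta - m) / 2.
  by rewrite mulrAC -expiD; congr (expi _ / 2); rewrite intrN; ring.
rewrite e1 e2 expiN -mulrDl.
rewrite (_ : conjc (expi (eta - m)) + expi (eta - m) = (cos (eta - m))%:C * 2).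
  by rewrite mulfK// pnatr_eq0.
by rewrite mulr_natr mulr2n; apply: Ceq; rewrite !ReImE/=; ring.
Qed.

(** A trigonometric polynomial with values in [0, 1] that increases with the
distance to m modulo 2 pi: its sublevel sets are arcs around m. *)
Definition uarc m eta : R := (1 - cos (eta - m)) / 2.

Lemma trigp_thr m t n : trigp (fun eta => (thr t n (uarc m eta))%:C).
Proof.
rewrite /thr /uarc; under eq_fun do rewrite rmorphXn.
apply: trigpX.
rewrite (_ : (fun x => _) = (fun=> 1) \+ (fun x => (-1) * (((1 - cos (x - m)) / 2)%:C) ^+ n)); last first.
  by apply/funext => x /=; rewrite rmorphB rmorph1 rmorphXn mulN1r.
apply: lincombD; first exact: trigp_cst.
apply: lincombZ; apply: trigpX.
rewrite (_ : (fun x => _) = (fun=> 2^-1%:C) \+ (fun x => (- 2^-1)%:C * (cos (x - m))%:C)); last first.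
  by apply/funext => x /=; rewrite -rmorphM -rmorphD; congr (_%:C); field.
apply: lincombD; first exact: trigp_cst.
by apply: lincombZ; exact: trigp_cos.
Qed.

Lemma uarc_itv m eta : 0 <= uarc m eta <= 1.
Proof.
rewrite /uarc divr_ge0 ?subr_ge0 ?cos_le1//=.
by rewrite ler_pdivrMr// mul1r; have := cos_geN1 (eta - m); lra.
Qed.

Lemma expi2pi : expi (2 * pi) = 1 :> C.
Proof. by rewrite /expi mulr_natl cos2pi sin2pi. Qed.

Lemma expi2piz (q : int) : expi (q%:~R * (2 * pi)) = 1 :> C.
Proof.
have e n : expi (n%:R * (2 * pi)) = 1 :> C.
  elim: n => [|n IH]; first by rewrite mul0r expi0.
  by rewrite -natr1 mulrDl mul1r expiD IH expi2pi mulr1.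
case: q => n; first exact: e.
by rewrite NegzE intrN mulNr expiN e conjc1.
Qed.

Lemma cosD2piz (x : R) (q : int) : cos (x + q%:~R * (2 * pi)) = cos x.
Proof.
have := congr1 (@complex.Re R) (expiD x (q%:~R * (2 * pi))).
by rewrite expi2piz mulr1.
Qed.

Lemma cos_lt_arc (h y : R) : 0 < h < pi -> `|y| <= pi -> (cos h < cos y) = (`|y| < h).
Proof.
move=> /andP[h0 hpi] ypi; rewrite -(cos_norm y) ltr_cos// in_itv/= ?(ltW h0) ?(ltW hpi)//.
by rewrite normr_ge0.
Qed.

(** Within one period ]w, w + 2 pi], the arc centred at (a + b) / 2 with
half-length (b - a) / 2 is the interval ]a, b[. *)
Lemma arc_window (w a b eta : R) (q : int) : a < b -> w <= a -> b <= w + 2 * pi ->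
  b - a < 2 * pi -> w < eta <= w + 2 * pi ->
  (cos ((b - a) / 2) < cos (eta + q%:~R * (2 * pi) - (a + b) / 2)) = (a < eta < b).
Proof.
move=> ab wa bw bapi /andP[we ew].
rewrite addrAC cosD2piz; set y := eta - _.
have hpi : 0 < (b - a) / 2 < pi by apply/andP; split; lra.
have bound (z : R) : (`|z| < (b - a) / 2) = (- ((b - a) / 2) < z) && (z < (b - a) / 2).
  by rewrite ltr_norml.
case: (lerP `|y| pi) => yp.
  rewrite cos_lt_arc// bound /y; congr (_ && _); apply/idP/idP; lra.
have ba : (a < eta < b) = false.
  apply/negbTE/negP => /andP[h1 h2]; move: yp; rewrite ltNge => /negP; apply.
  by rewrite ler_norml /y; apply/andP; split; lra.
rewrite ba; move: yp; rewrite ltr_normr => /orP[yp|yp].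
  have -> : cos y = cos (y - 2 * pi).
    by have := cosD2piz y (-1); rewrite intrN mulNr mul1r.
  rewrite cos_lt_arc//; last by rewrite ler_norml /y; apply/andP; split; move: yp; rewrite /y; lra.
  by rewrite bound; apply/negbTE/negP => /andP[h1 h2]; move: h1 h2; rewrite /y; lra.
have -> : cos y = cos (y + 2 * pi).
  by have := cosD2piz y 1; rewrite mul1r.
rewrite cos_lt_arc//; last by rewrite ler_norml /y; apply/andP; split; move: yp; rewrite /y; lra.
by rewrite bound; apply/negbTE/negP => /andP[h1 h2]; move: h1 h2; rewrite /y; lra.
Qed.

End Trig.

(** * Spanning by restrictions to arcs *)
Section Completeness.
Variable R : realType.
Local Notation C := R[i].
Local Notation mu := (@lebesgue_measure R).
Implicit Types (f g h : R -> C) (a b x eta u v w : R).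
Variable G : R -> C.
Hypothesis L2G : CL 2 G.

Let D : set (R -> C) := clspan (range (Gd G)).
Let subG : range (Gd G) `<=` CL 2. Proof. by move=> _ [p _ <-]; exact: L2_Gd. Qed.

(** Multiplying G by a character is passing from k = 0 to another k. *)
Lemma trigp_span p j : trigp p ->
  lincomb (range (Gd G)) (fun xi => p ((pw R j)^-1 * xi) * G ((pw R j)^-1 * xi)).
Proof.
move=> [n [c [e [Ee ->]]]].
rewrite (_ : (fun xi => _) = fun xi => \sum_(i < n) c i * (e i ((pw R j)^-1 * xi) * G ((pw R j)^-1 * xi))).
  apply: (@lincomb_sum _ _ _ (fun i xi => c i * (e i ((pw R j)^-1 * xi) * G ((pw R j)^-1 * xi)))) => i.
  apply: lincombZ; have [k ->] := Ee i.
  rewrite (_ : (fun xi => _) = fun xi => (hpw R j)%:C * Gd G (j, k) xi).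
    by apply: lincombZ; apply: lincomb_in; exists (j, k).
  apply/funext => xi; rewrite /Gd /= mulrA -rmorphM mulfV ?rmorph1 ?mul1r 1?mulrC//.
  by rewrite lt0r_neq0// hpw_gt0.
by apply/funext => xi; rewrite mulr_suml; apply: eq_bigr => i _; rewrite mulrA.
Qed.

Definition arcG m t eta : C := if cos t < cos (eta - m) then G eta else 0.

Lemma meas_arcG m t : Cmeasurable (arcG m t).
Proof.
have mc : measurable_fun setT (fun eta : R => cos (eta - m)).
  apply: measurableT_comp; first by apply: continuous_measurable_fun; exact: continuous_cos.
  exact: measurable_funB.
have mb : measurable_fun setT (fun eta : R => cos t < cos (eta - m)).
  by apply: measurable_fun_ltr.
have [g1 g2] := L2_meas L2G.
split.
  rewrite (_ : (fun x => _) = fun x => if cos t < cos (x - m) then Re (G x) else 0).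
    exact: measurable_fun_ifT.
  by apply/funext => x; rewrite /arcG; case: ifP.
rewrite (_ : (fun x => _) = fun x => if cos t < cos (x - m) then Im (G x) else 0).
  exact: measurable_fun_ifT.
by apply/funext => x; rewrite /arcG; case: ifP.
Qed.

Lemma cvg_sqM0 (v : nat -> R) (c : R) : v n @[n --> \oo] --> (0 : R) ->
  v n * v n * c @[n --> \oo] --> (0 : R).
Proof.
move=> v0; have -> : (0 : R) = 0 * 0 * c by rewrite !mul0r.
by apply: cvgM; [exact: cvgM|exact: cvg_cst].
Qed.

(** The trigonometric polynomials [thr] of [uarc] converge boundedly to the
indicator function of the arc. *)
Lemma arc_span m t j : 0 < t < pi -> D (fun xi => arcG m t ((pw R j)^-1 * xi)).
Proof.
move=> /andP[t0 tpi].
have ct1 : cos t < 1.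
  by rewrite -(@cos0 R) ltr_cos ?in_itv/= ?lexx ?pi_ge0 ?(ltW t0) ?(ltW tpi).
pose th := (1 - cos t) / 2.
have th0 : 0 < th by rewrite divr_gt0// subr_gt0.
have th1 : th <= 1 by rewrite ler_pdivrMr// mul1r; have := cos_geN1 t; lra.
have uE eta : (uarc m eta < th) = (cos t < cos (eta - m)).
  by rewrite /uarc /th ltr_pM2r ?invr_gt0// ltrD2l ltrN2.
have ai : 0 < (pw R j)^-1 by rewrite invr_gt0 pw_gt0.
have L2s (g : R -> C) : CL 2 g -> CL 2 (fun xi => g ((pw R j)^-1 * xi)).
  by move=> Lg; have := L2_affine 0 ai Lg; under eq_fun do rewrite addr0.
have LA : CL 2 (arcG m t).
  apply: (L2_le (meas_arcG m t) L2G) => x; rewrite /arcG; case: ifP => // _.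
  by rewrite nsq0 nsq_ge0.
pose f_ n xi : C := (thr th n (uarc m ((pw R j)^-1 * xi)))%:C * G ((pw R j)^-1 * xi).
have Sf n : lincomb (range (Gd G)) (f_ n).
  exact: (trigp_span j (trigp_thr m th n)).
have Df n : D (f_ n) by apply: clspan_lincomb => //; exact: subG.
apply: (clspan_cvg subG _ Df); first exact: L2s.
apply: (@sqn_cvg0 _ _ (fun xi => nsq (G ((pw R j)^-1 * xi)))).
- move=> n; apply: cmeas_sub; apply: L2_meas; first exact: L2s.
  exact: clspan_L2 (Df n).
- move=> n xi; rewrite /f_ /arcG /=; set eta := _ * xi; set z := thr _ _ _.
  have /andP[z0 z1] : 0 <= z <= 1 by apply: thr_itv; exact: uarc_itv.
  case: ifP => _.
    rewrite -[X in X - _]mul1r -(rmorph1 (@real_complex R)) -mulrBl -rmorphB nsqM nsq_real.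
    by rewrite ler_piMl ?nsq_ge0// expr_le1// ?subr_ge0// lerBlDr lerDl.
  by rewrite sub0r nsqN nsqM nsq_real ler_piMl ?nsq_ge0// expr_le1.
- exact: L2_nsq_integrable (L2s _ L2G).
- move=> xi; pose eta := (pw R j)^-1 * xi.
  have /andP[u0 u1] := uarc_itv m eta; set v := fun n => thr th n (uarc m eta).
  rewrite (_ : (fun n => nsq _) = fun n => nsq (arcG m t eta - (v n)%:C * G eta)) // /arcG.
  case: ifPn => ca.
    have c1 : v n @[n --> \oo] --> (1 : R) by apply: thr_lt => //; rewrite u0 uE.
    rewrite (_ : (fun n => _) = fun n => (1 - v n) * (1 - v n) * nsq (G eta)); last first.
      apply/funext => n; rewrite -[X in X - _]mul1r -(rmorph1 (@real_complex R)).
      by rewrite -mulrBl -rmorphB nsqM nsq_real expr2.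
    have c2 : 1 - v n @[n --> \oo] --> (0 : R).
      by rewrite -(subrr 1); apply: cvgB => //; exact: cvg_cst.
    exact: cvg_sqM0.
  have c1 : v n @[n --> \oo] --> (0 : R) by apply: thr_ge => //; rewrite u1 andbT leNgt uE.
  rewrite (_ : (fun n => _) = fun n => v n * v n * nsq (G eta)); last first.
    by apply/funext => n; rewrite sub0r nsqN nsqM nsq_real expr2.
  exact: cvg_sqM0.
Qed.

(** The indicator functions of all subintervals of ]u, v] are in the closed
span; a and b are arbitrary, so that adjacent intervals glue without case
distinctions ([good_trans]). *)
Definition good u v := forall a b, D (cind (`]a, b] `&` `]u, v])).

Lemma clspan_ae f g : CL 2 f -> D g -> sqn (f \- g) = 0%E -> D f.
Proof.
move=> Lf Dg e; apply: (clspan_approx subG) => // e' e0.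
by exists g => //; rewrite e lte_fin.
Qed.

Lemma good_piece u v j :
  (forall a b, u <= a -> a < b -> b <= v -> D (fun xi => cind `]a, b[ ((pw R j)^-1 * xi))) ->
  good (pw R j * u) (pw R j * v).
Proof.
move=> h a b; rewrite ocI; set c := Num.max _ _; set d := Num.min _ _.
have p0 := pw_gt0 R j.
case: (ltP c d) => cd; last first.
  rewrite (_ : cind _ = fun=> 0); first exact: clspan0.
  by apply/funext => x; rewrite cindE_itv; case: ifP => // /andP[/lt_le_trans k /k]; rewrite ltNge cd.
have uc : u <= (pw R j)^-1 * c by rewrite ler_pdivlMl// /c le_max lexx orbT.
have dv : (pw R j)^-1 * d <= v by rewrite ler_pdivrMl// /d ge_min lexx orbT.
have cd' : (pw R j)^-1 * c < (pw R j)^-1 * d by rewrite ltr_pM2l// invr_gt0.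
have Dh := h _ _ uc cd' dv.
apply: (clspan_ae _ Dh); first exact: L2_itv.
rewrite (@eq_sqn _ _ (cind [set d])).
  by rewrite sqn_cind; [exact: lebesgue_measure_set1|exact: measurable_set1].
move=> x; rewrite /= cindE_itv.
have [->|xd] := eqVneq x d.
  by rewrite cd lexx/= cindF ?subr0 ?cindT//= in_itv/= ltxx andbF.
rewrite [X in _ = nsq X]cindF; last by move=> /= /eqP; rewrite (negbTE xd).
case: ifPn => cxd.
  rewrite cindT ?subrr//= in_itv/= !ltr_pM2l ?invr_gt0//.
  by move: cxd => /andP[-> xd']; rewrite lt_neqAle xd.
rewrite cindF ?subrr//= in_itv/= !ltr_pM2l ?invr_gt0// => /andP[k1 k2].
by move: cxd; rewrite k1 (ltW k2).
Qed.

Lemma good_trans u v w : u <= v -> v <= w -> good u v -> good v w -> good u w.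
Proof.
move=> uv vw g1 g2 a b.
rewrite (_ : cind _ = cind (`]a, b] `&` `]u, v]) \+ cind (`]a, b] `&` `]v, w])).
  exact: (clspanD subG (g1 a b) (g2 a b)).
apply/funext => x /=; rewrite !cindI -mulrDr; congr (_ * _); rewrite !cindE_itv.
case: (ltP v x) => vx; rewrite ?andbF ?andbT/=.
  by rewrite (le_lt_trans uv vx)/= add0r.
by rewrite addr0 (le_trans vx vw) andbT.
Qed.

Lemma good_chain (u0 : R) : 0 < u0 ->
  (forall j, good (pw R j * u0) (pw R (j + 1) * u0)) ->
  forall n : nat, good (pw R (- n%:Z) * u0) (pw R n%:Z * u0).
Proof.
move=> u00 gj; have mono j : pw R j * u0 <= pw R (j + 1) * u0.
  rewrite ler_pM2r// pwD -[X in X <= _]mulr1 ler_pM2l ?pw_gt0//.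
  by rewrite /pw expr1z ler1n.
have e n : - n.+1%:Z + 1 = - n%:Z by rewrite -addn1 PoszD opprD addrNK.
elim=> [|n IH].
  move=> a b; rewrite oppr0 (_ : cind _ = fun=> 0); first exact: clspan0.
  by apply/funext => x; rewrite cindI [X in _ * X]cindE_itv ltNge; case: (x <= _); rewrite ?andbF mulr0.
have IHm : pw R (- n%:Z) * u0 <= pw R n%:Z * u0.
  elim: n {IH} => [|n IH]; first by rewrite oppr0.
  apply: (@le_trans _ _ (pw R (- n%:Z) * u0)); first by rewrite -(e n); exact: mono.
  by apply: (le_trans IH); rewrite -addn1 PoszD; exact: mono.
apply: (@good_trans _ (pw R (- n%:Z) * u0)).
- by rewrite -(e n); exact: mono.
- by apply: (le_trans IHm); rewrite -addn1 PoszD; exact: mono.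
- by have := gj (- n.+1%:Z); rewrite e.
apply: (good_trans IHm _ IH); rewrite -addn1 PoszD; [exact: mono|exact: gj].
Qed.

Lemma pw_cofinal (x u0 : R) : 0 < u0 -> \forall n \near \oo, x < pw R n%:Z * u0.
Proof.
move=> u00; near=> n; rewrite -ltr_pdivrMr//.
apply: (@lt_le_trans _ _ n%:R); first by near: n; exact: nbhs_infty_gtr.
rewrite /pw -exprnP; have := bernoulli_add n (@ler01 R); rewrite mulr1; apply: le_trans.
by rewrite lerDr.
Unshelve. all: by end_near. Qed.

(** The octaves exhaust the positive half-line. *)
Lemma good_pos (u0 : R) : 0 < u0 ->
  (forall j, good (pw R j * u0) (pw R (j + 1) * u0)) ->
  forall a b, 0 <= a -> D (cind `]a, b]).
Proof.
move=> u00 gj a b a0; have gn := good_chain u00 gj.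
pose I_ (n : nat) := (`]a, b] `&` `]pw R (- n%:Z) * u0, pw R n%:Z * u0])%classic.
apply: (clspan_cvg subG (L2_itv a b) (fun n => gn n a b)).
have mI n : Cmeasurable (cind (I_ n)).
  by apply: meas_cind; apply: measurableI; exact: measurable_itv.
apply: (@sqn_cvg0 _ _ (fun x => nsq (cind `]a, b] x))).
- by move=> n; apply: cmeas_sub; [exact: L2_meas (L2_itv a b)|exact: mI].
- move=> n x; rewrite /= cindI -[X in X - _]mulr1 -mulrBr nsqM.
  rewrite ler_piMr ?nsq_ge0// cindE_itv; case: ifP => _.
    by rewrite subrr nsq0.
  by rewrite subr0 -(rmorph1 (@real_complex R)) nsq_real expr1n.
- exact: L2_nsq_integrable (L2_itv a b).
- move=> x; apply: cvg_near_cst; have [x0|x0] := ltP 0 x; last first.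
    near=> n; rewrite /= cindI cindE_itv ifF ?mul0r ?subrr ?nsq0//.
    by apply/negbTE; rewrite negb_and -leNgt (le_trans x0 a0).
  near=> n; rewrite /= cindI [cind `]a, b] x]cindE_itv; case: ifPn => [/andP[ax xb]|_]; last first.
    by rewrite mul0r subrr nsq0.
  rewrite mul1r cindE_itv ifT ?subrr ?nsq0//; apply/andP; split.
    rewrite pwN ltr_pdivrMl ?pw_gt0//.
    by near: n; exact: (pw_cofinal u0 x0).
  by apply: ltW; near: n; exact: pw_cofinal.
Unshelve. all: by end_near. Qed.

(** Step functions are dense, and restricting a step function to the positive
half-line does not increase its distance to h. *)
Lemma complete_of_good (u0 : R) : 0 < u0 ->
  (forall j, good (pw R j * u0) (pw R (j + 1) * u0)) ->
  forall h, CL 2 h -> (forall xi, xi <= 0 -> h xi = 0) -> D h.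
Proof.
move=> u00 gj h Lh h0; apply: (clspan_approx subG Lh) => e e0.
have [_ /(_ e e0)[s Ss hs]] := density Lh.
have Ls : CL 2 s by exact: (lincomb_L2 (@steps_L2 R) Ss).
move: Ss Ls hs => [n [c [u [Uu ->]]]] Ls hs.
have Ua i : {v | D v & forall x, v x = if 0 < x then u i x else 0}.
  apply: cid2; have [a [b ->]] := Uu i.
  exists (cind `]Num.max a 0, b]).
    by apply: good_pos gj _ _ _ => //; rewrite le_max lexx orbT.
  move=> x; rewrite !cindE_itv gt_max; case: (0 < x); rewrite ?andbT ?andbF//.
pose v i := s2val (Ua i).
have vE i x : v i x = if 0 < x then u i x else 0 by exact: (s2valP' (Ua i)).
have Dv : D (fun x => \sum_(i < n) c i * v i x).
  apply: clspan_sum => // i; apply: clspanZ => //; exact: (s2valP (Ua i)).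
exists (fun x => \sum_(i < n) c i * v i x) => //.
apply: le_lt_trans hs; apply: le_sqn.
- by apply: cmeas_sub; apply: L2_meas => //; exact: clspan_L2 Dv.
- by apply: cmeas_sub; apply: L2_meas.
move=> x /=; case: (ltP 0 x) => x0.
  rewrite (eq_bigr (fun i => c i * u i x))// => i _; by rewrite vE x0.
rewrite big1; first by rewrite h0// subrr nsq0 nsq_ge0.
by move=> i _; rewrite vE ltNge x0/= mulr0.
Qed.

End Completeness.

(** * Exponential integrals over intervals *)
Section IntervalIntegral.
Variable R : realType.
Local Notation C := R[i].
Implicit Types (a b c t th w x y : R).

Definition itv_int a b th : C := Cintegral (fun eta => cind `]a, b] eta * expi (th * eta)).

Lemma itv_int_integrable a b th : Cintegrable (fun eta : R => cind `]a, b] eta * expi (th * eta)).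
Proof.
apply: L1_Cintegrable; apply: (@L1_mul_bounded _ (cind `]a, b])).
- exact: L1_itv.
- exact: meas_expiM.
- by move=> x; rewrite normc_expi.
Qed.

Lemma itv_int_cat a b c th : a <= b -> b <= c ->
  itv_int a c th = itv_int a b th + itv_int b c th.
Proof.
move=> ab bc; rewrite -(CintegralD (itv_int_integrable _ _ _) (itv_int_integrable _ _ _)).
apply: eq_Cintegral => x /=; rewrite -mulrDl; congr (_ * _); rewrite !cindE_itv.
case: (ltP b x) => bx; rewrite ?andbF ?andbT/=; first by rewrite (le_lt_trans ab bx) add0r.
by rewrite addr0 (le_trans bx bc) andbT.
Qed.

Lemma itv_int_shift t a b th : itv_int (a + t) (b + t) th = expi (th * t) * itv_int a b th.
Proof.
rewrite -(CintegralZ _ (itv_int_integrable a b th)).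
have := Cintegral_affine t ltr01 (itv_int_integrable (a + t) (b + t) th).
rewrite invr1 rmorph1 mul1r => e; rewrite /itv_int -e; apply: eq_Cintegral => x; rewrite mul1r mulrCA.
rewrite !cindE_itv ltrD2r lerD2r -expiD; congr (_ * expi _); ring.
Qed.

Lemma itv_intE a b th : a <= b -> th != 0 ->
  itv_int a b th = ((sin (th * b) - sin (th * a)) / th) +i* ((cos (th * a) - cos (th * b)) / th).
Proof. by move=> ab th0; rewrite /itv_int Cint_cind_expi// int_cosl// int_sinl. Qed.

Lemma itv_int0 a b : a <= b -> itv_int a b 0 = (b - a)%:C.
Proof.
move=> ab; rewrite /itv_int Cint_cind_expi//.
under eq_Rintegral do rewrite mul0r cos0.
under [X in _ +i* X]eq_Rintegral do rewrite mul0r sin0.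
rewrite !Rintegral_cst//; try exact: measurable_itv.
rewrite mul0r mul1r; congr (_ +i* _).
by apply: (etrans (congr1 fine (mu_oc _ _))); rewrite /= max_l// subr_ge0.
Qed.

Lemma sinD2piz (x : R) (q : int) : sin (x + q%:~R * (2 * pi)) = sin x.
Proof.
have := congr1 (@complex.Im R) (expiD x (q%:~R * (2 * pi))).
by rewrite expi2piz mulr1.
Qed.

Lemma itv_int_period w (q : int) :
  itv_int w (w + 2 * pi) q%:~R = (2 * pi)%:C * (q == 0)%:R.
Proof.
have ww : w <= w + 2 * pi by rewrite lerDl mulr_ge0// pi_ge0.
have [->|q0] := eqVneq q 0; first by rewrite itv_int0// addrC addKr mulr1.
rewrite mulr0 itv_intE ?intr_eq0// mulrDr cosD2piz sinD2piz !subrr !mul0r.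
by [].
Qed.

(** If the integral vanished, sin and cos would agree at th a and th b, and then
cos (th (b - a)) would be 1. *)
Lemma itv_int_neq0 a b th : a < b -> 0 < `|th| * (b - a) < pi -> itv_int a b th != 0.
Proof.
move=> ab /andP[k0 kpi]; have th0 : th != 0.
  by apply: contraTneq k0 => ->; rewrite normr0 mul0r ltxx.
rewrite itv_intE// ?(ltW ab)//; apply/eqP => -[/eqP + /eqP].
rewrite !mulf_eq0 !invr_eq0 (negbTE th0) !orbF !subr_eq0 => /eqP es /eqP ec.
have c1 : cos (th * b - th * a) = 1.
  by rewrite cosB -ec es -!expr2 cos2Dsin2.
have : cos (`|th| * (b - a)) < 1.
  by rewrite -(@cos0 R) ltr_cos ?in_itv/= ?lexx ?pi_ge0 ?(ltW k0) ?(ltW kpi).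
rewrite -{1}(gtr0_norm (_ : 0 < b - a)) ?subr_gt0// -normrM cos_norm.
by rewrite mulrBr c1 ltxx.
Qed.

End IntervalIntegral.

(** * A wavelet invariant exactly down to translations by 1 / n *)
Section Finite.
Variable R : realType.
Local Notation C := R[i].
Variables (n : nat) (s : int) (a0 a1 T : R).
Hypothesis TE : T = n%:R * (2 * pi).
Hypothesis n0 : (0 < n)%N.
Hypothesis s2 : 2 <= s.
Hypothesis a0_gt0 : 0 < a0.
Hypothesis a01 : a0 < a1.
Hypothesis a1_lt : a1 < 2 * a0.
Hypothesis a1_tau : 2 * a1 < a0 + 2 * pi.
Hypothesis pw_a1 : pw R s * a1 = a1 + 2 * T.
Hypothesis pw_a0 : pw R s * (2 * a0) = a0 + 2 * pi + 2 * T.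

Let T_ge : 2 * pi <= T.
Proof. by rewrite TE ler_peMl ?mulr_ge0 ?pi_ge0// ler1n. Qed.

Let ordering : [/\ 0 < a0, a0 < a1, a1 < 2 * a0, 2 * a1 < a0 + 2 * pi & 2 * pi <= T].
Proof. by []. Qed.

(** The intervals of constancy of G: A, B = A + T, 2A, 2B, and the intervals F1 and
F2 that surround 2B. *)
Variant piece := PA | PB | P2A | P2B | PF1 | PF2.

Definition lo p : R := match p with
  | PA => a0 | PB => a0 + T | P2A => 2 * a0 | P2B => 2 * a0 + 2 * T
  | PF1 => a1 + 2 * T | PF2 => 2 * a1 + 2 * T end.
Definition hi p : R := match p with
  | PA => a1 | PB => a1 + T | P2A => 2 * a1 | P2B => 2 * a1 + 2 * T
  | PF1 => 2 * a0 + 2 * T | PF2 => a0 + 2 * pi + 2 * T end.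

(** Besides G itself, the functions |G|^2 and G (2 eta) conj (G eta) are of this
form. *)
Definition combo (c : piece -> C) (eta : R) : C :=
  c PA * cind `]lo PA, hi PA] eta + c PB * cind `]lo PB, hi PB] eta +
  c P2A * cind `]lo P2A, hi P2A] eta + c P2B * cind `]lo P2B, hi P2B] eta +
  c PF1 * cind `]lo PF1, hi PF1] eta + c PF2 * cind `]lo PF2, hi PF2] eta.

Lemma piece_inj p q eta : lo p < eta <= hi p -> lo q < eta <= hi q -> p = q.
Proof.
move: (ordering) => [? ? ? ? ?].
by case: p; case: q => //= /andP[h1 h2] /andP[h3 h4]; exfalso; lra.
Qed.

Lemma combo_in p c eta : lo p < eta <= hi p -> combo c eta = c p.
Proof.
move=> hp; have off q : q <> p -> cind `]lo q, hi q] eta = 0.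
  by move=> qp; rewrite cindE_itv; case: ifP => // hq; case: qp; exact: piece_inj hq hp.
have on : cind `]lo p, hi p] eta = 1 by rewrite cindE_itv hp.
by rewrite /combo; case: p hp off on => hp off ->; rewrite !off// !mulr0 ?addr0 ?add0r mulr1.
Qed.

Lemma combo_out c eta : (forall p, ~~ (lo p < eta <= hi p)) -> combo c eta = 0.
Proof.
move=> h; have off q : cind `]lo q, hi q] eta = 0.
  by rewrite cindE_itv (negbTE (h q)).
by rewrite /combo !off !mulr0 !addr0.
Qed.

Lemma combo_case eta :
  (exists2 p, lo p < eta <= hi p & forall c, combo c eta = c p) \/
  (forall p, ~~ (lo p < eta <= hi p)).
Proof.
have [[p hp]|h] := pselect (exists p, lo p < eta <= hi p).
  by left; exists p => // c; exact: combo_in.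
by right => p; apply/negP => hp; apply: h; exists p.
Qed.

Lemma combo_L2 c : CL 2 (combo c).
Proof. by rewrite /combo; do 5?[apply: L2D]; apply: L2Z; exact: L2_itv. Qed.
Lemma combo_L1 c : CL 1 (combo c).
Proof. by rewrite /combo; do 5?[apply: L1D]; apply: L1Z; exact: L1_itv. Qed.

Lemma combo_int c th : Cintegral (fun eta => combo c eta * expi (th * eta)) =
  c PA * itv_int (lo PA) (hi PA) th + c PB * itv_int (lo PB) (hi PB) th +
  c P2A * itv_int (lo P2A) (hi P2A) th + c P2B * itv_int (lo P2B) (hi P2B) th +
  c PF1 * itv_int (lo PF1) (hi PF1) th + c PF2 * itv_int (lo PF2) (hi PF2) th.
Proof.
pose f p eta := c p * (cind `]lo p, hi p] eta * expi (th * eta)).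
have If p : Cintegrable (f p) by apply: CintegrableZ; exact: itv_int_integrable.
have fE p : c p * itv_int (lo p) (hi p) th = Cintegral (f p).
  by rewrite CintegralZ//; exact: itv_int_integrable.
rewrite !fE -!CintegralD//; do 5?[apply: CintegrableD => //].
by apply: eq_Cintegral => eta /=; rewrite /combo /f !mulrDl !mulrA.
Qed.

(** Divided by 2^(lev p), the piece p lies in the octave ]a0, 2 a0], in ]a0, a1] or
in ]a1, 2 a0] according to [low p]. *)
Definition lev p : int := match p with
  | PA => 0 | P2A => 1 | PB => s - 1 | _ => s end.
Definition low p : bool := match p with PA | P2A => true | _ => false end.

Lemma pw1 : pw R 1 = 2. Proof. by rewrite /pw expr1z. Qed.
Lemma pw_pred j : pw R j = 2 * pw R (j - 1). Proof. by rewrite -pw1 -pwD addrC subrK. Qed.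

Lemma piece_dyadic p : if low p
  then lo p = pw R (lev p) * a0 /\ hi p = pw R (lev p) * a1
  else pw R (lev p) * a1 <= lo p /\ hi p <= pw R (lev p) * (2 * a0).
Proof.
move: (ordering) => [? ? ? ? ?]; have es := pw_pred s; move: pw_a1 pw_a0.
case: p => /=; rewrite ?pw1 ?[pw R 0]expr0z ?es => t2 t3; split; lra.
Qed.

Lemma piece_pos p eta : lo p < eta <= hi p ->
  exists z, [/\ eta = pw R (lev p) * z, a0 < z <= 2 * a0 & (z <= a1) = low p].
Proof.
move=> /andP[h1 h2]; exists ((pw R (lev p))^-1 * eta).
have p0 := pw_gt0 R (lev p).
rewrite mulVKf ?pw_neq0// ltr_pdivlMl// !ler_pdivrMl//.
have q0 : pw R (lev p) * a1 < pw R (lev p) * (2 * a0) by rewrite ltr_pM2l.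
have q1 : pw R (lev p) * a0 < pw R (lev p) * a1 by rewrite ltr_pM2l.
have := piece_dyadic p; case: (low p) => -[e1 e2]; split => //.
- by apply/andP; split; lra.
- by apply/idP; lra.
- by apply/andP; split; lra.
- by apply/negbTE; rewrite -ltNge; lra.
Qed.

Lemma dyadic_uniq (c : R) (i j : int) z z' : 0 < c -> c < z <= 2 * c -> c < z' <= 2 * c ->
  pw R i * z = pw R j * z' -> i = j /\ z = z'.
Proof.
move=> c0; wlog ij : i j z z' / i <= j.
  move=> W hz hz' e; case: (leP i j) => ij; first exact: W.
  by have [-> ->] := W j i z' z (ltW ij) hz' hz (esym e).
move=> /andP[z1 z2] /andP[z3 z4]; rewrite -[j](subrK i) addrC pwD -mulrA.
move=> /(mulfI (pw_neq0 R i)); case E : (j - i) => [[|k]|k].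
- rewrite [pw R 0]expr0z mul1r => ->; split => //.
  by rewrite addr0.
- have k2 : 2 <= pw R k.+1.
    by rewrite /pw -exprnP exprS ler_peMr// exprn_ege1// ler1n.
  move=> e; have : 2 * z' <= pw R k.+1 * z' by rewrite ler_wpM2r// ltW// (lt_trans c0).
  by rewrite -e; move: z1 z2 z3; lra.
- by move: ij; rewrite -subr_ge0 E.
Qed.

(** Positions in the octave are unique ([dyadic_uniq]), so dilation by 2^d raises
the level by d and preserves [low].  The levels are 0 and 1 for low pieces, s - 1
and s for the others, which leaves d = 1; and 2B is the only piece that meets
the dilate of B. *)
Lemma dilated_pieces p q (d : int) eta : 0 < d ->
  lo p < eta <= hi p -> lo q < pw R d * eta <= hi q ->
  d = 1 /\ ((p = PA /\ q = P2A) \/ (p = PB /\ q = P2B)).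
Proof.
move=> d0 hp hq.
have [z [e1 z1 z2]] := piece_pos hp; have [z' [e2 z1' z2']] := piece_pos hq.
have [e3 zz] : d + lev p = lev q /\ z = z'.
  by apply: (dyadic_uniq a0_gt0 z1 z1'); rewrite pwD -mulrA -e1.
have lpq : low p = low q by rewrite -z2 -z2' zz.
move: (ordering) s2 => [? ? ? ? ?] s2'.
case: p hp {e1 z1 z2} e3 lpq => hp; case: q hq {e2 z1' z2' zz} => hq //= e3 _;
  try by exfalso; clear -d0 s2' e3; lia.
- by split; [lia|left].
- have d1 : d = 1 by lia.
  by split=> //; right.
- have d1 : d = 1 by lia.
  move: hp hq; rewrite d1 pw1 /= => /andP[h1 h2] /andP[h3 h4]; exfalso.
  clear e3 d1 s2' d0; lra.
- have d1 : d = 1 by lia.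
  move: hp hq; rewrite d1 pw1 /= => /andP[h1 h2] /andP[h3 h4]; exfalso.
  clear e3 d1 s2' d0; lra.
Qed.

Definition rt : C := (Num.sqrt 2)^-1%:C.
Definition cG p : C := match p with PA | PB | P2A => rt | P2B => - rt | _ => 1 end.
Definition c1 p : C := match p with PA => 2^-1%:C | PB => - 2^-1%:C | _ => 0 end.
Definition stepG := combo cG.

Lemma rt_sq : rt * rt = 2^-1%:C.
Proof. by rewrite -rmorphM -invfM -expr2 sqr_sqrtr. Qed.
Lemma conj_rt : conjc rt = rt. Proof. exact: conjc_real. Qed.

Lemma stepG_dilate (d : int) eta : 0 < d ->
  stepG (pw R d * eta) * conjc (stepG eta) = if d == 1 then combo c1 eta else 0.
Proof.
move=> d0; rewrite /stepG; have [[p hp e1]|o1] := combo_case eta; last first.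
  by rewrite !(combo_out _ o1) conjc0 mulr0 if_same.
have [[q hq e2]|o2] := combo_case (pw R d * eta).
  have [d1 pq] := dilated_pieces d0 hp hq; rewrite e2 !e1 d1 eqxx.
  by case: pq => -[-> ->]; rewrite /cG /c1 conj_rt ?mulNr rt_sq.
rewrite (combo_out _ o2) mul0r e1; case: eqP => // d1; move: o2; rewrite d1 pw1 => o2.
move: (ordering) => [? ? ? ? ?].
move: hp; case: p e1 => //= _ /andP[h1 h2].
  by case/negP: (o2 P2A); apply/andP; split => /=; lra.
by case/negP: (o2 P2B); apply/andP; split => /=; lra.
Qed.

Lemma cG_sq p : cG p * conjc (cG p) = match p with PF1 | PF2 => 1 | _ => 2^-1%:C end.
Proof.
have -> : conjc (cG p) = cG p by case: p; apply: Ceq; rewrite /= ?oppr0.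
by case: p; rewrite /cG ?mulrNN ?rt_sq ?mulr1.
Qed.

Lemma expi_T (q : int) : expi (q%:~R * T) = 1 :> C.
Proof. have -> : q%:~R * T = (q * n%:Z)%:~R * (2 * pi) by rewrite TE intrM -mulrA.
exact: expi2piz. Qed.

(** Integer frequencies are blind to translations by multiples of 2 pi; after such
translations A, F1, 2A and F2 tile a period, and the weights 1/2 of A and B, and
of 2A and 2B, add up to 1. *)
Lemma corr0G (q : int) : corr stepG 0 q%:~R = (2 * pi)%:C * (q == 0)%:R.
Proof.
rewrite /corr (@eq_Cintegral _ _ (fun eta => combo (fun p => cG p * conjc (cG p)) eta * expi (q%:~R * eta))).
  rewrite combo_int !cG_sq /lo /hi !mul1r.
  have sh k a b : itv_int (a + k%:R * T) (b + k%:R * T) q%:~R = itv_int a b q%:~R.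
    have e : q%:~R * (k%:R * T) = (q * k%:Z)%:~R * T by rewrite intrM -mulrA.
    by rewrite itv_int_shift e expi_T mul1r.
  have := sh 1%N; rewrite mul1r => sh1; rewrite !sh1 !sh -!mulrDr.
  rewrite -(itv_int_period a0 q); move: (ordering) => [? ? ? ? ?].
  rewrite (@itv_int_cat _ a0 a1 (a0 + 2 * pi)); [|lra|lra].
  rewrite (@itv_int_cat _ a1 (2 * a0) (a0 + 2 * pi)); [|lra|lra].
  rewrite (@itv_int_cat _ (2 * a0) (2 * a1) (a0 + 2 * pi)); [|lra|lra].
  have h2 (z : C) : 2^-1%:C * z + 2^-1%:C * z = z.
    by rewrite -mulrDl -rmorphD (_ : 2^-1 + 2^-1 = 1 :> R) ?rmorph1 ?mul1r//; lra.
  rewrite -[X in _ = X + _]h2 -[X in _ = _ + (_ + (X + _))]h2; ring.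
move=> eta; congr (_ * _); rewrite [pw R 0]expr0z mul1r /stepG.
have [[p _ e]|o] := combo_case eta; first by rewrite !e.
by rewrite !(combo_out _ o) mul0r.
Qed.

Lemma corr_far (d : int) th : 1 < d -> corr stepG d th = 0.
Proof.
move=> d1; rewrite /corr (@eq_Cintegral _ _ (fun eta => 0 * expi (th * eta))).
  rewrite /Cintegral (_ : (fun x => _) = fun=> 0); last by apply/funext => x; rewrite mul0r.
  rewrite (_ : (fun x => Im _) = fun=> 0); last by apply/funext => x; rewrite mul0r.
  by rewrite Rintegral_cst// mul0r.
move=> eta; rewrite stepG_dilate; last by lia.
by rewrite gt_eqF.
Qed.

(** The overlaps of A with 2A and of B with 2B count with opposite signs, and B is
the translate of A by T. *)
Lemma corr_near th : corr stepG 1 th = 2^-1%:C * (1 - expi (th * T)) * itv_int a0 a1 th.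
Proof.
rewrite /corr (@eq_Cintegral _ _ (fun eta => combo c1 eta * expi (th * eta))).
  by rewrite combo_int /= itv_int_shift; ring.
by move=> eta; rewrite stepG_dilate.
Qed.

Lemma corr1G (d q : int) : 0 < d -> corr stepG d q%:~R = 0.
Proof.
move=> d0; case: (ltP 1 d) => d1; first exact: corr_far.
have -> : d = 1 by lia.
by rewrite corr_near expi_T subrr mulr0 mul0r.
Qed.

(** Translation by - (sh p) T brings p into the period ]a0, a0 + 2 pi]. *)
Definition sh p : nat := match p with PA | P2A => 0 | PB => 1 | _ => 2 end.

Let D : set (R -> C) := clspan (range (Gd stepG)).
Let L1G : CL 1 stepG := combo_L1 cG.
Let L2G : CL 2 stepG := combo_L2 cG.
Let subG : range (Gd stepG) `<=` CL 2. Proof. by move=> _ [p _ <-]; exact: L2_Gd. Qed.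

Lemma arc_stepG a b p eta : a0 <= a -> a < b -> b <= a0 + 2 * pi -> b - a < 2 * pi ->
  lo p < eta <= hi p ->
  arcG stepG ((a + b) / 2) ((b - a) / 2) eta =
    if a < eta - (sh p)%:R * T < b then cG p else 0.
Proof.
move=> ha ab hb ba hp; rewrite /arcG /stepG (combo_in _ hp).
have := @arc_window R a0 a b (eta - (sh p)%:R * T) (sh p * n)%N ab ha hb ba.
rewrite [X in cos (X - _)](_ : _ = eta) => [->//|]; last first.
  by rewrite TE -[(sh p * n)%N%:~R]/((sh p * n)%N%:R) natrM; ring.
move: (ordering) => [? ? ? ? ?]; move: hp.
by case: p => /= /andP[h1 h2]; apply/andP; split; lra.
Qed.

Lemma arc_stepG_out a b eta : (forall p, ~~ (lo p < eta <= hi p)) ->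
  arcG stepG ((a + b) / 2) ((b - a) / 2) eta = 0.
Proof. by move=> o; rewrite /arcG /stepG (combo_out _ o) if_same. Qed.

Lemma arc_stepG_span a b j : a < b -> b - a < 2 * pi ->
  D (fun xi => arcG stepG ((a + b) / 2) ((b - a) / 2) ((pw R j)^-1 * xi)).
Proof.
move=> ab ba; apply: (arc_span L2G).
by apply/andP; split; lra.
Qed.

Lemma cindE_oo (a b x : R) : cind `]a, b[ x = (if a < x < b then 1 else 0).
Proof.
case: ifPn => h; first by rewrite cindT//= in_itv.
by rewrite cindF//= in_itv/=; exact/negP.
Qed.

Lemma arc_F1 a b x : a1 <= a -> a < b -> b <= 2 * a0 ->
  arcG stepG ((a + b) / 2) ((b - a) / 2) x = cind `]a + 2 * T, b + 2 * T[ x.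
Proof.
move: (ordering) => [? ? ? ? ?] ha ab hb; rewrite cindE_oo.
have [[p hp _]|o] := combo_case x; last first.
  rewrite arc_stepG_out// ifF//; apply/negbTE/negP => /andP[k1 k2].
  by case/negP: (o PF1); apply/andP; split => /=; lra.
rewrite (arc_stepG (p := p))//; [|lra|lra|lra].
move: hp; case: p => /= /andP[h1 h2]; last 2 first.
- by rewrite ltrBrDr ltrBlDr.
all: rewrite !ifF//; apply/negbTE/negP => /andP[k1 k2]; lra.
Qed.

Lemma arc_F2 a b x : 2 * a1 <= a -> a < b -> b <= a0 + 2 * pi ->
  arcG stepG ((a + b) / 2) ((b - a) / 2) x = cind `]a + 2 * T, b + 2 * T[ x.
Proof.
move: (ordering) => [? ? ? ? ?] ha ab hb; rewrite cindE_oo.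
have [[p hp _]|o] := combo_case x; last first.
  rewrite arc_stepG_out// ifF//; apply/negbTE/negP => /andP[k1 k2].
  by case/negP: (o PF2); apply/andP; split => /=; lra.
rewrite (arc_stepG (p := p))//; [|lra|lra].
move: hp; case: p => /= /andP[h1 h2]; last first.
- by rewrite ltrBrDr ltrBlDr.
all: rewrite !ifF//; apply/negbTE/negP => /andP[k1 k2]; lra.
Qed.

Lemma arc_A a b x : a0 <= a -> a < b -> b <= a1 ->
  arcG stepG ((a + b) / 2) ((b - a) / 2) x =
  rt * (cind `]a, b[ x + cind `]a + T, b + T[ x).
Proof.
move: (ordering) => [? ? ? ? ?] ha ab hb; rewrite !cindE_oo.
have [[p hp _]|o] := combo_case x; last first.
  rewrite arc_stepG_out// !ifF ?addr0 ?mulr0//; apply/negbTE/negP => /andP[k1 k2].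
    by case/negP: (o PB); apply/andP; split => /=; lra.
  by case/negP: (o PA); apply/andP; split => /=; lra.
rewrite (arc_stepG (p := p))//; [|lra|lra].
move: hp; case: p => /= /andP[h1 h2].
- rewrite mul0r subr0 (_ : (a + T < x < b + T) = false).
    by rewrite addr0; case: ifP; rewrite ?mulr1 ?mulr0.
  by apply/negbTE/negP => /andP[k1 k2]; lra.
- rewrite mul1r ltrBrDr ltrBlDr (_ : (a < x < b) = false).
    by rewrite add0r; case: ifP; rewrite ?mulr1 ?mulr0.
  by apply/negbTE/negP => /andP[k1 k2]; lra.
all: rewrite !ifF ?addr0 ?mulr0//; apply/negbTE/negP => /andP[k1 k2]; lra.
Qed.

Lemma arc_2A a b x : a0 <= a -> a < b -> b <= a1 ->
  arcG stepG ((2 * a + 2 * b) / 2) ((2 * b - 2 * a) / 2) (2 * x) =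
  rt * (cind `]a, b[ x - cind `]a + T, b + T[ x).
Proof.
move: (ordering) => [? ? ? ? ?] ha ab hb; rewrite !cindE_oo.
have [[p hp _]|o] := combo_case (2 * x); last first.
  rewrite arc_stepG_out// !ifF ?subr0 ?mulr0//; apply/negbTE/negP => /andP[k1 k2].
    by case/negP: (o P2B); apply/andP; split => /=; lra.
  by case/negP: (o P2A); apply/andP; split => /=; lra.
rewrite (arc_stepG (p := p))//; [|lra|lra|lra|lra].
have e1 : (2 * a < 2 * x < 2 * b) = (a < x < b) by rewrite !ltr_pM2l.
have e2 : (2 * a < 2 * x - 2 * T < 2 * b) = (a + T < x < b + T).
  by rewrite -mulrBr !ltr_pM2l// ltrBrDr ltrBlDr.
move: hp; case: p => /= /andP[h1 h2].
3: rewrite mul0r subr0 e1 (_ : (a + T < x < b + T) = false).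
3: by rewrite subr0; case: ifP; rewrite ?mulr1 ?mulr0.
3: by apply/negbTE/negP => /andP[k1 k2]; lra.
3: rewrite e2 (_ : (a < x < b) = false).
3: by rewrite sub0r; case: ifP; rewrite ?mulrN ?mulr1 ?mulr0 ?oppr0.
3: by apply/negbTE/negP => /andP[k1 k2]; lra.
all: rewrite !ifF ?subr0 ?mulr0//; apply/negbTE/negP => /andP[k1 k2]; lra.
Qed.

(** Level j gives the sum and level j - 1 the difference of the two indicator
functions, both with the factor 1/sqrt 2. *)
Lemma pieces_AB a b j : a0 <= a -> a < b -> b <= a1 ->
  D (fun xi => cind `]a, b[ ((pw R j)^-1 * xi)) /\
  D (fun xi => cind `]a + T, b + T[ ((pw R j)^-1 * xi)).
Proof.
move: (ordering) => [? ? ? ? ?] ha ab hb.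
pose y xi := (pw R j)^-1 * xi.
have Dp : D (fun xi => rt * (rt * (cind `]a, b[ (y xi) + cind `]a + T, b + T[ (y xi)))).
  apply: clspanZ => //; rewrite (_ : (fun xi => _) = fun xi => arcG stepG ((a + b) / 2) ((b - a) / 2) (y xi)); last first.
    by apply/funext => xi; rewrite arc_A.
  by apply: arc_stepG_span => //; lra.
have Dm : D (fun xi => rt * (rt * (cind `]a, b[ (y xi) - cind `]a + T, b + T[ (y xi)))).
  apply: clspanZ => //; rewrite (_ : (fun xi => _) = fun xi =>
    arcG stepG ((2 * a + 2 * b) / 2) ((2 * b - 2 * a) / 2) ((pw R (j - 1))^-1 * xi)).
    by apply: arc_stepG_span; lra.
  apply/funext => xi; rewrite -arc_2A//; congr arcG; rewrite /y (pw_pred j) mulrA; congr (_ * _).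
  by rewrite invfM mulrA mulfV ?mul1r.
have half (z : C) : rt * (rt * z) + rt * (rt * z) = z.
  rewrite !mulrA rt_sq -mulrDl -rmorphD (_ : 2^-1 + 2^-1 = 1 :> R) ?rmorph1 ?mul1r//; lra.
split.
  have := clspanD subG Dp Dm; congr D; apply/funext => xi /=.
  by rewrite -[RHS]half /y; ring.
have := clspanB subG Dp Dm; congr D; apply/funext => xi /=.
by rewrite -[RHS]half /y; ring.
Qed.

(** The octave is tiled by 2^j A and by the dilates by 2^(j - s) of F1, 2B and F2;
the dilate of 2B is reached as a dilate of B one level higher. *)
Lemma good_octave j : good stepG (pw R j * a0) (pw R (j + 1) * a0).
Proof.
move: (ordering) => [? ? ? ? ?].
have js k : pw R (j - s) * (pw R s * k) = pw R j * k by rewrite mulrA -pwD subrK.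
have js1 k : pw R (j - s + 1) * k = pw R (j - s) * (2 * k) by rewrite pwD pw1 mulrA.
have gA : good stepG (pw R j * a0) (pw R j * a1).
  by apply: good_piece => // a b ha ab hb; case: (pieces_AB j ha ab hb).
have gB : good stepG (pw R (j - s + 1) * (a0 + T)) (pw R (j - s + 1) * (a1 + T)).
  apply: good_piece => // a b ha ab hb.
  have ha' : a0 <= a - T by lra.
  have ab' : a - T < b - T by lra.
  have hb' : b - T <= a1 by lra.
  by have [_] := pieces_AB (j - s + 1) ha' ab' hb'; rewrite !subrK.
have gF1 : good stepG (pw R (j - s) * (a1 + 2 * T)) (pw R (j - s) * (2 * a0 + 2 * T)).
  apply: good_piece => // a b ha ab hb.
  have := @arc_stepG_span (a - 2 * T) (b - 2 * T) (j - s).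
  under [in X in _ -> _ -> D X]eq_fun do (rewrite arc_F1; [|lra|lra|lra]).
  by rewrite !subrK; apply; lra.
have gF2 : good stepG (pw R (j - s) * (2 * a1 + 2 * T)) (pw R (j - s) * (a0 + 2 * pi + 2 * T)).
  apply: good_piece => // a b ha ab hb.
  have := @arc_stepG_span (a - 2 * T) (b - 2 * T) (j - s).
  under [in X in _ -> _ -> D X]eq_fun do (rewrite arc_F2; [|lra|lra|lra]).
  by rewrite !subrK; apply; lra.
rewrite !js1 !(mulrDr 2) in gB.
have p0 := pw_gt0 R (j - s).
have -> : pw R (j + 1) * a0 = pw R (j - s) * (a0 + 2 * pi + 2 * T).
  by rewrite -pw_a0 js pwD pw1 mulrA.
have e1 : pw R j * a1 = pw R (j - s) * (a1 + 2 * T) by rewrite -pw_a1 js.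
have le_oct : pw R j * a0 <= pw R j * a1 by rewrite ler_pM2l ?pw_gt0// ltW.
apply: (good_trans L2G le_oct _ gA); first by rewrite e1 ler_pM2l//; lra.
rewrite e1; apply: (good_trans L2G _ _ gF1); [by rewrite ler_pM2l//; lra..|].
by apply: (good_trans L2G _ _ gB) => //; rewrite ler_pM2l//; lra.
Qed.

Lemma stepG_le0 x : x <= 0 -> stepG x = 0.
Proof.
move: (ordering) => [? ? ? ? ?] x0; apply: combo_out => p.
by apply/negP => /andP[+ _]; case: p => /=; lra.
Qed.

Lemma stepG_complete h : CL 2 h -> (forall xi, xi <= 0 -> h xi = 0) -> D h.
Proof. by apply: (complete_of_good L2G a0_gt0) => j; exact: good_octave. Qed.

Lemma stepG_wavelet : H2_wavelet (phi stepG).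
Proof. exact: (phiG_wavelet L1G L2G stepG_le0 corr0G corr1G stepG_complete). Qed.

Lemma stepG_invariant (m : int) f : V0 (phi stepG) f ->
  V0 (phi stepG) (translation (m%:~R / n%:R) f).
Proof.
apply: (translation_V0 L1G L2G stepG_le0 corr0G corr1G stepG_complete) => d j q j0 jd.
case: (ltP 1 d) => d1; first exact: corr_far.
have -> : d = 1 by lia.
have -> : j = 0 by lia.
rewrite corr_near [pw R 0]expr0z mulr1.
have -> : (q%:~R - m%:~R / n%:R) * T = (q * n%:Z - m)%:~R * (2 * pi).
  by rewrite TE intrB intrM; field; rewrite pnatr_eq0 -lt0n.
by rewrite expi2piz subrr mulr0 mul0r.
Qed.

(** Here exp (i th T) = -1, and A is shorter than 2 pi n. *)
Lemma stepG_not_invariant :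
  ~ (forall f, V0 (phi stepG) f -> V0 (phi stepG) (translation (2 * n%:R)^-1 f)).
Proof.
move: (ordering) => [? ? ? ? ?].
have n1 : 1 <= n%:R :> R by rewrite ler1n.
have n2 : 0 < 2 * n%:R :> R by rewrite mulr_gt0// ltr0n.
move=> /(translation_V0_inv L1G L2G stepG_le0 corr0G corr1G stepG_complete).
rewrite corr_near (_ : - _ * T = - pi); last by rewrite TE; field; rewrite pnatr_eq0 -lt0n.
rewrite expiN /expi cospi sinpi => /eqP; apply/negP.
rewrite mulf_neq0//; last first.
  apply: itv_int_neq0 => //; rewrite normrN ger0_norm ?invr_ge0 ?(ltW n2)//.
  apply/andP; split; first by rewrite mulr_gt0 ?invr_gt0// subr_gt0.
  rewrite mulrC ltr_pdivrMr//.
  have : pi <= pi * n%:R :> R by rewrite ler_peMr ?pi_ge0.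
  lra.
rewrite (_ : _ * _ = 1) ?oner_neq0//.
by apply: Ceq; rewrite !ReImE/= ?ReImE/=; lra.
Qed.

End Finite.

(** * A wavelet invariant under all translations *)
Section Infinite.
Variable R : realType.
Local Notation C := R[i].

Definition bandG : R -> C := cind `]2 * pi, 4 * pi].

Let L1G : CL 1 bandG := L1_itv _ _.
Let L2G : CL 2 bandG := L2_itv _ _.
Let p0 : 0 < pi :> R := pi_gt0 R.

Lemma bandG_le0 (x : R) : x <= 0 -> bandG x = 0.
Proof.
by move: p0 => ? x0; rewrite /bandG cindE_itv ifF//; apply/negbTE/negP => /andP[h _]; lra.
Qed.

(** The band and its dilates by 2^d with d > 0 are disjoint. *)
Lemma bandG_corr (d : int) th : 0 < d -> corr bandG d th = 0.
Proof.
move=> d0; rewrite /corr (@eq_Cintegral _ _ (fun x => 0 * (bandG x * expi (th * x)))).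
  rewrite (@CintegralZ _ 0) ?mul0r//; exact: itv_int_integrable.
move=> x; rewrite mul0r [bandG x]cindE_itv; case: ifP => [/andP[x1 x2]|_]; last first.
  by rewrite conjc0 mulr0 mul0r.
rewrite [bandG _]cindE_itv ifF ?mul0r//; apply/negbTE/negP => /andP[_ h].
have : 2 * x <= pw R d * x.
  rewrite ler_pM2r; last by move: p0 => ?; lra.
  by case: d d0 {h} => // -[//|d] _; rewrite /pw -exprnP exprS ler_peMr// exprn_ege1// ler1n.
by lra.
Qed.

Lemma bandG_corr0 (q : int) : corr bandG 0 q%:~R = (2 * pi)%:C * (q == 0)%:R.
Proof.
rewrite -(itv_int_period (2 * pi) q) (_ : 2 * pi + 2 * pi = 4 * pi); last by ring.
apply: eq_Cintegral => x; rewrite [pw R 0]expr0z mul1r; congr (_ * _).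
rewrite /bandG cindE_itv; case: ifP; rewrite ?conjc0 ?conjc1 ?mulr0 ?mulr1//.
Qed.

Lemma arc_bandG a b x : 2 * pi <= a -> a < b -> b <= 4 * pi -> b - a < 2 * pi ->
  arcG bandG ((a + b) / 2) ((b - a) / 2) x = cind `]a, b[ x.
Proof.
move: p0 => p0' ha ab hb ba; rewrite /arcG /bandG cindE_itv cindE_oo.
have b4 : b <= 2 * pi + 2 * pi by lra.
have := @arc_window R (2 * pi) a b x 0 ab ha b4 ba; rewrite mul0r addr0.
have [/andP[x1 x2] ->//|xn _] := boolP (2 * pi < x <= 4 * pi); first by apply/andP; split; lra.
rewrite if_same ifF//; apply/negbTE/negP => /andP[x1 x2].
by case/negP: xn; apply/andP; split; lra.
Qed.

(** An arc has to be shorter than the period, so the band, which is a whole period,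
is cut into two halves. *)
Lemma bandG_complete h : CL 2 h -> (forall xi, xi <= 0 -> h xi = 0) ->
  clspan (range (Gd bandG)) h.
Proof.
move: (p0) => p0'; have pp : 0 < 2 * pi :> R by lra.
apply: (complete_of_good L2G pp) => j.
have half u v : 2 * pi <= u -> v <= 4 * pi -> v - u < 2 * pi ->
    good bandG (pw R j * u) (pw R j * v).
  move=> hu hv uv; apply: good_piece => // a b ha ab hb.
  rewrite (_ : (fun xi => _) = fun xi => arcG bandG ((a + b) / 2) ((b - a) / 2) ((pw R j)^-1 * xi)).
    by apply: (arc_span L2G); apply/andP; split; lra.
  by apply/funext => xi; rewrite arc_bandG//; lra.
rewrite pwD [pw R 1]expr1z -mulrA (_ : 2 * (2 * pi) = 4 * pi :> R); last by ring.
apply: (good_trans L2G (v := pw R j * (3 * pi))).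
- by rewrite ler_pM2l ?pw_gt0//; lra.
- by rewrite ler_pM2l ?pw_gt0//; lra.
- by apply: half; lra.
- by apply: half; lra.
Qed.

Let corr1 (d q : int) (d0 : 0 < d) : corr bandG d q%:~R = 0 := bandG_corr q%:~R d0.

Lemma bandG_wavelet : H2_wavelet (phi bandG).
Proof. exact: (phiG_wavelet L1G L2G bandG_le0 bandG_corr0 corr1 bandG_complete). Qed.

Lemma bandG_invariant y f : V0 (phi bandG) f -> V0 (phi bandG) (translation y f).
Proof.
apply: (translation_V0 L1G L2G bandG_le0 bandG_corr0 corr1 bandG_complete) => d j q j0 jd.
by apply: bandG_corr; lia.
Qed.

End Infinite.

(** * The classes are non-empty *)
Theorem theorem6 (R : realType) (r : option nat) : @calM R r !=set0.
Proof.
case: r => [N|]; last first.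
  exists (phi (@bandG R)); split; first exact: bandG_wavelet.
  by move=> _ [y _ <-] f; exact: bandG_invariant.
have [p0 x1] : 0 < pi :> R /\ 1 <= (2 ^ N)%:R :> R by rewrite pi_gt0 ler1n expn_gt0.
pose x : R := (2 ^ N)%:R; rewrite -/x in x1.
pose T := x * (2 * pi).
(* the solutions of 2^(N+2) a1 = a1 + 2 T and 2^(N+2) (2 a0) = a0 + 2 pi + 2 T,
   where 2^(N+2) = 4 x *)
pose a1 := 2 * T / (4 * x - 1); pose a0 := (2 * T + 2 * pi) / (8 * x - 1).
have d1 : 0 < 4 * x - 1 by lra.
have d0 : 0 < 8 * x - 1 by lra.
have xp : pi <= x * pi by rewrite ler_peMl// ltW.
have h0 : 0 < a0 by rewrite /a0 divr_gt0// /T; lra.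
have h01 : a0 < a1.
  rewrite /a0 /a1 /T ltr_pdivrMr// mulrAC ltr_pdivlMr//.
  nra.
have h1 : a1 < 2 * a0.
  rewrite (_ : 2 * a0 = 2 * (2 * T + 2 * pi) / (8 * x - 1)); last by rewrite /a0 mulrA.
  rewrite /a1 /T ltr_pdivrMr// mulrAC ltr_pdivlMr//; nra.
have ht : 2 * a1 < a0 + 2 * pi.
  rewrite (_ : 2 * a1 = 2 * (2 * T) / (4 * x - 1)); last by rewrite /a1 mulrA.
  rewrite (_ : a0 + 2 * pi = (2 * T + 2 * pi + 2 * pi * (8 * x - 1)) / (8 * x - 1)); last first.
    by rewrite /a0; field; lra.
  rewrite /T ltr_pdivrMr// mulrAC ltr_pdivlMr//; nra.
have pwN2 : pw R (N%:Z + 2) = 4 * x.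
  rewrite pwD /pw -!exprnP /x natrX -natrX; ring.
have e1 : pw R (N%:Z + 2) * a1 = a1 + 2 * T.
  by rewrite pwN2 /a1; field; lra.
have e0 : pw R (N%:Z + 2) * (2 * a0) = a0 + 2 * pi + 2 * T.
  by rewrite pwN2 /a0; field; lra.
have n0 : (0 < 2 ^ N)%N by rewrite expn_gt0.
have s2 : 2 <= N%:Z + 2 by lia.
have TE : T = (2 ^ N)%:R * (2 * pi) by [].
exists (phi (stepG a0 a1 T)); split; first split.
- exact: (stepG_wavelet TE n0 s2 h0 h01 h1 ht e1 e0).
- move=> _ [m _ <-] f; rewrite -natrX; exact: (stepG_invariant TE n0 s2 h0 h01 h1 ht e1 e0).
- move=> [_ inv]; apply: (stepG_not_invariant TE n0 s2 h0 h01 h1 ht e1 e0) => f.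
  apply: inv; exists 1 => //; rewrite /translation; apply/funext => g; apply/funext => t.
  by rewrite exprS -natrX mul1r.
Qed.
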